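(* Let $(\sigma,\alpha)\in Z_k\times W_k$ be such that $Z(\sigma,\alpha)\subseteq\mathfrak{n}$. Then: 1. $T_k(\sigma,\alpha)=T_p(Z(\sigma,\alpha))$. 2. $Z(\sigma,\alpha)$ is regular if and only if $|t_k(\sigma,\alpha)|=l(\sigma)+l(\alpha)$.
   Context: $K$ is an algebraically closed field of characteristic zero; $G=\mathrm{GL}_n(K)$, $B\subseteq G$ the upper-triangular Borel subgroup, $W=S_n$, $s_i=(i\ i+1)$, $l$ the Bruhat (Coxeter) length and $\prec$ the (reflexive) Bruhat order on $W$; $\dot w$ is the permutation matrix of $w\in W$, $\dot we_i=e_{w(i)}$. $\mathfrak{n}\subseteq\mathfrak{gl}_n$ is the space of strictly upper-triangular matrices. $E_{r,s}$ denotes the elementary matrix with $E_{r,s}e_m=\delta_{s,m}e_r$. Fix $k$ with $0\le 2k\le n$. Let $x_k=\sum_{r=1}^kE_{r,r+n-k}$, $\mathbb{O}_k=\{u\in\mathfrak{gl}_n\mid u^2=0,\ \mathrm{rk}(u)=k\}=G.x_k$ (conjugation), $C_k=\mathrm{Stab}_G(x_k)$, and identify $G/C_k\simeq\mathbb{O}_k$ via $gC_k\mapsto gx_kg^{-1}$. Let $P_k\supseteq B$ be the parabolic subgroup corresponding to the simple reflections $\{s_i\mid i\notin\{k,n-k\}\}$, with Weyl group of its Levi factor $W(L)=\langle s_i\mid i\notin\{k,n-k\}\rangle$. Let $W(C_k)\subseteq W(L)$ be the Weyl group of the reductive part of $C_k$, i.e. the subgroup of those $w\in W(L)$ with $w(n-k+i)=n-k+w(i)$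 for $i=1,\dots,k$. $W_k=\langle s_1,\dots,s_{k-1}\rangle$; $Z_k=\{\sigma\in W\mid l(\sigma s_i)=l(\sigma)+1\text{ for all } i\in\{1,\dots,n-1\}\setminus\{k,n-k\}\}$. For $(\sigma,\alpha)\in Z_k\times W_k$, $Z(\sigma,\alpha)$ is the closure in $\mathbb{O}_k$ of the $B$-orbit $B\dot\sigma\dot\alpha C_k/C_k$. $Y^0=B.x_k=BC_k/C_k$ is the minimal $B$-orbit; it is contained in every $Z(\sigma,\alpha)$. Put $p=\mathrm{id}\,C_k\in Y^0$ (i.e. $p=x_k$). For $w\in W$ write $wW(C_k)\prec\sigma\alpha W(C_k)$ if there is $\tau\in wW(C_k)$ with $\tau\prec\sigma\alpha$. Positive roots: $\phi^+=\{(i,j)\mid 1\le i<j\le n\}$; for $\epsilon=(i,j)$ let $r_\epsilon\in W$ be the transposition $(i\ j)$, $u_{-\epsilon}(t)=\mathrm{id}+tE_{j,i}$ and $U_{-\epsilon}=\{u_{-\epsilon}(t)\mid t\in K\}$. Let $\phi^+(\mathrm{GL}_k)=\{(i,j)\mid 1\le i<j\le k\}$, $\phi^+(P_k)=\{\epsilon\in\phi^+\mid U_{-\epsilon}\not\subseteq P_k\}$, $\phi^+(C_k)=\phi^+(\mathrm{GL}_k)\sqcup\phi^+(P_k)$. For $\epsilon\in\phi^+(C_k)$ let $C(\epsilon)=\{u_{-\epsilon}(t)C_k\mid t\in K\}\subseteq G/C_k$ (this is isomorphic to an affine line through $p$). Let $t_k(\sigma,\alpha)=\{\epsilon\in\phi^+(C_k)\mid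 r_\epsilon W(C_k)\prec\sigma\alpha W(C_k)\}$; for $\epsilon\in t_k(\sigma,\alpha)$ one has $C(\epsilon)\subseteq Z(\sigma,\alpha)$. Finally $$T_k(\sigma,\alpha)=T_p(Y^0)\oplus\bigoplus_{\epsilon\in t_k(\sigma,\alpha)}T_p(C(\epsilon))\subseteq T_p(Z(\sigma,\alpha)).$$ *)

(* Defs.v *)
From HB Require Import structures.
From mathcomp Require Import all_boot all_order all_algebra all_fingroup.
From mathcomp Require Import boolp.
From mathcomp Require Import mpoly.

Set Implicit Arguments.
Unset Strict Implicit.
Unset Printing Implicit Defensive.

Import GRing.Theory.
Local Open Scope ring_scope.

(* Indices are 0-based: the 'I_n-element i stands for i + 1 in {1, ..., n}.   *)

(* ---------- The symmetric group as a Coxeter group ------------------------ *)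

(* Product of permutations as functions: (wcomp s t) i = s (t i).  MathComp's *)
(* own product on 'S_n composes in the opposite order.                        *)
Definition wcomp n (s t : 'S_n) : 'S_n := (t * s)%g.

(* { s_i | 1 <= i <= n - 1, I i }, where s_i exchanges the 0-based indices    *)
(* i - 1 and i.                                                               *)
Definition simples n (I : pred nat) : {set 'S_n} :=
  [set s : 'S_n | [exists a : 'I_n, [exists b : 'I_n,
     [&& b == a.+1 :> nat, I b & s == tperm a b]]]].

Lemma simples_gen n : <<simples n predT>>%g = [set: 'S_n].
Proof.
case: n => [|n].
  by apply/setP=> s; rewrite inE (_ : s = 1%g) ?group1 //; apply/permP; case.
apply/eqP; rewrite eqEsubset subsetT /= -(gen_tperm ord0) gen_subG.
apply/subsetP => _ /imsetP[[j lt_jn] _ ->].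
elim: j lt_jn => [|j IHj] lt_jn.
  by rewrite (_ : Ordinal lt_jn = ord0) ?tperm1 ?group1 //; apply: val_inj.
have lt_j := ltnW lt_jn.
have Sj : tperm (Ordinal lt_j) (Ordinal lt_jn) \in <<simples n.+1 predT>>%g.
  apply: mem_gen; rewrite inE; apply/existsP; exists (Ordinal lt_j).
  by apply/existsP; exists (Ordinal lt_jn); rewrite /= !eqxx.
case: j => [|j] in lt_jn lt_j IHj Sj *.
  by rewrite (_ : ord0 = Ordinal lt_j) //; apply: val_inj.
have -> : tperm ord0 (Ordinal lt_jn) =
  (tperm ord0 (Ordinal lt_j) ^ tperm (Ordinal lt_j) (Ordinal lt_jn))%g.
  by rewrite tpermJ tpermL tpermD.
by rewrite groupJ // IHj.
Qed.

(* (S ^+ m) is the set of products of m elements of S. *)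
Lemma coxlen_subproof n (w : 'S_n) :
  exists m, w \in (simples n predT ^+ m)%g.
Proof.
have : w \in <<simples n predT>>%g by rewrite simples_gen inE.
case/gen_prodgP=> m [c Sc ->]; exists m.
elim: m c Sc => [|m IHm] c Sc; first by rewrite big_ord0 expg0 inE.
by rewrite big_ord_recl expgS mem_mulg // IHm.
Qed.

Definition coxlen n (w : 'S_n) : nat := ex_minn (coxlen_subproof w).

(* Bruhat order: reflexive-transitive closure of u < u (a b) whenever this    *)
(* increases the length.                                                      *)
Definition bruhat_step n : rel 'S_n := fun u v =>
  [exists a : 'I_n, [exists b : 'I_n,
     (v == wcomp u (tperm a b)) && (coxlen u < coxlen v)%N]].
Definition bruhat n : rel 'S_n := connect (@bruhat_step n).

Section Combinatorics.
Variables n k : nat.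

Definition levi_index : pred nat := fun i => (i != k) && (i != (n - k)%N).

Definition WL : {set 'S_n} := <<simples n levi_index>>%g.

Definition WC : {set 'S_n} :=
  [set w in WL | [forall i : 'I_n, [forall j : 'I_n,
     ((i < k)%N && (j == (n - k + i)%N :> nat))
       ==> (w j == (n - k + w i)%N :> nat)]]].

Definition Wk : {set 'S_n} := <<simples n (fun i => i < k)%N>>%g.

Definition Zk : {set 'S_n} :=
  [set s : 'S_n | [forall t in simples n levi_index,
     coxlen (wcomp s t) == (coxlen s).+1]].

(* w WC < v WC *)
Definition coset_bruhat (w v : 'S_n) : bool :=
  [exists c in WC, bruhat (wcomp w c) v].

Definition phi_plus : {set 'I_n * 'I_n} := [set e : 'I_n * 'I_n | (e.1 < e.2)%N].

Definition phi_GL : {set 'I_n * 'I_n} :=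
  [set e : 'I_n * 'I_n in phi_plus | (e.2 < k)%N].

End Combinatorics.

(* ---------- Zariski geometry in the affine space of n x n matrices -------- *)

Section Zariski.
Variables (K : closedFieldType) (n : nat).

Definition mxeval (f : {mpoly K[n * n]}) (A : 'M[K]_n) : K :=
  f.@[fun i => mxvec A 0 i].

(* The differential of f at A, applied to v. *)
Definition mxdiff (f : {mpoly K[n * n]}) (A v : 'M[K]_n) : K :=
  \sum_(i < n * n) mxeval (mderiv i f) A * mxvec v 0 i.

Definition vanishes_on (X : 'M[K]_n -> Prop) (f : {mpoly K[n * n]}) : Prop :=
  forall A, X A -> mxeval f A = 0.

(* Closure of X in the subspace Y. *)
Definition zclosure_in (Y X : 'M[K]_n -> Prop) (A : 'M[K]_n) : Prop :=
  Y A /\ forall f, vanishes_on X f -> mxeval f A = 0.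

Lemma tangent_subproof (X : 'M[K]_n -> Prop) (p : 'M[K]_n) :
  exists U : {vspace 'M[K]_n}, forall v,
    v \in U <-> (forall f, vanishes_on X f -> mxdiff f p v = 0).
Proof.
set P := fun v => forall f, vanishes_on X f -> mxdiff f p v = 0.
have P0 : P 0.
  by move=> f _; rewrite /mxdiff big1 // => i _; rewrite linear0 mxE mulr0.
have PD a u v : P u -> P v -> P (a *: u + v).
  move=> Pu Pv f fX; rewrite /mxdiff.
  under eq_bigr => i _ do rewrite linearP !mxE mulrDr mulrCA.
  rewrite big_split /= -mulr_sumr.
  by have := Pu f fX; have := Pv f fX; rewrite /mxdiff => -> ->; rewrite mulr0 addr0.
pose Q d := `[< exists2 U : {vspace 'M[K]_n},
                 (forall v, v \in U -> P v) & \dim U = d >].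
have exQ : exists d, Q d.
  exists 0%N; apply/asboolP; exists 0%VS; last exact: dimv0.
  by move=> v; rewrite memv0 => /eqP->.
have ubQ d : Q d -> (d <= \dim {:'M[K]_n})%N.
  by case/asboolP=> U _ <-; apply/dimvS/subvf.
case: (ex_maxnP exQ ubQ) => d /asboolP[U UP dU] maxd.
exists U => v; split=> [/UP//|Pv].
have QUv : Q (\dim (U + <[v]>)%VS).
  apply/asboolP; exists (U + <[v]>)%VS => // w /memv_addP[u Uu].
  by case=> _ /vlineP[a ->] ->; rewrite addrC; apply: PD => //; apply: UP.
have /eqP-> : U == (U + <[v]>)%VS by rewrite eqEdim addvSl dU maxd.
by rewrite memvE addvSr.
Qed.

(* Embedded Zariski tangent space at p of a locally closed X containing p     *)
(* (with its reduced structure); polynomials vanishing on X are those         *)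
(* vanishing on its closure, in which X is open.                              *)
Definition tangent (X : 'M[K]_n -> Prop) (p : 'M[K]_n) : {vspace 'M[K]_n} :=
  sval (cid (tangent_subproof X p)).

Lemma tangentP X p v :
  v \in tangent X p <-> (forall f, vanishes_on X f -> mxdiff f p v = 0).
Proof. by rewrite /tangent; case: cid => U /= ->. Qed.

(* The functions f_0, ..., f_{d-1} are algebraically independent in the       *)
(* coordinate ring of X.                                                      *)
Definition alg_indep_on (X : 'M[K]_n -> Prop) d
    (f : 'I_d -> {mpoly K[n * n]}) : Prop :=
  forall P : {mpoly K[d]},
    (forall A, X A -> P.@[fun i => mxeval (f i) A] = 0) -> P = 0.

(* dim X = d for an irreducible locally closed X: d is the transcendence      *)
(* degree over K of the function field of X.                                  *)
Definition has_dim (X : 'M[K]_n -> Prop) (d : nat) : Prop :=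
  (exists f : 'I_d -> {mpoly K[n * n]}, alg_indep_on X f) /\
  (forall m (f : 'I_m -> {mpoly K[n * n]}), alg_indep_on X f -> (m <= d)%N).

(* To be used for irreducible X only (orbit closures of the connected group B *)
(* are irreducible), where every local ring at a point has dimension dim X.   *)
Definition regular_variety (X : 'M[K]_n -> Prop) : Prop :=
  forall q, X q -> has_dim X (\dim (tangent X q)).

End Zariski.

(* ---------- B-orbits of 2-nilpotent matrices of rank k -------------------- *)

Section Orbits.
Variables (K : closedFieldType) (n k : nat).

Definition borel (b : 'M[K]_n) : Prop :=
  b \in unitmx /\ forall i j : 'I_n, (j < i)%N -> b i j = 0.

Definition strictly_upper (u : 'M[K]_n) : Prop :=
  forall i j : 'I_n, (j <= i)%N -> u i j = 0.

(* The permutation matrix with e_j |-> e_(w j) on column vectors; this is     *)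
(* perm_mx w^-1 in MathComp.                                                  *)
Definition dotmx (w : 'S_n) : 'M[K]_n := \matrix_(i, j) (i == w j)%:R.

Definition conjmx_by (g x : 'M[K]_n) : 'M[K]_n := g *m x *m invmx g.

Definition xk : 'M[K]_n :=
  \matrix_(i, j) ((i < k)%N && (j == (i + (n - k))%N :> nat))%:R.

Definition Ok (u : 'M[K]_n) : Prop := u *m u = 0 /\ \rank u = k.

(* Subsets of G / C_k are written as subsets of Ok through g C_k |-> g xk g^-1. *)

(* B w C_k / C_k *)
Definition Borbit (w : 'S_n) (u : 'M[K]_n) : Prop :=
  exists2 b, borel b & u = conjmx_by (b *m dotmx w) xk.

Definition Y0 : 'M[K]_n -> Prop := Borbit 1%g.

Definition Zvar (s a : 'S_n) : 'M[K]_n -> Prop :=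
  zclosure_in Ok (Borbit (wcomp s a)).

Definition Pk (g : 'M[K]_n) : Prop :=
  exists w b1 b2,
    [/\ w \in WL n k, borel b1, borel b2 & g = b1 *m dotmx w *m b2].

Definition uneg (e : 'I_n * 'I_n) (t : K) : 'M[K]_n :=
  1%:M + t *: delta_mx e.2 e.1.

Definition phi_P : {set 'I_n * 'I_n} :=
  [set e : 'I_n * 'I_n in phi_plus n | `[< ~ forall t, Pk (uneg e t) >]].

Definition phi_C : {set 'I_n * 'I_n} := phi_GL n k :|: phi_P.

Definition Ccurve (e : 'I_n * 'I_n) (u : 'M[K]_n) : Prop :=
  exists t, u = conjmx_by (uneg e t) xk.

Definition tk (s a : 'S_n) : {set 'I_n * 'I_n} :=
  [set e : 'I_n * 'I_n in phi_C | coset_bruhat k (tperm e.1 e.2) (wcomp s a)].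

End Orbits.

(* Main.v *)
(* Let v = sigma alpha, x = x_k and, for e = (i, j), d_e = [E_{j,i}, x].

   Tangent space.  A tangent vector t of Z at x satisfies x t + t x = 0 and is strictly upper
   triangular because Z lies in n, so t lies in the span of T(Y0) and the d_e with e in phi+(C_k),
   and each of its coefficients is, up to sign, a single matrix entry.  If the coefficient of d_e
   is nonzero, then no corner minor (rows >= p, columns < q) whose differential at x is that entry
   vanishes on Z; this says exactly that the corner ranks of r_e x are bounded by those of v x.
   By induction on l(v) along left descents of v, such rank bounds between link patterns w x and
   v x produce an element c of W(C_k) with r_e c <= v.  Conversely r_e c <= v puts C(e) into Z,
   since u <= v in the Bruhat order puts B u B x into the closure of B v B x = B v x.

   Dimension.  With q = v x, the tangent space [b, q] of the orbit B q is the image under v of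
   T(Y0) plus the lines of the d_e, e running over the inversions of v; as l(v) = l(sigma) +
   l(alpha), this gives dim Z = dim T(Y0) + l(sigma) + l(alpha), the transcendence degree being a
   Jacobian rank in characteristic zero.  Every B-orbit of O_k has x in its closure, so by
   semicontinuity dim T_q(Z) lies between dim Z and dim T_x(Z) for all q in Z. *)

Require Import Defs.
From mathcomp Require Import all_boot all_order all_algebra all_fingroup.
From HB Require Import structures.
From mathcomp Require Import boolp mpoly zify ring.
(* Again, because all_algebra exports another [dotmx]. *)
Require Import Defs.

Set Implicit Arguments.
Unset Strict Implicit.
Unset Printing Implicit Defensive.
Import GRing.Theory.

Local Open Scope ring_scope.

(** * Inversions and the Bruhat order *)

Section Inversions.
Local Open Scope nat_scope.
Variable n : nat.
Implicit Types (u v w x y : 'S_n) (a b i j X Y : 'I_n).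

(** The hypothesis Z in n enters at two places: tangent vectors become strictly upper triangular,
    and v x does too, so that corners with p = q have rank zero. In the combinatorial induction the
    corner with both thresholds between two adjacent values is the one that the row and column
    formulas do not reach, and this settles it. For i <= k and j > n - k the vector d_e has two
    nonzero entries, and a corner minor may detect either of them; the relation x t + t x = 0
    identifies the two up to sign. That B v B x = B v x concerns the last k indices only: modulo the
    stabilizer of x, an element of B acts through a matrix differing from 1 in the last k rows, and
    v increases on these indices. For the dimension, conjugation is replaced by b q adj(b), which is
    polynomial in b. The factor det(b) is harmless because a torus multiplies q by any nonzero
    scalar; it leaves a trace term in the derivative, removed with a diagonal matrix H such that
    [H, q] = q. *)

Lemma wcompE u v i : wcomp u v i = u (v i).
Proof. by rewrite permM. Qed.

Lemma wcompA u v w : wcomp u (wcomp v w) = wcomp (wcomp u v) w.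
Proof. by rewrite /wcomp mulgA. Qed.

Definition inv_set w : {set 'I_n * 'I_n} :=
  [set e : 'I_n * 'I_n | (e.1 < e.2) && (w e.2 < w e.1)].

Lemma ord_neq_lt i j : i != j -> (i < j) || (j < i).
Proof. by rewrite -neq_ltn. Qed.

(** Moving a pair along the transposition when it stays ordered, and keeping it otherwise, injects
    the inversions of [u] into those of the product; the pair [(a, b)] is missed. *)
Lemma inv_tperm_lt u a b : a < b -> u a < u b ->
  #|inv_set u| < #|inv_set (wcomp u (tperm a b))|.
Proof.
move=> ab uab; set t := tperm a b.
pose f (e : 'I_n * 'I_n) := if t e.1 < t e.2 then (t e.1, t e.2) else e.
have finj : {in inv_set u &, injective f}.
  move=> [i j] [i' j']; rewrite !inE /f /= => /andP[ij _] /andP[ij' _].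
  case: ifP => h; case: ifP => h' [] // e1 e2.
  - by move: (perm_inj e1) (perm_inj e2) => -> ->.
  - by move: h'; rewrite -e1 -e2 /t !tpermK ij.
  - by move: h; rewrite e1 e2 /t !tpermK ij'.
  - by rewrite e1 e2.
rewrite -(card_in_imset finj).
apply: proper_card; apply/properP; split.
  apply/subsetP => _ /imsetP[[i j] + ->]; rewrite !inE /= => /andP[ij uij].
  rewrite /f /=; case: ifP => h /=; first by rewrite !wcompE /t !tpermK h.
  rewrite ij !wcompE /= -/t; move/negP: h; rewrite /t.
  case: (tpermP a b i) => [Ei|Ei|ia ib]; case: (tpermP a b j) => [Ej|Ej|ja jb];
    subst=> //; lia.
exists (a, b); first by rewrite inE ab !wcompE /t tpermL tpermR.
apply/negP => /imsetP[[i j]]; rewrite inE /f /= => /andP[ij uij].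
case: ifP => h [] e1 e2.
  have ib : i = b by rewrite -(tpermK a b i) -/t -e1 /t tpermL.
  have ja : j = a by rewrite -(tpermK a b j) -/t -e2 /t tpermR.
  by move: ij; rewrite ib ja; lia.
by move: uij; rewrite -e1 -e2; lia.
Qed.

(** The numbers [i] and [u i] have the same sum, so each inequality is an equality. *)
Lemma monotone_perm_id u : (forall i, i <= u i) -> u = 1%g.
Proof.
move=> h.
have /leqif_sum : forall i : 'I_n, true -> i <= u i ?= iff (nat_of_ord i == u i).
  by move=> i _; split => //.
case=> _ /esym; rewrite -(reindex_inj (h := u) perm_inj (P := predT) (F := fun i =>
  nat_of_ord i)) eqxx.
by move=> /forallP e; apply/permP => i; apply/val_inj; rewrite perm1; have /eqP := e i.
Qed.

Lemma adj_increasing_id u :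
  (forall X Y, Y = X.+1 :> nat -> u X < u Y) -> u = 1%g.
Proof.
move=> h; apply: monotone_perm_id => -[i lti] /=.
elim: i lti => // i IH lti; have lti' := ltnW lti.
exact: leq_ltn_trans (IH lti') (h (Ordinal lti') (Ordinal lti) erefl).
Qed.

Lemma left_descent v : v != 1%g ->
  exists X Y, Y = X.+1 :> nat /\ (v^-1)%g Y < (v^-1)%g X.
Proof.
move=> vn1; apply: contrapT => /forallNP h; case/eqP: vn1; apply: invg_inj.
rewrite invg1; apply: adj_increasing_id => X Y XY; rewrite ltnNge.
apply/negP => le; apply: (h X); exists Y; split => //.
rewrite ltn_neqAle le andbT; apply/eqP => /val_inj /perm_inj e.
by move: XY; rewrite e; lia.
Qed.

Lemma left_mulE v X Y :
  wcomp (tperm X Y) v = wcomp v (tperm ((v^-1)%g Y) ((v^-1)%g X)).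
Proof.
apply/permP => i; rewrite !wcompE.
case: (tpermP _ _ (v i)) => [e|e|nX nY].
- have -> : i = (v^-1)%g X by rewrite -e permK.
  by rewrite tpermR permKV.
- have -> : i = (v^-1)%g Y by rewrite -e permK.
  by rewrite tpermL permKV.
by rewrite tpermD //; apply/eqP => e; [apply: nY|apply: nX]; rewrite -e permKV.
Qed.

Lemma left_desc_lt v X Y : (v^-1)%g Y < (v^-1)%g X -> X < Y ->
  #|inv_set (wcomp (tperm X Y) v)| < #|inv_set v|.
Proof.
move=> lt XY; set a := (v^-1)%g Y; set b := (v^-1)%g X.
have -> : #|inv_set v| = #|inv_set (wcomp (wcomp (tperm X Y) v) (tperm a b))|.
  congr (#|inv_set _|); rewrite left_mulE -wcompA.
  by apply/permP => i; rewrite !wcompE tpermK.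
by apply: inv_tperm_lt; rewrite ?wcompE ?permKV ?tpermL ?tpermR.
Qed.

Lemma inv_set1 : inv_set 1%g = set0.
Proof. by apply/setP=> -[i j]; rewrite !inE /= !perm1; lia. Qed.

Lemma tperm_simple X Y : Y = X.+1 :> nat -> tperm X Y \in simples n predT.
Proof.
move=> XY; rewrite inE; apply/existsP; exists X; apply/existsP; exists Y.
by rewrite XY !eqxx.
Qed.

(** Exchanging the adjacent values [X] and [Y] can create an inversion only at the two positions
    holding these values. *)
Lemma inv_left_mul w X Y : Y = X.+1 :> nat ->
  #|inv_set (wcomp (tperm X Y) w)| <= #|inv_set w|.+1.
Proof.
move=> XY; set i0 := (w^-1)%g X; set j0 := (w^-1)%g Y.
have sub : inv_set (wcomp (tperm X Y) w) \subset (i0, j0) |: inv_set w.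
  apply/subsetP => -[i j]; rewrite !inE /= !wcompE => /andP[ij h]; rewrite ij /=.
  case: eqP => //= ne; move: h.
  have ne' : ~ (w i = X /\ w j = Y).
    by move=> [e1 e2]; apply: ne; rewrite /i0 /j0 -e1 -e2 !permK.
  have wij : w i <> w j by move=> /perm_inj e; move: ij; rewrite e; lia.
  case: (tpermP X Y (w i)) => [Ei|Ei|/eqP iX /eqP iY];
    case: (tpermP X Y (w j)) => [Ej|Ej|/eqP jX /eqP jY];
    rewrite ?Ei ?Ej; try (by case: wij; rewrite Ei Ej);
    try (by case: ne'); move: iX iY jX jY || move: iX iY || move: jX jY || idtac;
    rewrite -?val_eqE /=; lia.
by apply: leq_trans (subset_leq_card sub) _; rewrite cardsU1; lia.
Qed.

Lemma left_mulK X Y w : wcomp (tperm X Y) (wcomp (tperm X Y) w) = w.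
Proof. by apply/permP => i; rewrite !wcompE tpermK. Qed.

Lemma left_desc_ind (P : 'S_n -> Prop) : P 1%g ->
  (forall X Y v, Y = X.+1 :> nat -> (v^-1)%g Y < (v^-1)%g X ->
     P (wcomp (tperm X Y) v) -> P v) ->
  forall v, P v.
Proof.
move=> P1 Ps v; have [m] := ubnP #|inv_set v|; elim: m v => // m IH v lt.
have [->//|/left_descent [X [Y [XY d]]]] := eqVneq v 1%g.
rewrite ltnS in lt; apply: (Ps X Y) => //; apply: IH; apply: leq_trans lt.
by apply: left_desc_lt; rewrite ?XY.
Qed.

Lemma coxlen_inv w : coxlen w = #|inv_set w|.
Proof.
rewrite /coxlen; case: ex_minnP => m wm min; apply/eqP; rewrite eqn_leq.
apply/andP; split.
  have [N wN le] : exists2 N, w \in (simples n predT ^+ N)%g & N <= #|inv_set w|.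
    elim/left_desc_ind: w {m wm min} => [|X Y v XY d [N vN le]].
      by exists 0; rewrite ?expg0 ?inE.
    exists N.+1; last by apply: leq_ltn_trans le (left_desc_lt d _); rewrite XY.
    rewrite -(left_mulK X Y v) {1}/wcomp expgSr.
    by rewrite mem_mulg // tperm_simple.
  exact: leq_trans (min _ wN) le.
elim: m w wm {min} => [|m IH] w.
  by rewrite expg0 inE => /eqP ->; rewrite inv_set1 cards0.
rewrite expgSr => /mulsgP [v s vm sS ->].
move: sS; rewrite inE => /existsP[X /existsP[Y /and3P[/eqP XY _ /eqP ->]]].
by apply: leq_trans (inv_left_mul v XY) _; rewrite ltnS IH.
Qed.

Lemma bruhat_stepI u a b : a < b -> u a < u b ->
  bruhat_step u (wcomp u (tperm a b)).
Proof.
move=> ab uab; apply/existsP; exists a; apply/existsP; exists b.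
by rewrite eqxx !coxlen_inv inv_tperm_lt.
Qed.

Lemma bruhat_stepP u v : reflect
  (exists a b, [/\ a < b, u a < u b & v = wcomp u (tperm a b)]) (bruhat_step u v).
Proof.
apply: (iffP idP) => [/existsP[a /existsP[b /andP[/eqP-> lt]]]|]; last first.
  by move=> [a [b [ab uab ->]]]; apply: bruhat_stepI.
wlog ab : a b lt / a < b.
  move=> h; have [/ord_neq_lt/orP[]|e] := boolP (a != b); first exact: h.
    by rewrite tpermC in lt *; apply: h.
  move/negPn/eqP: e lt => ->; rewrite tperm1 /wcomp mul1g; lia.
exists a, b; split => //; rewrite ltnNge leq_eqVlt; apply/negP => /orP[/eqP|ba].
  by move=> /val_inj/perm_inj e; move: ab; rewrite e; lia.
have := @inv_tperm_lt (wcomp u (tperm a b)) a b ab.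
rewrite !wcompE tpermL tpermR => /(_ ba); rewrite -!coxlen_inv -wcompA.
have -> : wcomp (tperm a b) (tperm a b) = 1%g by rewrite /wcomp tperm2.
by rewrite /wcomp mul1g => /(ltn_trans lt); rewrite ltnn.
Qed.

Lemma left_desc_bruhat v X Y : X < Y -> (v^-1)%g Y < (v^-1)%g X ->
  bruhat (wcomp (tperm X Y) v) v.
Proof.
move=> XY d; apply: connect1; apply/bruhat_stepP.
exists ((v^-1)%g Y), ((v^-1)%g X); split => //.
  by rewrite !wcompE !permKV tpermL tpermR.
by rewrite left_mulE -wcompA /wcomp tperm2 mul1g.
Qed.

Lemma bruhat_trans u v w : bruhat u v -> bruhat v w -> bruhat u w.
Proof. exact: connect_trans. Qed.

Lemma bruhat1 v : bruhat 1%g v.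
Proof.
elim/left_desc_ind: v => [|X Y v XY d h]; first exact: connect0.
by apply: bruhat_trans h (left_desc_bruhat _ d); rewrite XY.
Qed.

(** Left multiplication by the adjacent transposition preserves every step of a chain except one
    that exchanges the values [X] and [Y]; there it turns the lower end into the upper end, which
    gives the first alternative. *)
Lemma bruhat_lift x y X Y : Y = X.+1 :> nat -> bruhat x y ->
  bruhat (wcomp (tperm X Y) x) y \/
  bruhat (wcomp (tperm X Y) x) (wcomp (tperm X Y) y).
Proof.
move=> XY /connectP[p]; elim/last_ind: p y => [|p z IH] y.
  by move=> _ ->; right; apply: connect0.
rewrite rcons_path last_rcons => /andP[xp st] ->.
set y0 := last x p in st; case: (IH _ xp erefl) => h.
  by left; apply: bruhat_trans h (connect1 st).
move/bruhat_stepP: st => [a [b [ab yab ->]]]; rewrite -/y0 in h.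
have [e|ne] := boolP ((y0 a == X) && (y0 b == Y)).
  left; move/andP: e h => [/eqP ea /eqP eb].
  have <- // : wcomp (tperm X Y) y0 = wcomp y0 (tperm a b).
  by rewrite left_mulE -ea -eb !permK tpermC.
right; apply: bruhat_trans h (connect1 _); rewrite wcompA; apply: bruhat_stepI => //.
rewrite !wcompE; move: ne yab.
case: (tpermP X Y (y0 a)) => [->|->|/eqP aX /eqP aY];
  case: (tpermP X Y (y0 b)) => [->|->|/eqP bX /eqP bY];
  try move: aX aY; try move: bX bY; rewrite ?eqxx -?val_eqE /=; lia.
Qed.
End Inversions.

(** * Corner ranks of link patterns *)

Section Links.
Local Open Scope nat_scope.
Variables n k : nat.
Hypothesis le_2k_n : 2 * k <= n.
Implicit Types (u v w : 'S_n) (i j X Y : 'I_n) (p q : nat).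

(* The column of the nonzero entry of [xk] in row [i]; meaningful for [i < k] only (the default
   value of [insubd] is [i] itself). *)
Definition sh i : 'I_n := insubd i (i + (n - k)).

Lemma shE i : i < k -> sh i = i + (n - k) :> nat.
Proof. by move=> ik; rewrite val_insubd; case: ifP => //; lia. Qed.

Lemma sh_ge i : i < k -> k <= sh i.
Proof. by move=> ik; rewrite shE //; lia. Qed.

Lemma sh_inj : {in [pred i : 'I_n | i < k] &, injective sh}.
Proof.
move=> i j; rewrite !inE => ik jk /(congr1 val) /=; rewrite !shE //.
by move=> /addIn /val_inj.
Qed.

Definition unsh i : 'I_n := insubd i (i - (n - k)).

Lemma unshP i : n - k <= i -> unsh i < k /\ sh (unsh i) = i.
Proof.
move=> h; have e : unsh i = i - (n - k) :> nat.
  by rewrite val_insubd; case: ifP => //; have := ltn_ord i; lia.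
have lt : unsh i < k by rewrite e; have := ltn_ord i; lia.
by split => //; apply: val_inj; rewrite /= shE // e subnK.
Qed.

Lemma sh_surj j : n - k <= j -> exists2 i : 'I_n, i < k & j = sh i.
Proof. by case/unshP => uk ue; exists (unsh j). Qed.

(** Says that [v x] is strictly upper triangular: its nonzero entries sit at [(v i, v (sh i))] with
    [i < k]. *)
Definition ntype v := forall i : 'I_n, i < k -> v i < v (sh i).

(** The rank of the submatrix of [v x] on the rows [>= p] and the columns [< q]. A link pattern has
    at most one nonzero entry in each row and column, so ranks count entries. *)
Definition crank v p q :=
  #|[set i : 'I_n | [&& i < k, p <= v i & v (sh i) < q]]|.

Definition Rle w v := forall p q, q <= n -> crank w p q <= crank v p q.

Definition rowhit v p q : bool :=
  [exists i : 'I_n, [&& i < k, v i == p :> nat & v (sh i) < q]].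

Definition colhit v p q : bool :=
  [exists i : 'I_n, [&& i < k, p <= v i & v (sh i) == q :> nat]].

Lemma card_le1_exists (P : pred 'I_n) : (forall i j, P i -> P j -> i = j) ->
  #|[set i | P i]| = [exists i, P i].
Proof.
move=> h; case: existsP => [[i Pi]|nP].
  by apply/eqP/cards1P; exists i; apply/setP => j; rewrite !inE; apply/idP/eqP => [Pj|->] //;
    apply: h.
by apply/eqP; rewrite cards_eq0; apply/eqP/setP => i; rewrite !inE; apply/negP => Pi; apply: nP;
  exists i.
Qed.

Lemma crank_row v p q : crank v p q = rowhit v p q + crank v p.+1 q.
Proof.
rewrite -card_le1_exists; last first.
  move=> i j /and3P[_ /eqP e _] /and3P[_ /eqP e' _].
  by apply: (@perm_inj _ v); apply: val_inj; rewrite /= e e'.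
rewrite -cardsUI [X in _ = _ + X]eq_card0 ?addn0; last first.
  by move=> i; rewrite !inE; apply/negP => /andP[]; lia.
by apply: eq_card => i; rewrite !inE; case: (i < k) => //=; lia.
Qed.

Lemma crank_col v p q : crank v p q.+1 = crank v p q + colhit v p q.
Proof.
rewrite -card_le1_exists; last first.
  move=> i j /and3P[ik _ /eqP e] /and3P[jk _ /eqP e'].
  by apply: sh_inj => //; apply: (@perm_inj _ v); apply: val_inj; rewrite /= e e'.
rewrite -cardsUI [X in _ = _ + X]eq_card0 ?addn0; last first.
  by move=> i; rewrite !inE; apply/negP => /andP[]; lia.
by apply: eq_card => i; rewrite !inE; case: (i < k) => //=; lia.
Qed.

Lemma ntypeP v : ntype v <-> (forall p, p <= n -> crank v p p = 0).
Proof.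
split=> [h p _|h i ik].
  apply/eqP; rewrite cards_eq0; apply/eqP/setP => i; rewrite !inE.
  by apply/negP => /and3P[ik a b]; have := h i ik; lia.
rewrite ltn_neqAle; apply/andP; split.
  apply/eqP => /val_inj/perm_inj e; have := shE ik; rewrite -e; lia.
rewrite leqNgt; apply/negP => lt; have /eqP := h (v i) (ltnW (ltn_ord _)).
by rewrite cards_eq0 => /eqP/setP/(_ i); rewrite !inE ik leqnn lt.
Qed.

Lemma rowhit_mono v p q q' : q <= q' -> rowhit v p q -> rowhit v p q'.
Proof.
move=> qq' /existsP[i /and3P[ik e h]]; apply/existsP; exists i.
by rewrite ik e (leq_trans h qq').
Qed.

Lemma colhit_mono v p p' q : p' <= p -> colhit v p q -> colhit v p' q.
Proof.
move=> qq' /existsP[i /and3P[ik e h]]; apply/existsP; exists i.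
by rewrite ik h (leq_trans qq' e).
Qed.

(** Rows of the pattern are images of indices below [k], columns are images of indices
    [sh i >= k]. *)
Lemma row_not_col v p q p' q' : rowhit v p q -> colhit v p' q' -> p <> q'.
Proof.
move=> /existsP[i /and3P[ik /eqP e _]] /existsP[j /and3P[jk _ /eqP e']] pq.
have /perm_inj ij : v i = v (sh j) by apply: val_inj; rewrite /= e e'.
by have := sh_ge jk; rewrite -ij; lia.
Qed.

Section Adjacent.
Variables X Y : 'I_n.
Hypothesis XY : Y = X.+1 :> nat.
Let s v := wcomp (tperm X Y) v.

(** Exchanging the two adjacent values is visible only at the threshold [Y], which separates
    them. *)
Lemma adj_geq (z : 'I_n) p : p <> Y -> (p <= tperm X Y z) = (p <= z).
Proof. by move=> pY; case: (tpermP X Y z) => [->|->|] //; lia. Qed.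

Lemma adj_ltn (z : 'I_n) q : q <> Y -> (tperm X Y z < q) = (z < q).
Proof. by move=> pY; case: (tpermP X Y z) => [->|->|] //; lia. Qed.

Lemma adj_eq (z a : 'I_n) : (tperm X Y z == a :> nat) = (z == tperm X Y a :> nat).
Proof. by rewrite !val_eqE -(inj_eq (@perm_inj _ (tperm X Y))) tpermK. Qed.

Lemma crank_adj v p q : p <> Y -> q <> Y -> crank (s v) p q = crank v p q.
Proof.
by move=> pY qY; apply: eq_card => i; rewrite !inE !wcompE adj_geq ?adj_ltn.
Qed.

Lemma crank_adj_row v q : q <> Y ->
  crank (s v) Y q = rowhit v X q + crank v Y.+1 q.
Proof.
move=> qY; rewrite crank_row crank_adj //; last by lia.
congr (nat_of_bool _ + _); apply: eq_existsb => i.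
by rewrite !wcompE adj_eq tpermR adj_ltn.
Qed.

Lemma crank_adj_col v p : p <> Y ->
  crank (s v) p Y = crank v p X + colhit v p Y.
Proof.
move=> pY; rewrite XY crank_col -XY crank_adj //; last by lia.
congr (_ + nat_of_bool _); apply: eq_existsb => i.
by rewrite !wcompE adj_eq tpermL adj_geq.
Qed.

(** Only an entry at [(X, Y)] would be moved below the diagonal, and the disjunction excludes it
    because no index is both a row and a column of the pattern. *)
Lemma ntype_adj v : ntype v -> (rowhit v Y n || colhit v 0 X) -> ntype (s v).
Proof.
move=> nv h i ik; rewrite !wcompE; have := nv _ ik.
have [e|ne] := boolP ((v i == X) && (v (sh i) == Y)).
  move/andP: e => [/eqP e1 /eqP e2]; case/orP: h => h.
    have hc : colhit v 0 Y by apply/existsP; exists i; rewrite ik e2 eqxx.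
    by case: (row_not_col h hc).
  have hr : rowhit v X n by apply/existsP; exists i; rewrite ik e1 eqxx ltn_ord.
  by case: (row_not_col hr h).
move: ne.
case: (tpermP X Y (v i)) => [->|->|/eqP aX /eqP aY];
  case: (tpermP X Y (v (sh i))) => [->|->|/eqP bX /eqP bY];
  try move: aX aY; try move: bX bY; rewrite ?eqxx -?val_eqE /=; lia.
Qed.

(* If a rank bound at a threshold separating X from Y fails for [s v], it shows that Y is a row (or
   X a column) of the link pattern of w, so that exchanging X and Y lowers the ranks of w there. *)
Lemma Rle_adj w v : Rle w v -> ntype v -> Rle w (s v) \/ Rle (s w) (s v).
Proof.
move=> wv nv.
have nw : ntype w.
  by apply/ntypeP => p pn; have := wv p p pn; rewrite (proj1 (ntypeP v) nv p pn); lia.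
have w0 : crank w Y Y = 0 by rewrite (proj1 (ntypeP w) nw) // ltnW.
have [h|/existsNP[p /existsNP[q /not_implyP[qn /negP]]]] := pselect (Rle w (s v)).
  by left.
rewrite -ltnNge => lt; right.
have [pY|pY] := eqVneq p Y; have [qY|qY] := eqVneq q Y.
- by move: lt; rewrite pY qY w0.
- rewrite pY crank_adj_row in lt; last exact/eqP.
  (* The bounds at [X] and [Y.+1] leave one way for the threshold [Y] to fail: row [Y] contributes
     for [w], and row [X] for neither pattern. *)
  have [eY eX] : rowhit w Y q /\ ~~ rowhit w X q.
    move: (crank_row w X q) (crank_row w Y q) (crank_row v X q) (crank_row v Y q).
    rewrite -XY; move: (wv X q qn) (wv Y q qn) (wv Y.+1 q qn) lt; lia.
  have ncol a : ~~ colhit w a Y by apply/negP => /(row_not_col eY); apply.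
  move=> p' q' qn'; have [pY'|/eqP pY'] := eqVneq p' Y; have [qY'|/eqP qY'] := eqVneq q' Y.
  + rewrite pY' qY' (_ : crank (s w) Y Y = 0) //; apply: (proj1 (ntypeP _)); last by apply/ltnW.
    by apply: ntype_adj => //; rewrite (rowhit_mono qn eY).
  + rewrite pY' !crank_adj_row //.
    (* If row [X] of [w x] meets this corner, so does row [Y]. The bound at threshold [X], less the
       at most one entry of [v x] in row [Y], is then what is wanted. *)
    have [eX'|] := boolP (rowhit w X q'); last by move: (wv Y.+1 q' qn'); lia.
    have qq' : q <= q'.
      by rewrite leqNgt; apply: contra eX => /ltnW le; apply: rowhit_mono eX'.
    have := rowhit_mono qq' eY.
    move: (crank_row w X q') (crank_row w Y q') (crank_row v X q') (crank_row v Y q').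
    rewrite -XY; move: (wv X q' qn'); lia.
  + rewrite qY' !crank_adj_col // (negbTE (ncol _)).
    by move: (wv p' X (ltnW (ltn_ord _))); lia.
  + by rewrite !crank_adj //; apply: wv.
- rewrite qY crank_adj_col in lt; last exact/eqP.
  have Xn : X <= n by apply/ltnW.
  have Yn : Y <= n by apply/ltnW.
  have Yn1 : Y.+1 <= n by [].
  have [eX eY] : colhit w p X /\ ~~ colhit w p Y.
    move: (crank_col w p X) (crank_col w p Y) (crank_col v p X) (crank_col v p Y).
    rewrite -XY; move: (wv p X Xn) (wv p Y Yn) (wv p Y.+1 Yn1) lt; lia.
  have nrow a : ~~ rowhit w X a by apply/negP => /row_not_col/(_ eX); apply.
  move=> p' q' qn'; have [pY'|/eqP pY'] := eqVneq p' Y; have [qY'|/eqP qY'] := eqVneq q' Y.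
  + rewrite pY' qY' (_ : crank (s w) Y Y = 0) //; apply: (proj1 (ntypeP _)) => //.
    by apply: ntype_adj => //; rewrite (colhit_mono (leq0n _) eX) orbT.
  + rewrite pY' !crank_adj_row // (negbTE (nrow _)).
    by move: (wv Y.+1 q' qn'); lia.
  + rewrite qY' !crank_adj_col //.
    have [eY'|] := boolP (colhit w p' Y); last by move: (wv p' X Xn); lia.
    have pp' : p' <= p.
      by rewrite leqNgt; apply: contra eY => /ltnW le; apply: colhit_mono eY'.
    have := colhit_mono pp' eX.
    move: (crank_col w p' X) (crank_col w p' Y) (crank_col v p' X) (crank_col v p' Y).
    rewrite -XY; move: (wv p' Y.+1 Yn1); lia.
  + by rewrite !crank_adj //; apply: wv.
- by move: lt; rewrite crank_adj; [move: (wv p q qn); lia| exact/eqP|exact/eqP].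
Qed.
End Adjacent.
End Links.

(** * Levi blocks, and the passage from rank bounds to the Bruhat order on cosets *)

Section Cosets.
Local Open Scope nat_scope.
Variables n k : nat.
Hypothesis le_2k_n : 2 * k <= n.
Implicit Types (u v w : 'S_n) (i j X Y : 'I_n) (p q : nat).

(** The blocks are the intervals of ['I_n] cut at [k] and at [n - k], on which the Levi factor of
    P_k acts. *)
Definition same_block i j :=
  ((i < k) == (j < k)) && ((i < n - k) == (j < n - k)).

Lemma gen_simples_ind (I : pred nat) (P : 'S_n -> Prop) : P 1%g ->
  (forall X Y w, Y = X.+1 :> nat -> I Y -> P w -> P (wcomp (tperm X Y) w)) ->
  forall w, w \in <<simples n I>>%g -> P w.
Proof.
move=> P1 PM w /gen_prodgP[m [c Sc ->]].
elim: m c Sc => [|m IH] c Sc; first by rewrite big_ord0.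
rewrite big_ord_recr /=; have := Sc ord_max.
rewrite inE => /existsP[X /existsP[Y /and3P[/eqP XY IY /eqP ->]]].
by apply: (PM X Y) => //; apply: IH.
Qed.

(** The left descents of a block-preserving permutation exchange two values of one block, so they
    are generators and the induction over descents stays inside W(L). *)
Lemma WLP w : reflect (forall i, same_block (w i) i) (w \in WL n k).
Proof.
apply: (iffP idP) => [|h].
  apply: (@gen_simples_ind _ (fun u => forall i, same_block (u i) i)) => {w} [i|X Y w XY lv IH i].
    by rewrite perm1 /same_block !eqxx.
  move: lv (IH i); rewrite /levi_index /same_block wcompE.
  by case: (tpermP X Y (w i)) => [->|->|//]; lia.
elim/left_desc_ind: w h => [_|X Y v XY d IH h]; first exact: group1.
have hY := h ((v^-1)%g Y); have hX := h ((v^-1)%g X).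
rewrite !permKV /same_block in hX hY.
have lv : levi_index n k Y by rewrite /levi_index; lia.
rewrite -(left_mulK X Y v) /wcomp groupM //; last first.
  apply: mem_gen; rewrite inE; apply/existsP; exists X; apply/existsP; exists Y.
  by rewrite XY !eqxx -XY lv.
apply: IH => i; move: (h i) lv; rewrite /levi_index /same_block wcompE.
by case: (tpermP X Y (v i)) => [->|->|//]; lia.
Qed.

Lemma WkP w : w \in Wk n k -> forall i, k <= i -> w i = i.
Proof.
apply: (@gen_simples_ind _ (fun u => forall i, k <= i -> u i = i)) =>
  {w} [i _|X Y w XY Yk IH i ki]; first by rewrite perm1.
by rewrite wcompE IH // tpermD // -val_eqE /=; lia.
Qed.

Lemma ZkP w : w \in Zk n k -> forall i j, same_block i j -> i < j -> w i < w j.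
Proof.
rewrite inE => /forall_inP h.
have st X Y : Y = X.+1 :> nat -> same_block X Y -> w X < w Y.
  move=> XY sb.
  have lv : levi_index n k Y by move: sb; rewrite /same_block /levi_index; lia.
  have /h /eqP : tperm X Y \in simples n (levi_index n k).
    rewrite inE; apply/existsP; exists X; apply/existsP; exists Y.
    by rewrite XY !eqxx -XY lv.
  (* The step is realized by some [(a b)] with [a < b] and increasing values; comparing the two
     products forces this pair to be [(X, Y)]. *)
  move=> e; have /bruhat_stepP[a [b [ab wab]]] : bruhat_step w (wcomp w (tperm X Y)).
    by apply/existsP; exists X; apply/existsP; exists Y; rewrite eqxx e ltnSn.
  move=> /permP e'; have eY := e' Y; move: (e' X).
  rewrite !wcompE tpermL in eY *; rewrite tpermR in eY.
  move=> /perm_inj eX; move/perm_inj: eY => eY.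
  case: (tpermP a b X) eX => [Xa|Xb|_ _] eX; last by move: XY; rewrite eX; lia.
    by rewrite Xa eX.
  by move: ab XY; rewrite Xb eX; lia.
move=> i [j jn]; elim: j jn => // j IH jn sb; rewrite /= ltnS leq_eqVlt.
have jn' := ltnW jn => /orP[/eqP ij|ij].
  by apply: st => //=; rewrite ij.
apply: ltn_trans (IH jn' _ ij) (st _ _ _ _) => //; move: sb ij; rewrite /same_block /=; lia.
Qed.

Lemma sum_sh (F : 'I_n -> nat) :
  \sum_(i in 'I_n | i < k) F (sh k i) = \sum_(j in 'I_n | n - k <= j) F j.
Proof.
transitivity (\sum_(j in sh k @: [set i : 'I_n | i < k]) F j).
  rewrite big_imset /=; first by apply: eq_bigl => i; rewrite inE.
  by move=> i j; rewrite !inE; apply: sh_inj.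
apply: eq_bigl => j /=; apply/imsetP/idP => [[i + ->]|/(sh_surj le_2k_n) [i ik ->]].
  by rewrite inE => ik; rewrite shE //; lia.
by exists i; rewrite ?inE.
Qed.

(** Corners without entries of [x] contain none of [w x]. Three families of such corners show that
    [w] preserves the first and the last [k] indices and that [w i + (n - k) <= w (sh k i)]; both
    sides have the same sum, so equality holds throughout. *)
Lemma Rle1_WC w : Rle k w 1%g -> w \in WC n k.
Proof.
move=> h.
have h0 p q : q <= n -> (forall i, i < k -> p <= i -> sh k i < q -> False) ->
    forall i, i < k -> p <= w i -> w (sh k i) < q -> False.
  move=> qn h0 i ik a b; have := h p q qn.
  rewrite [crank k 1%g p q]eq_card0 => [|j]; last first.
    by rewrite !inE !perm1; apply/negP => /and3P[jk c d]; apply: (h0 j).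
  by rewrite leqn0 cards_eq0 => /eqP/setP/(_ i); rewrite !inE ik a b.
have wA i : i < k -> w i < k.
  move=> ik; rewrite ltnNge; apply/negP => c.
  by apply: (h0 k n (leqnn _) _ i) => // j; lia.
have wC i : i < k -> n - k <= w (sh k i).
  move=> ik; rewrite leqNgt; apply/negP => c.
  by apply: (h0 0 (n - k) (leq_subr _ _) _ i) => // j jk _; rewrite shE //; lia.
have wn i : i < k -> w i + (n - k) <= w (sh k i).
  move=> ik; rewrite leqNgt; apply/negP => c.
  have wi := wA i ik.
  apply: (h0 (w i) (w i + (n - k)) _ _ i) => // [|j jk a]; first by lia.
  by rewrite shE //; lia.
have kn : k <= n by lia.
have imA : w @: [set i : 'I_n | i < k] = [set i : 'I_n | i < k].
  apply/eqP; rewrite eqEcard card_imset ?leqnn ?andbT; last exact: perm_inj.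
  by apply/subsetP => _ /imsetP[i + ->]; rewrite !inE => /wA.
have imC : w @: [set i : 'I_n | n - k <= i] = [set i : 'I_n | n - k <= i].
  apply/eqP; rewrite eqEcard card_imset ?leqnn ?andbT; last exact: perm_inj.
  apply/subsetP => _ /imsetP[i + ->]; rewrite !inE => /(sh_surj le_2k_n)[j jk ->].
  exact: wC.
have inA i : (w i < k) = (i < k).
  by move/setP/(_ (w i)): imA; rewrite mem_imset ?inE //; apply: perm_inj.
have inC i : (n - k <= w i) = (n - k <= i).
  by move/setP/(_ (w i)): imC; rewrite mem_imset ?inE //; apply: perm_inj.
have eqsum : \sum_(i in 'I_n | i < k) (w i + (n - k)) = \sum_(i in 'I_n | i < k) w (sh k i).
  rewrite (sum_sh (fun j => w j)).
  transitivity (\sum_(i in 'I_n | i < k) (i + (n - k))).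
    by rewrite [RHS](reindex_inj (@perm_inj _ w)) /=; apply: eq_bigl => i; rewrite inA.
  transitivity (\sum_(i in 'I_n | n - k <= i) i).
    by rewrite -sum_sh; apply: eq_bigr => i ik; rewrite shE.
  by rewrite (reindex_inj (@perm_inj _ w)) /=; apply: eq_bigl => i; rewrite inC.
have wE i : i < k -> w (sh k i) = w i + (n - k) :> nat.
  move=> ik; have /leqif_sum : forall i : 'I_n, i < k ->
      w i + (n - k) <= w (sh k i) ?= iff (w i + (n - k) == w (sh k i)).
    by move=> j jk; split => //; apply: wn.
  case=> _; rewrite eqsum eqxx => /esym/forall_inP/(_ i ik).
  by move/eqP.
rewrite inE; apply/andP; split.
  apply/WLP => i; rewrite /same_block inA eqxx /=.
  by rewrite !ltnNge inC eqxx.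
apply/forallP => i; apply/forallP => j; apply/implyP => /andP[ik /eqP e].
have -> : j = sh k i by apply: val_inj; rewrite /= e shE //; lia.
by rewrite wE //; lia.
Qed.

Lemma WC_inv w : w \in WC n k -> (w^-1)%g \in WC n k.
Proof.
rewrite !inE => /andP[wL /forallP h]; rewrite groupV wL /=.
apply/forallP => i; apply/forallP => j; apply/implyP => /andP[ik /eqP e].
have /WLP wb := wL; have := wb ((w^-1)%g i); rewrite permKV /same_block => b.
have wik : (w^-1)%g i < k by move: b; lia.
have /forallP/(_ (sh k ((w^-1)%g i))) := h ((w^-1)%g i).
rewrite wik shE // addnC eqxx /= permKV => /eqP e'.
have <- : w (sh k ((w^-1)%g i)) = j by apply: val_inj; rewrite /= e' e.
by rewrite permK shE // addnC.
Qed.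

Lemma Rle_bruhat v w : ntype k v -> Rle k w v ->
  exists2 c, c \in WC n k & bruhat (wcomp w c) v.
Proof.
elim/left_desc_ind: v w => [|X Y v XY d IH] w nv wv.
  have /WC_inv wC := Rle1_WC wv; exists (w^-1)%g => //.
  by rewrite /wcomp mulVg; apply: connect0.
have dv : bruhat (wcomp (tperm X Y) v) v by apply: left_desc_bruhat; rewrite ?XY.
have nsv : ntype k (wcomp (tperm X Y) v).
  move=> i ik; rewrite !wcompE; have := nv i ik.
  (* An entry at [(X, Y)] cannot occur: the descent puts the position of [Y] before that of [X],
     whereas [i < sh k i]. *)
  have [e|ne] := boolP ((v i == X) && (v (sh k i) == Y)).
    move/andP: e => [/eqP e1 /eqP e2]; move: d; rewrite -e1 -e2 !permK.
    by rewrite shE //; lia.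
  move: ne.
  case: (tpermP X Y (v i)) => [->|->|/eqP aX /eqP aY];
    case: (tpermP X Y (v (sh k i))) => [->|->|/eqP bX /eqP bY];
    try move: aX aY; try move: bX bY; rewrite ?eqxx -?val_eqE /=; lia.
have [h|h] := Rle_adj le_2k_n XY wv nv.
  by have [c cW b] := IH w nsv h; exists c => //; apply: bruhat_trans dv.
have [c cW b] := IH _ nsv h; exists c => //.
have := bruhat_lift XY b; rewrite wcompA left_mulK left_mulK.
by case=> // /bruhat_trans; apply.
Qed.

End Cosets.

(** * Polynomial substitution and the Jacobian criterion *)

Section Substitution.

Lemma mmap_comp n (R : nzRingType) (S : nzRingType) (T : nzRingType)
    (f : R -> S) (h : 'I_n -> S) (g : {rmorphism S -> T}) (p : {mpoly R[n]}) :
  g (mmap f h p) = mmap (fun c => g (f c)) (fun i => g (h i)) p.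
Proof.
rewrite /mmap rmorph_sum; apply: eq_bigr => m _; rewrite rmorphM /mmap1.
by rewrite rmorph_prod; congr (_ * _); apply: eq_bigr => i _; rewrite rmorphXn.
Qed.

Lemma mmap_eq_supp n (R S : nzRingType) (f f' : R -> S) (h h' : 'I_n -> S) (p : {mpoly R[n]}) :
  f =1 f' -> (forall m i, m \in msupp p -> m i != 0%N -> h i = h' i) ->
  mmap f h p = mmap f' h' p.
Proof.
move=> ff hh; rewrite /mmap !big_seq; apply: eq_bigr => m pm; rewrite ff.
congr (_ * _); apply: eq_bigr => i _; have [->|ne] := eqVneq (m i) 0%N.
  by rewrite !expr0.
by rewrite (hh m).
Qed.

Lemma mmap_id n (R : nzRingType) (p : {mpoly R[n]}) : mmap (@mpolyC n R) (fun i => 'X_i) p = p.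
Proof.
rewrite [RHS]mpolyE; apply: eq_bigr => m _.
by rewrite mmap1_id mul_mpolyC.
Qed.

(** Stated for any additive [D] that obeys the Leibniz rule and kills the coefficients, so that it
    serves both the derivative in [{poly K}] along curves and the partial derivatives of composed
    polynomials. *)
Lemma chain_rule n (R : nzRingType) (S : comNzRingType) (f : {rmorphism R -> S}) (D : S -> S)
    (h : 'I_n -> S) (p : {mpoly R[n]}) :
    (forall x y, D (x + y) = D x + D y) ->
    (forall x y, D (x * y) = D x * y + x * D y) ->
    (forall c, D (f c) = 0) ->
  D (mmap f h p) = \sum_i mmap f h (mderiv i p) * D (h i).
Proof.
move=> DD DM Df.
pose P (q : {mpoly R[n]}) := D (mmap f h q) = \sum_i mmap f h (mderiv i q) * D (h i).
have D0 : D 0 = 0.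
  by rewrite -(rmorph0 f) Df rmorph0.
have PC c : P c%:MP.
  by rewrite /P mmapC Df big1 // => i _; rewrite mderivC mmap0 mul0r.
have PD q r : P q -> P r -> P (q + r).
  rewrite /P mmapD DD => -> ->; rewrite -big_split; apply: eq_bigr => i _.
  by rewrite mderivD mmapD mulrDl.
have PMm q r : mmap f h (q * r) = mmap f h q * mmap f h r by rewrite rmorphM.
have PM q r : P q -> P r -> P (q * r).
  rewrite /P PMm DM => -> ->; rewrite mulr_suml mulr_sumr -big_split.
  apply: eq_bigr => i _; rewrite mderivM mmapD !PMm mulrDl.
  by rewrite mulrAC mulrA.
have PX i : P 'X_i.
  rewrite /P mmapX mmap1U (bigD1 i) //= big1 ?addr0.
    rewrite mderivX mnm1E eqxx; have -> : (U_(i) - U_(i) = 0 :> 'X_{1..n})%MM by apply/mnmP => j;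
      rewrite !mnmE subnn.
    by rewrite mpolyX0 scale1r rmorph1 mul1r.
  by move=> j ji; rewrite mderivX mnm1E eq_sym (negbTE ji) scale0r mmap0 mul0r.
suff : P p by [].
rewrite [p]mpolyE; elim: (msupp p) => [|m s IH].
  by rewrite big_nil -mpolyC0; apply: PC.
rewrite big_cons; apply: PD IH; rewrite -mul_mpolyC; apply: (PM _ _ (PC _)).
rewrite mpolyXE_id; apply: (big_ind P) => [||i _]; [exact: (PC 1)|exact: PM|].
elim: (m i) => [|d IH]; first by rewrite expr0; exact: (PC 1).
by rewrite exprS; apply: PM.
Qed.

End Substitution.

(** * Nonvanishing of polynomials in characteristic zero *)

Section CharZero.
Variable K : fieldType.
Hypothesis charK0 : [pchar K] =i pred0.

Lemma natr_eq0 m : (m%:R == 0 :> K) = (m == 0)%N.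
Proof. by move/pcharf0P: charK0. Qed.

Lemma natr_inj : injective (fun m : nat => m%:R : K).
Proof.
move=> a b /= e; wlog ab : a b e / (a <= b)%N.
  by move=> h; case: (leqP a b) => [|/ltnW] c; [apply: h|apply/esym/h].
move/eqP: e; rewrite eq_sym -subr_eq0 -natrB // natr_eq0; lia.
Qed.

Lemma poly_ext0 (p : {poly K}) : (forall s, s != 0 -> p.[s] = 0) -> p = 0.
Proof.
move=> h; apply/eqP; apply: contraT => pn0.
(* In characteristic zero these are distinct nonzero points, as many as the size of [p], which is
   one more than its degree. *)
pose rs := [seq (i%:R : K) | i <- iota 1 (size p)].
have /max_poly_roots : p != 0 by [].
move=> /(_ rs); rewrite size_map size_iota ltnn => -> //.
  by apply/allP => _ /mapP[i + ->]; rewrite mem_iota => /andP[i0 _]; apply/eqP/h;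
    rewrite natr_eq0; lia.
by rewrite map_inj_uniq ?iota_uniq //; apply: natr_inj.
Qed.

Lemma poly_nonroot (p : {poly K}) : p != 0 -> exists s, p.[s] != 0.
Proof.
move=> pn0; apply: contrapT => /forallNP h; case/eqP: pn0.
by apply: poly_ext0 => s _; apply/eqP/negPn/negP/h.
Qed.

Lemma radix_inj N L (a b : nat -> nat) : (forall i, (i < N)%N -> (a i < L)%N /\ (b i < L)%N) ->
  (\sum_(i < N) a i * L ^ i = \sum_(i < N) b i * L ^ i)%N ->
  forall i, (i < N)%N -> a i = b i.
Proof.
elim: N a b => // N IH a b lt.
rewrite !big_ord_recl /= expn0 !muln1.
have sh (c : nat -> nat) : (\sum_(i < N) c (bump 0 i) * L ^ bump 0 i =
    L * \sum_(i < N) c i.+1 * L ^ i)%N.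
  by rewrite big_distrr /=; apply: eq_bigr => i _; rewrite /bump /= add1n expnS; lia.
rewrite !sh => e; have [a0 b0] := lt 0%N isT.
have e0 : a 0%N = b 0%N.
  have := congr1 (modn^~ L) e; rewrite ![(L * _)%N]mulnC ![(_ + _ * L)%N]addnC !modnMDl.
  by rewrite !modn_small.
have L0 : (0 < L)%N by apply: leq_ltn_trans a0.
have eS : forall i, (i < N)%N -> a i.+1 = b i.+1.
  apply: IH => [i iN|]; first exact: lt.
  by apply/eqP; rewrite -(eqn_pmul2l L0); apply/eqP; move: e; rewrite e0 => /addnI.
by case=> [_|i] //; apply: eS.
Qed.

(** Kronecker substitution: with [L] above all exponents, sending the i-th variable to the power
    [L ^ i] of a single variable keeps distinct monomials distinct, so a nonzero [p] becomes a
    nonzero univariate polynomial. *)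
Lemma mpoly_nonroot N (p : {mpoly K[N]}) : p != 0 -> exists v, p.@[v] != 0.
Proof.
move=> pn0; pose L := msize p.
pose h (i : 'I_N) : {poly K} := 'X^(L ^ i).
pose kap (m : 'X_{1..N}) := (\sum_(i < N) m i * L ^ i)%N.
have qE : mmap (@polyC K) h p = \sum_(m <- msupp p) p@_m *: 'X^(kap m).
  apply: eq_bigr => m _; rewrite mul_polyC; congr (_ *: _).
  rewrite /mmap1 /kap -prodrXr; apply: eq_bigr => i _.
  by rewrite -exprM mulnC.
have kap_inj : {in msupp p &, injective kap}.
  move=> m m' pm pm' e; apply/mnmP => i.
  pose ext (u : 'X_{1..N}) j := if insub j is Some k then u k else 0%N.
  have extE (u : 'X_{1..N}) (j : 'I_N) : ext u j = u j by rewrite /ext valK.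
  have b (u : 'X_{1..N}) j : u \in msupp p -> (u j < L)%N.
    by move/msize_mdeg_lt; apply: leq_ltn_trans; rewrite mdegE (bigD1 j) //= leq_addr.
  rewrite -!extE; apply: (@radix_inj N L) (ltn_ord i) => [j jN|].
    by rewrite -[j]/(val (Ordinal jN)) !extE !b.
  transitivity (kap m); first by apply: eq_bigr => j _; rewrite extE.
  by rewrite e; apply: eq_bigr => j _; rewrite extE.
have [m pm] : exists m, m \in msupp p.
  by case E: (msupp p) => [|m s]; [move/msuppnil0: E pn0 => ->; rewrite eqxx|exists m;
    rewrite inE eqxx].
have /poly_nonroot [s sP] : mmap (@polyC K) h p != 0.
  apply/eqP => /(congr1 (fun q : {poly K} => q`_(kap m))).
  rewrite qE coef_sum coef0 (bigD1_seq m) //= ?msupp_uniq //.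
  rewrite coefZ coefXn eqxx mulr1 big1_seq ?addr0.
    by apply/eqP; rewrite -mcoeff_msupp.
  move=> m' /andP[m'm pm']; rewrite coefZ coefXn.
  by case: eqP => [/kap_inj e|]; rewrite ?mulr0 //; move: m'm; rewrite e ?eqxx.
exists (fun i => (h i).[s]); move: sP.
rewrite -horner_evalE mmap_comp /=; congr (_ != 0).
by apply: eq_bigr => u _; rewrite /= horner_evalE hornerC.
Qed.

End CharZero.

(** * Algebraic independence and the rank of the Jacobian matrix *)

Section AlgIndep.
Variables (K : fieldType) (N : nat).
Hypothesis charK0 : [pchar K] =i pred0.

Definition psubst M (f : 'I_M -> {mpoly K[N]}) : {mpoly K[M]} -> {mpoly K[N]} :=
  mmap (@mpolyC N K) f.

HB.instance Definition _ M f := GRing.RMorphism.on (@psubst M f).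

Definition pindep M (f : 'I_M -> {mpoly K[N]}) :=
  forall P, psubst f P = 0 -> P = 0.

Definition jac M (f : 'I_M -> {mpoly K[N]}) (x : 'I_N -> K) : 'M[K]_(M, N) :=
  \matrix_(i, j) (mderiv j (f i)).@[x].

Lemma psubst_eval M (f : 'I_M -> {mpoly K[N]}) P x :
  (psubst f P).@[x] = P.@[fun i => (f i).@[x]].
Proof.
rewrite mmap_comp; apply: eq_bigr => m _.
by rewrite /= mevalC.
Qed.

Lemma psubst_deriv M (f : 'I_M -> {mpoly K[N]}) P j :
  mderiv j (psubst f P) = \sum_i psubst f (mderiv i P) * mderiv j (f i).
Proof.
apply: chain_rule => [||c]; [exact: mderivD| |exact: mderivC].
by move=> x y; rewrite mderivM.
Qed.

Lemma mderiv0_supp M (P : {mpoly K[M]}) i : mderiv i P = 0 ->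
  forall m, m \in msupp P -> m i = 0%N.
Proof.
move=> d m Pm; apply/eqP; rewrite -leqn0 leqNgt; apply/negP => mi.
have : (mderiv i P)@_(m - U_(i)) = 0 by rewrite d mcoeff0.
rewrite mcoeff_deriv submK; last first.
  by apply/mnm_lepP => l; rewrite mnm1E; case: eqP => // <-.
move/eqP; rewrite -mulr_natr mulf_eq0 natr_eq0 // orbF.
by move: Pm; rewrite mcoeff_msupp => /negbTE ->.
Qed.

Lemma msize_mderiv M (P : {mpoly K[M]}) i : P != 0 -> (msize (mderiv i P) < msize P)%N.
Proof.
move=> Pn0; rewrite [X in (X < _)%N]msizeE big_seq.
have P0 : (0 < msize P)%N by rewrite lt0n msize_poly_eq0.
rewrite -(prednK P0) ltnS; apply: (big_ind (fun a => (a <= (msize P).-1)%N)) => //.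
  by move=> a b ha hb; rewrite geq_max ha.
move=> m; rewrite mcoeff_msupp mcoeff_deriv => ne.
have : (m + U_(i))%MM \in msupp P.
  by rewrite mcoeff_msupp; apply: contraNneq ne => ->; rewrite mul0rn.
by move/msize_mdeg_lt; rewrite mdegD mdeg1; lia.
Qed.

Lemma poly_mdeg_prod I (r : seq I) (F : I -> {mpoly K[N]}) (d : I -> nat) :
  (forall i, msize (F i) <= (d i).+1)%N ->
  (msize (\prod_(i <- r) F i) <= (\sum_(i <- r) d i).+1)%N.
Proof.
move=> h; elim: r => [|i r IH]; first by rewrite !big_nil msize1.
rewrite !big_cons; have [->|n0] := eqVneq (F i) 0; first by rewrite mul0r msize0.
have [->|n1] := eqVneq (\prod_(j <- r) F j) 0; first by rewrite mulr0 msize0.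
rewrite msizeM //; have := leq_add (h i) IH; rewrite addSn addnS.
by case: (msize _ + _)%N.
Qed.

Lemma poly_mdeg_exp (p : {mpoly K[N]}) d e : (msize p <= d.+1)%N ->
  (msize (p ^+ e) <= (e * d).+1)%N.
Proof.
move=> h; have := @poly_mdeg_prod _ (nseq e tt) (fun _ => p) (fun _ => d) (fun _ => h).
by rewrite !big_const_seq /= count_predT size_nseq iter_mulr_1 iter_addn_0 mulnC.
Qed.

(* The L^M monomials of partial degrees < L are sent to a space of dimension at most (c L)^N. *)
Lemma pdependent M (f : 'I_M -> {mpoly K[N]}) : (N < M)%N ->
  exists2 P : {mpoly K[M]}, P != 0 & psubst f P = 0.
Proof.
(* [e] bounds the degrees of the [f i], so images of the monomials have total degree below [c * L];
   the choice [L > c ^ N] gives [(c * L) ^ N < L ^ N.+1 <= L ^ M]. *)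
move=> NM; pose e := (\max_i msize (f i))%N; pose c := (M * e).+1.
pose L := (c ^ N).+1.
pose I := {ffun 'I_M -> 'I_L}; pose J := {ffun 'I_N -> 'I_(c * L)}.
pose mI (g : I) := [multinom (g i : nat) | i < M].
pose mJ (g : J) := [multinom (g i : nat) | i < N].
pose Q (g : I) := psubst f 'X_[mI g].
have QE g : Q g = \prod_i f i ^+ g i.
  by rewrite /Q /psubst mmapX /mmap1; apply: eq_bigr => i _; rewrite mnmE.
have fe i : (msize (f i) <= e.+1)%N by apply: leqW; apply: (leq_bigmax i).
have Qdeg g : (msize (Q g) <= c * L)%N.
  rewrite QE; apply: leq_trans (poly_mdeg_prod _ (fun i => poly_mdeg_exp _ (fe i))) _.
  have : (\sum_(i < M) g i * e <= \sum_(i < M) L.-1 * e)%N.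
    by apply: leq_sum => i _; rewrite leq_mul2r /= -ltnS ltn_ord orbT.
  by rewrite sum_nat_const card_ord /c /L /=; nia.
pose A : 'M[K]_(#|I|, #|J|) := \matrix_(i, j) (Q (enum_val i))@_(mJ (enum_val j)).
have ltJI : (#|J| < #|I|)%N.
  rewrite !card_ffun !card_ord expnMn.
  apply: leq_trans (_ : L ^ N.+1 <= _)%N; last by rewrite leq_pexp2l.
  by rewrite expnS ltn_pmul2r ?expn_gt0.
have : kermx A != 0.
  rewrite kermx_eq0 /row_free; apply/negP => /eqP e1.
  by have := rank_leq_col A; rewrite e1 leqNgt ltJI.
case/rowV0Pn => u /sub_kermxP uA un0.
exists (\sum_i u 0 i *: 'X_[mI (enum_val i)]).
  have [i ui] : exists i, u 0 i != 0.
    apply: contrapT => /forallNP h; case/eqP: un0; apply/rowP => i; rewrite mxE.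
    by apply/eqP/negPn/negP/h.
  apply: contraNneq ui => /(congr1 (mcoeff (mI (enum_val i)))).
  rewrite raddf_sum mcoeff0 (bigD1 i) //= mcoeffZ mcoeffX eqxx mulr1 big1 ?addr0.
    by move=> ->.
  move=> j ji; rewrite mcoeffZ mcoeffX; case: eqP => [E|]; rewrite ?mulr0 //.
  case/eqP: ji; apply: enum_val_inj; apply/ffunP => a; apply: val_inj.
  by have := congr1 (fun m : 'X_{1..M} => m a) E; rewrite /= !mnmE.
apply/mpolyP => m; rewrite mcoeff0 /psubst rmorph_sum /= raddf_sum /=.
have [lt|/forallPn [a na]] := boolP [forall a, m a < c * L]%N.
  pose g : J := [ffun a => Ordinal (forallP lt a)].
  have mE : m = mJ g by apply/mnmP => a; rewrite mnmE ffunE.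
  have := congr1 (fun B : 'rV_ _ => B 0 (enum_rank g)) uA; rewrite !mxE; apply: etrans.
  apply: eq_bigr => i _; rewrite /psubst mmapZ mul_mpolyC mcoeffZ mxE.
  by rewrite enum_rankK mE.
rewrite big1 // => i _; rewrite /psubst mmapZ mul_mpolyC mcoeffZ.
rewrite [_@__](_ : _ = 0) ?mulr0 //; apply/eqP; rewrite mcoeff_eq0 -/(psubst f _) -/(Q _).
apply: msize_mdeg_ge; apply: leq_trans (Qdeg _) _; move: na; rewrite -leqNgt => /leq_trans; apply.
by rewrite mdegE (bigD1 a) //= leq_addr.
Qed.

Lemma psubstC M (f : 'I_M -> {mpoly K[N]}) c : psubst f c%:MP = c%:MP.
Proof. exact: mmapC. Qed.

Lemma mderiv_const M (P : {mpoly K[M]}) : (forall i, mderiv i P = 0) -> P = (P@_0)%:MP.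
Proof.
move=> h; apply/mpolyP => m; rewrite mcoeffC; have [->|m0] := eqVneq m 0%MM.
  by rewrite mulr1.
rewrite mulr0; apply/eqP; rewrite mcoeff_eq0; apply/negP => Pm; case/eqP: m0.
by apply/mnmP => i; rewrite mnm0E; apply: mderiv0_supp Pm.
Qed.

(** Differentiating P(f) = 0 gives a linear relation between the gradients of the [f i], with
    coefficients the partial derivatives of [P] at [f]. The gradients are generically independent,
    so these partial derivatives, smaller than [P], vanish at [f] too; by induction they are zero
    and [P] is constant. *)
Lemma jac_pindep M (f : 'I_M -> {mpoly K[N]}) x : row_free (jac f x) -> pindep f.
Proof.
move=> /row_freeP[Q jQ] P; have [d] := ubnP (msize P).
elim: d P => // d IH P; rewrite ltnS => Pd fP.
have [//|Pn0] := eqVneq P 0.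
suff d0 i : mderiv i P = 0.
  by move: fP; rewrite (mderiv_const d0) psubstC => /eqP; rewrite mpolyC_eq0 => /eqP ->;
    rewrite mpolyC0.
apply: IH; first by apply: leq_trans Pd; apply: msize_mderiv.
pose G := \matrix_(i, j) mderiv j (f i) : 'M[{mpoly K[N]}]_(M, N).
pose c := \row_i psubst f (mderiv i P).
have cG : c *m G = 0.
  apply/rowP => j; rewrite !mxE; transitivity (mderiv j (psubst f P)); last by rewrite fP mderiv0.
  by rewrite psubst_deriv; apply: eq_bigr => l _; rewrite !mxE.
(* [Q] is a right inverse of the Jacobian matrix at [x], so the determinant of [E] takes the value 1
   at [x]. *)
pose E := G *m map_mx (@mpolyC N K) Q.
have detE : \det E != 0.
  apply/eqP => /(congr1 (meval x)); rewrite meval0 -det_map_mx map_mxM.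
  have -> : map_mx (meval x) G = jac f x by apply/matrixP => a b; rewrite !mxE.
  have -> : map_mx (meval x) (map_mx (@mpolyC N K) Q) = Q.
    by apply/matrixP => a b; rewrite !mxE mevalC.
  by rewrite jQ det1 => /eqP; rewrite oner_eq0.
have : c *m E *m \adj E = 0 by rewrite mulmxA cG !mul0mx.
rewrite -mulmxA mul_mx_adj mul_mx_scalar => /rowP/(_ i); rewrite !mxE.
by move/eqP; rewrite mulf_eq0 (negbTE detE) => /eqP.
Qed.

Definition padd M (f : 'I_M -> {mpoly K[N]}) (g : {mpoly K[N]}) (i : 'I_(M + 1)) :=
  match split i with inl j => f j | inr _ => g end.

Lemma paddl M f g j : @padd M f g (lshift 1 j) = f j.
Proof. by rewrite /padd; case: split_ordP => a // => [/lshift_inj ->|/eqP];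
  rewrite ?eq_lrshift. Qed.

Lemma paddr M f g j : @padd M f g (rshift M j) = g.
Proof. by rewrite /padd; case: split_ordP => a // /eqP; rewrite eq_rlshift. Qed.

Lemma jac_padd M (f : 'I_M -> {mpoly K[N]}) g x :
  jac (padd f g) x = col_mx (jac f x) (\row_j (mderiv j g).@[x]).
Proof.
apply/matrixP => i j; rewrite -[i]splitK; case: (split i) => a /=.
  by rewrite col_mxEu !mxE paddl.
by rewrite col_mxEd !mxE paddr.
Qed.

(** Descent on the size of a relation: its derivative in the last variable is smaller, so it serves
    as a new relation if it is nonzero but vanishes at the family. If it is zero, the last variable
    is absent in characteristic zero, and the relation is one of [f] alone. *)
Lemma dep_minimal M (f : 'I_M -> {mpoly K[N]}) g : pindep f -> ~ pindep (padd f g) ->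
  exists2 P, psubst (padd f g) P = 0 & psubst (padd f g) (mderiv (rshift M ord0) P) != 0.
Proof.
move=> indf /existsNP[P0 /not_implyP[P0r /eqP P0n]].
have [d] := ubnP (msize P0); elim: d P0 P0r P0n => // d IH P Pr Pn; rewrite ltnS => Pd.
have [d0|] := eqVneq (psubst (padd f g) (mderiv (rshift M ord0) P)) 0; last by exists P.
have [e0|ne] := eqVneq (mderiv (rshift M ord0) P) 0; last first.
  by apply: IH ne _; rewrite ?(leq_trans (msize_mderiv _ _) Pd).
have sup m i : m \in msupp P -> m i != 0%N -> exists j, i = lshift 1 j.
  move=> Pm; rewrite -[i]splitK; case: (split i) => a /=; first by exists a.
  by rewrite [a]ord1 (mderiv0_supp e0 Pm).
pose P' : {mpoly K[M]} := mmap (@mpolyC M K)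
  (fun i => match split i with inl j => 'X_j | inr _ => 0 end) P.
have P'l : mmap (@mpolyC (M + 1) K) (fun j => 'X_(lshift 1 j)) P' = P.
  rewrite -[RHS]mmap_id mmap_comp; apply: mmap_eq_supp => [c|m i Pm mi] /=.
    by rewrite mmapC.
  have [j ->] := sup m i Pm mi.
  by case: split_ordP => a => [/lshift_inj <-|/eqP]; rewrite ?eq_lrshift // mmapX mmap1U.
case/eqP: Pn; rewrite -P'l (_ : P' = 0) ?mmap0 //; apply: indf.
rewrite -Pr /psubst mmap_comp; apply: mmap_eq_supp => [c|m i Pm mi] /=.
  by rewrite mmapC.
have [j ->] := sup m i Pm mi; rewrite paddl.
by case: split_ordP => a => [/lshift_inj <-|/eqP]; rewrite ?eq_lrshift // mmapX mmap1U.
Qed.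

Lemma pindep_leq M (f : 'I_M -> {mpoly K[N]}) : pindep f -> (M <= N)%N.
Proof.
move=> indf; rewrite leqNgt; apply/negP => /(@pdependent _ f)[P Pn /indf P0].
by rewrite P0 eqxx in Pn.
Qed.

(** Adjoining coordinates as long as independence lasts reduces to the case where every coordinate
    is algebraic over [f]. Differentiating its relation then expresses each unit row through the
    gradients of [f] wherever the derivative in the last variable is nonzero; [h] adds one more
    nonvanishing condition. *)
Lemma pindep_jac M (f : 'I_M -> {mpoly K[N]}) h : pindep f -> h != 0 ->
  exists2 x, h.@[x] != 0 & row_free (jac f x).
Proof.
move=> indf hn0; have [d] := ubnP (N - M); elim: d M f indf => // d IH M f indf; rewrite ltnS => dN.
have MN := pindep_leq indf.
have [[j indj]|/forallNP dep] := pselect (exists j, pindep (padd f 'X_j)).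
  have M1N := pindep_leq indj.
  have [|x hx] := IH _ _ indj; first by lia.
  rewrite jac_padd -row_leq_rank -addsmxE => /leq_trans /(_ (mxrank_adds_leqif _ _)) le.
  exists x => //; rewrite -row_leq_rank;
    have := rank_leq_row (\row_j0 (mderiv j0 'X_j : {mpoly K[N]}).@[x]).
  by move: le; lia.
have /choice[P /all_and2[Pr Pd]] : forall j, exists P, psubst (padd f 'X_j) P = 0 /\
     psubst (padd f 'X_j) (mderiv (rshift M ord0) P) != 0.
  by move=> j; have [P] := dep_minimal indf (dep j); exists P.
pose g j := psubst (padd f 'X_j) (mderiv (rshift M ord0) (P j)).
have /mpoly_nonroot : h * \prod_j g j != 0.
  by rewrite mulf_neq0 //; apply/prodf_neq0 => j _; apply: Pd.
move=> /(_ charK0)[x]; rewrite mevalM mulf_eq0 negb_or => /andP[hx gx].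
exists x => //.
have gjx j : (g j).@[x] != 0.
  by move: gx; rewrite rmorph_prod => /prodf_neq0/(_ j isT).
have full : row_full (jac f x).
  rewrite -sub1mx; apply/row_subP => j.
  pose c := \row_i (psubst (padd f 'X_j) (mderiv (lshift 1 i) (P j))).@[x].
  have : c *m jac f x + (g j).@[x] *: row j 1%:M = 0.
    apply/rowP => l; have := congr1 (fun q => (mderiv l q).@[x]) (Pr j).
    rewrite psubst_deriv mderiv0 meval0 big_split_ord /= big_ord1 mevalD => e.
    rewrite !mxE -[RHS]e; congr (_ + _).
      rewrite raddf_sum; apply: eq_bigr => i _; rewrite !mxE paddl; exact/esym/mevalM.
    rewrite paddr mevalM -/(g j); congr (_ * _).
    rewrite mderivX mnm1E; case: eqP => [->|]; last by rewrite scale0r meval0.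
    have -> : (U_(l) - U_(l) = 0 :> 'X_{1..N})%MM by apply/mnmP => i; rewrite !mnmE subnn.
    by rewrite mpolyX0 scale1r meval1.
  move/eqP; rewrite addr_eq0 => /eqP E.
  have -> : row j 1%:M = - (g j).@[x]^-1 *: (c *m jac f x).
    by rewrite E scaleNr scalerN opprK scalerA mulVf // scale1r.
  by rewrite scalemx_sub // submxMl.
have eMN : M = N by apply/eqP; rewrite eqn_leq MN -(eqP full) rank_leq_row.
by rewrite /row_free (eqP full) eMN.
Qed.

End AlgIndep.

(** * Zariski tangent spaces *)

Section Tangent.
Variables (K : closedFieldType) (n : nat).
Hypothesis charK0 : [pchar K] =i pred0.
Local Notation pol := {mpoly K[n * n]}.
Implicit Types (f : pol) (A v : 'M[K]_n) (X : 'M[K]_n -> Prop).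

Definition genmx : 'M[pol]_n := \matrix_(i, j) 'X_(mxvec_index i j).

Definition pev (G : 'M[{poly K}]_n) f : {poly K} :=
  mmap (@polyC K) (fun i => mxvec G 0 i) f.

HB.instance Definition _ G := GRing.RMorphism.copy (pev G)
  (mmap (@polyC K) (fun i => mxvec G 0 i)).

Definition mxcomp f (P : 'M[pol]_n) : pol := mmap (@mpolyC (n * n) K) (fun i => mxvec P 0 i) f.

Definition at0 (G : 'M[{poly K}]_n) : 'M[K]_n := map_mx (horner_eval 0) G.
Definition deriv0 (G : 'M[{poly K}]_n) : 'M[K]_n := map_mx (fun p => p^`().[0]) G.
Definition mxline A v : 'M[{poly K}]_n := map_mx polyC A + 'X *: map_mx polyC v.

(** The point comes first so that evaluation at it can carry a ring morphism structure and act on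
    matrices through [map_mx]. *)
Definition mxev A f : K := mxeval f A.

HB.instance Definition _ A := GRing.RMorphism.copy (mxev A) (meval (fun i => mxvec A 0 i)).

Lemma mxvec_map (R S : Type) (g : R -> S) (B : 'M[R]_n) i :
  mxvec (map_mx g B) 0 i = g (mxvec B 0 i).
Proof. by case/mxvec_indexP: i => a b; rewrite !mxvecE mxE. Qed.

Lemma pev_horner f G s : (pev G f).[s] = mxeval f (map_mx (horner_eval s) G).
Proof.
rewrite -horner_evalE mmap_comp; apply: eq_bigr => m _; rewrite /= horner_evalE hornerC.
by congr (_ * _); apply: mmap1_eq => i; rewrite mxvec_map.
Qed.

Lemma pev_deriv f G : (pev G f)^`().[0] = mxdiff f (at0 G) (deriv0 G).
Proof.
rewrite (chain_rule (f := @polyC K)); last 3 first.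
- by move=> x y; rewrite derivD.
- by move=> x y; rewrite derivM.
- exact: derivC.
rewrite horner_sum; apply: eq_bigr => i _.
by rewrite hornerM -/(pev G _) pev_horner mxvec_map.
Qed.

Lemma pev_genmx G : map_mx (pev G) genmx = G.
Proof. by apply/matrixP => i j; rewrite !mxE /pev mmapX mmap1U mxvecE. Qed.

Lemma mxeval_genmx A : map_mx (mxev A) genmx = A.
Proof. by apply/matrixP => i j; rewrite !mxE /mxev /mxeval mevalXU mxvecE. Qed.

Lemma at0_line A v : at0 (mxline A v) = A.
Proof. by apply/matrixP => i j; rewrite !mxE /= horner_evalE !hornerE; ring. Qed.

Lemma deriv0_line A v : deriv0 (mxline A v) = v.
Proof.
by apply/matrixP => i j; rewrite !mxE /= derivD derivM derivX !derivC !hornerE; ring.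
Qed.

Lemma line_horner A v s : map_mx (horner_eval s) (mxline A v) = A + s *: v.
Proof. by apply/matrixP => i j; rewrite !mxE /= horner_evalE !hornerE; ring. Qed.

Lemma mxdiff_line f A v : mxdiff f A v = (pev (mxline A v) f)^`().[0].
Proof. by rewrite pev_deriv at0_line deriv0_line. Qed.

Lemma mxcomp_eval f P A : mxeval (mxcomp f P) A = mxeval f (map_mx (mxev A) P).
Proof.
rewrite /mxeval mmap_comp; apply: eq_bigr => m _; rewrite /= mevalC.
by congr (_ * _); apply: mmap1_eq => i; rewrite mxvec_map.
Qed.

Lemma mxcomp_diff f P A v :
  mxdiff (mxcomp f P) A v =
  mxdiff f (map_mx (mxev A) P) (map_mx (fun g => mxdiff g A v) P).
Proof.
rewrite /mxdiff.
have E i : mderiv i (mxcomp f P) = \sum_j mxcomp (mderiv j f) P * mderiv i (mxvec P 0 j).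
  apply: chain_rule => [||c]; [exact: mderivD| |exact: mderivC].
  by move=> x y; rewrite mderivM.
under eq_bigr => i _ do rewrite E -[mxeval _ A]/(mxev A _) rmorph_sum /= mulr_suml.
rewrite exchange_big /=; apply: eq_bigr => j _; rewrite mxvec_map mulr_sumr.
by apply: eq_bigr => i _; rewrite rmorphM /= {1}/mxev mxcomp_eval mulrA.
Qed.

(** [h] marks the finitely many parameters at which the curve may leave [X]; multiplying by it
    avoids treating them apart. *)
Lemma curve_vanishes f X G h : h != 0 -> vanishes_on X f ->
  (forall s, h.[s] != 0 -> X (map_mx (horner_eval s) G)) -> pev G f = 0.
Proof.
move=> h0 fX GX; suff : h * pev G f = 0 by move/eqP; rewrite mulf_eq0 (negbTE h0) => /eqP.
apply: (poly_ext0 charK0) => s _; rewrite hornerM.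
have [->|hs] := eqVneq h.[s] 0; first by rewrite mul0r.
by rewrite pev_horner (fX _ (GX _ hs)) mulr0.
Qed.

Lemma curve_tangent X G h : h != 0 -> (forall s, h.[s] != 0 -> X (map_mx (horner_eval s) G)) ->
  deriv0 G \in tangent X (at0 G).
Proof.
move=> h0 GX; apply/tangentP => f fX.
by rewrite -pev_deriv (curve_vanishes h0 fX GX) derivC horner0.
Qed.

Lemma curve_closed f X G h : h != 0 -> vanishes_on X f ->
  (forall s, h.[s] != 0 -> X (map_mx (horner_eval s) G)) -> mxeval f (at0 G) = 0.
Proof. by move=> h0 fX GX; rewrite -pev_horner (curve_vanishes h0 fX GX) horner0. Qed.

Lemma line_tangent X A v h : h != 0 -> (forall s, h.[s] != 0 -> X (A + s *: v)) ->
  v \in tangent X A.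
Proof.
move=> h0 hX; rewrite -{1}(deriv0_line A v) -{2}(at0_line A v).
by apply: (curve_tangent h0) => s s0; rewrite line_horner; apply: hX.
Qed.

Lemma tangent_sub X X' p : (forall f, vanishes_on X' f -> vanishes_on X f) ->
  (tangent X p <= tangent X' p)%VS.
Proof. by move=> h; apply/subvP => v /tangentP tv; apply/tangentP => f /h; apply: tv. Qed.

Lemma mxdiff_entry i j A v : mxdiff (genmx i j) A v = v i j.
Proof.
have e := congr1 (fun B : 'M_n => B i j) (pev_genmx (mxline A v)); rewrite mxE in e.
have e2 := congr1 (fun B : 'M_n => B i j) (deriv0_line A v); rewrite mxE in e2.
by rewrite mxdiff_line e.
Qed.

Lemma mxeval_entry i j A : mxeval (genmx i j) A = A i j.
Proof. by have := congr1 (fun B : 'M_n => B i j) (mxeval_genmx A); rewrite mxE. Qed.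

Lemma mxdiffC c A v : mxdiff c%:MP A v = 0.
Proof. by rewrite mxdiff_line /pev mmapC derivC horner0. Qed.

Lemma mxdiffB f g A v : mxdiff (f - g) A v = mxdiff f A v - mxdiff g A v.
Proof. by rewrite !mxdiff_line rmorphB derivB hornerD hornerN. Qed.

Lemma mxdiffZ c f A v : mxdiff (c *: f) A v = c * mxdiff f A v.
Proof. by rewrite !mxdiff_line /pev mmapZ mul_polyC derivZ hornerZ. Qed.

Lemma tangent_entry0 X p i j v : (forall u, X u -> u i j = 0) -> v \in tangent X p -> v i j = 0.
Proof.
move=> h /tangentP/(_ (genmx i j)); rewrite mxdiff_entry; apply=> u Xu.
by rewrite mxeval_entry h.
Qed.

(** The upper bound comes from the proportionality relations between the coordinates of [u - A] and
    those of [d], or from [u = A] if [d] is zero. *)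
Lemma tangent_param_line X A d : (forall u, X u <-> exists s, u = A + s *: d) ->
  tangent X A = <[d]>%VS.
Proof.
move=> XE; apply/vspaceP => v; apply/idP/vlineP => [/tangentP tv|[c ->]]; last first.
  apply: memvZ; apply: (@line_tangent _ _ _ 1); first exact: oner_neq0.
  by move=> s _; apply/XE; exists s.
have eq0 i j a b : d a b * v i j = d i j * v a b.
  pose e i j := genmx i j - (A i j)%:MP.
  have eE i' j' u : mxeval (e i' j') u = u i' j' - A i' j'.
    by rewrite /mxeval mevalB mevalC -/(mxeval _ _) mxeval_entry.
  have /tv : vanishes_on X (d a b *: e i j - d i j *: e a b).
    move=> u /XE[s ->]; rewrite /mxeval mevalB !mevalZ -![_.@[_]]/(mxeval _ _) !eE !mxE.
    by ring.
  by rewrite mxdiffB !mxdiffZ !mxdiffB !mxdiffC !mxdiff_entry => /eqP;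
    rewrite !subr0 subr_eq0 => /eqP.
have [d0|] := pselect (forall a b, d a b = 0).
  exists 0; rewrite scale0r; apply/matrixP => i j; rewrite mxE.
  have Xc u : X u -> (genmx i j - (A i j)%:MP).@[fun l => mxvec u 0 l] = 0.
    move=> /XE[s ->]; rewrite mevalB mevalC -/(mxeval _ _) mxeval_entry !mxE d0; ring.
  by have := tv _ Xc; rewrite mxdiffB mxdiffC mxdiff_entry subr0.
move=> /existsNP[a /existsNP[b /eqP dab]].
exists (v a b / d a b); apply/matrixP => i j; rewrite mxE.
by apply: (mulfI dab); rewrite eq0; field.
Qed.

Definition grad f A : 'rV[K]_(n * n) := \row_i mxeval (mderiv i f) A.

Lemma mxdiff_grad f A v : mxdiff f A v = (grad f A *m (mxvec v)^T) 0 0.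
Proof. by rewrite mxE; apply: eq_bigr => i _; rewrite !mxE. Qed.

(** A largest family of equations with independent gradients at [p]: an equation whose differential
    is nonzero on the common kernel would enlarge it. *)
Lemma tangent_equations X p : exists r (f : 'I_r -> pol),
  [/\ forall i, vanishes_on X (f i), row_free (\matrix_i grad (f i) p)
    & (r + \dim (tangent X p) = n * n)%N].
Proof.
pose Q r := `[< exists f : 'I_r -> pol,
  (forall i, vanishes_on X (f i)) /\ row_free (\matrix_i grad (f i) p) >].
have exQ : exists r, Q r.
  exists 0%N; apply/asboolP; exists (fun _ => 0); split; first by case.
  by rewrite /row_free -leqn0 rank_leq_row.
have ubQ r : Q r -> (r <= n * n)%N.
  by case/asboolP=> f [_ /eqP <-]; apply: rank_leq_col.
case: (ex_maxnP exQ ubQ) => r /asboolP[f [fX free]] maxr; exists r, f; split => //.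
set J := \matrix_i grad (f i) p in free.
pose h := linfun (mulmxr J^T \o @mxvec K n n).
have hE v : h v = mxvec v *m J^T by rewrite lfunE.
have kerh : lker h = tangent X p.
  apply/vspaceP => v; rewrite memv_ker hE; apply/idP/idP => [/eqP Jv|/tangentP tv].
    apply/tangentP => g gX; apply/eqP; apply: contraT => gv.
    have ng : ~~ (grad g p <= J)%MS.
      apply: contra gv => /submxP[u E]; rewrite mxdiff_grad E -mulmxA.
      by rewrite -[J]trmxK -trmx_mul Jv trmx0 mulmx0 mxE.
    have : Q (r + 1)%N; last by move/maxr; rewrite addn1 ltnn.
    apply/asboolP; exists (fun i => match split i with inl j => f j | inr _ => g end); split.
      by move=> i; case: (split i) => [j|_].
    have -> : \matrix_i grad (match split i with inl j => f j | inr _ => g end) p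
        = col_mx J (grad g p).
      apply/row_matrixP => i; rewrite rowK; case: split_ordP => j ->.
        by rewrite rowKu rowK.
      by rewrite rowKd [j]ord1 row_id.
    rewrite -row_leq_rank -addsmxE.
    have lt : (J < J + grad g p)%MS.
      by rewrite ltmxE addsmxSl /= addsmx_sub submx_refl.
    by have := rank_ltmx lt; rewrite addn1 (eqP free).
  apply/eqP/rowP => i; rewrite !mxE.
  have := tv _ (fX i); rewrite mxdiff_grad mxE => e; rewrite -[RHS]e.
  by apply: eq_bigr => j _; rewrite !mxE mulrC.
have := limg_ker_dim h fullv; rewrite capfv kerh dimvf /dim /= => <-; rewrite addnC.
congr (_ + _)%N; suff -> : limg h = fullv by rewrite dimvf /dim /= mul1n.
apply/vspaceP => w; rewrite memvf.
have /row_freeP[B JB] := free.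
apply/memv_imgP; exists (vec_mx (w *m B^T)); rewrite ?memvf // hE vec_mxK.
by rewrite -mulmxA -trmx_mul JB trmx1 mulmx1.
Qed.

(** Equations with independent gradients at [p] keep this property wherever a determinant [delta],
    equal to 1 at [p], is nonzero. As [p] lies in the closure of [S], this happens at some point of
    [S]. *)
Lemma tangent_semicontinuous X (S : 'M[K]_n -> Prop) p d :
  (forall f, vanishes_on S f -> mxeval f p = 0) ->
  (forall q, S q -> (d <= \dim (tangent X q))%N) -> (d <= \dim (tangent X p))%N.
Proof.
move=> Sp Sd; have [r [f [fX free dimp]]] := tangent_equations X p.
have /row_freeP[B JB] := free.
pose G := \matrix_(i < r, j < n * n) mderiv j (f i).
have GE q : map_mx (mxev q) G = \matrix_i grad (f i) q.
  by apply/matrixP => i j; rewrite !mxE.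
pose delta := \det (G *m map_mx (@mpolyC (n * n) K) B).
have deltaE q : mxeval delta q = \det ((\matrix_i grad (f i) q) *m B).
  rewrite -[LHS]/(mxev q _) -det_map_mx map_mxM GE; congr (\det (_ *m _)).
  by apply/matrixP => i j; rewrite !mxE; apply: mevalC.
have [q Sq dq] : exists2 q, S q & mxeval delta q != 0.
  apply: contrapT => h; have := Sp delta; rewrite deltaE JB det1 => /(_ _)/eqP.
  rewrite oner_eq0 => ne; apply/notF/ne => q Sq.
  by apply/eqP; apply: contraT => dq; case: h; exists q.
apply: leq_trans (Sd q Sq) _; rewrite -(leq_add2l r) dimp.
set J := \matrix_i grad (f i) q in deltaE.
have freeq : row_free J.
  rewrite /row_free eqn_leq rank_leq_row /=.
  move: dq; rewrite deltaE -unitfE -[_ \is a _]/(_ \in unitmx) => u.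
  by rewrite -{1}(mxrank_unit u) mxrankM_maxl.
pose h := linfun (mulmxr J^T \o @mxvec K n n).
have hE v : h v = mxvec v *m J^T by rewrite lfunE.
have sub : (tangent X q <= lker h)%VS.
  apply/subvP => v /tangentP tv; rewrite memv_ker hE.
  apply/eqP/rowP => i; rewrite !mxE.
  have := tv _ (fX i); rewrite mxdiff_grad mxE => e; rewrite -[RHS]e.
  by apply: eq_bigr => j _; rewrite !mxE mulrC.
have := limg_ker_dim h fullv; rewrite capfv dimvf /dim /= => <-; rewrite addnC.
apply: leq_add; first exact: dimvS.
suff -> : limg h = fullv by rewrite dimvf /dim /= mul1n.
apply/vspaceP => w; rewrite memvf.
have /row_freeP[C JC] := freeq.
apply/memv_imgP; exists (vec_mx (w *m C^T)); rewrite ?memvf // hE vec_mxK.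
by rewrite -mulmxA -trmx_mul JC trmx1 mulmx1.
Qed.

Lemma polynomial_conj f (g : 'M[K]_n) : g \in unitmx ->
  exists f', forall A, mxeval f' A = mxeval f (conjmx_by g A).
Proof.
move=> ug.
pose P := map_mx (@mpolyC (n * n) K) g *m genmx *m map_mx (@mpolyC (n * n) K) (invmx g).
exists (mxcomp f P) => A; rewrite mxcomp_eval; congr (mxeval f _).
rewrite !map_mxM mxeval_genmx; congr (_ *m _ *m _); apply/matrixP => i j; rewrite !mxE;
  exact: mevalC.
Qed.

Lemma tangent_conj X (g : 'M[K]_n) p : g \in unitmx ->
  (forall u, X u -> X (conjmx_by g u)) ->
  forall v, v \in tangent X p -> conjmx_by g v \in tangent X (conjmx_by g p).
Proof.
move=> ug gX v /tangentP tv; apply/tangentP => f fX.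
pose P := map_mx (@mpolyC (n * n) K) g *m genmx *m map_mx (@mpolyC (n * n) K) (invmx g).
(* One identity for all ring morphisms: it is applied to evaluation at a point and to restriction to
   a line. *)
have PE (R : comNzRingType) (e : {rmorphism pol -> R}) (c : {rmorphism K -> R}) :
   (forall a, e a%:MP = c a) -> map_mx e P = map_mx c g *m map_mx e genmx *m map_mx c (invmx g).
  by move=> ec; rewrite !map_mxM; congr (_ *m _ *m _); apply/matrixP => i j; rewrite !mxE.
have PA A : map_mx (mxev A) P = conjmx_by g A.
  rewrite (PE _ _ idfun) ?mxeval_genmx.
    by congr (_ *m _ *m _); apply/matrixP => i j; rewrite !mxE.
  by move=> a; apply: mevalC.
have Pv A w : map_mx (fun h => mxdiff h A w) P = conjmx_by g w.
  apply/matrixP => i j; rewrite mxE mxdiff_line.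
  have := congr1 (fun B : 'M_n => (B i j)^`().[0]) (PE _ (pev (mxline A w)) polyC (fun a =>
    mmapC _ _ a)).
  rewrite mxE => ->; rewrite pev_genmx.
  have -> : map_mx polyC g *m mxline A w *m map_mx polyC (invmx g) =
     mxline (conjmx_by g A) (conjmx_by g w).
    by rewrite /mxline /conjmx_by mulmxDr mulmxDl !map_mxM -scalemxAr -scalemxAl.
  by have := congr1 (fun B : 'M_n => B i j) (deriv0_line (conjmx_by g A) (conjmx_by g w));
    rewrite mxE.
have := tv (mxcomp f P); rewrite mxcomp_diff PA Pv; apply => A XA.
by rewrite mxcomp_eval PA; apply/fX/gX.
Qed.

Lemma conjmx_by_linear (g : 'M[K]_n) : linear (conjmx_by g).
Proof. by move=> a u v; rewrite /conjmx_by mulmxDr mulmxDl -scalemxAr -scalemxAl. Qed.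

HB.instance Definition _ g := GRing.isLinear.Build K 'M[K]_n 'M[K]_n _ (conjmx_by g)
  (conjmx_by_linear g).

Lemma invmx_eq m (A B : 'M[K]_m) : A *m B = 1%:M -> invmx A = B.
Proof.
move=> AB; have [uA _] := mulmx1_unit AB.
by rewrite -[LHS]mulmx1 -AB mulmxA mulVmx // mul1mx.
Qed.

Lemma invmx_mul m (A B : 'M[K]_m) : A \in unitmx -> B \in unitmx ->
  invmx (A *m B) = invmx B *m invmx A.
Proof. by move=> uA uB; apply: invmx_eq; rewrite mulmxA mulmxK // mulmxV. Qed.

Lemma conjmx_byM (g h u : 'M[K]_n) : g \in unitmx -> h \in unitmx ->
  conjmx_by g (conjmx_by h u) = conjmx_by (g *m h) u.
Proof. by move=> ug uh; rewrite /conjmx_by invmx_mul // !mulmxA. Qed.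

Lemma conjmx_by1 (u : 'M[K]_n) : conjmx_by 1%:M u = u.
Proof. by rewrite /conjmx_by invmx1 mul1mx mulmx1. Qed.

Lemma conjmx_by_inj (g : 'M[K]_n) : g \in unitmx -> injective (conjmx_by g).
Proof.
move=> ug; apply: (can_inj (g := conjmx_by (invmx g))) => u.
by rewrite conjmx_byM ?unitmx_inv // mulVmx // conjmx_by1.
Qed.

Lemma dim_conj (g : 'M[K]_n) (U : {vspace 'M[K]_n}) : g \in unitmx ->
  \dim (linfun (conjmx_by g) @: U) = \dim U.
Proof.
move=> ug; apply: limg_dim_eq; apply/eqP; rewrite -subv0; apply/subvP => v.
rewrite memv_cap memv_ker lfunE /= memv0 => /andP[_ /eqP e]; apply/eqP.
by apply: (conjmx_by_inj ug); rewrite e linear0.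
Qed.

Lemma dim_tangent_conj X (g : 'M[K]_n) p : g \in unitmx ->
  (forall u, X u -> X (conjmx_by g u)) ->
  (\dim (tangent X p) <= \dim (tangent X (conjmx_by g p)))%N.
Proof.
move=> ug gX; rewrite -(dim_conj _ ug); apply: dimvS.
by apply/subvP => _ /memv_imgP[v tv ->]; rewrite lfunE /=; apply: tangent_conj.
Qed.

End Tangent.

(** * Borel orbits and their closures *)

Section Borel.
Variables (K : closedFieldType) (n : nat).
Implicit Types (A b u : 'M[K]_n) (w : 'S_n).

Lemma det_upper A : (forall i j : 'I_n, (j < i)%N -> A i j = 0) -> \det A = \prod_i A i i.
Proof.
move=> h; rewrite -det_tr det_trig; last by apply/is_trig_mxP => i j ij; rewrite mxE h.
by apply: eq_bigr => i _; rewrite mxE.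
Qed.

Lemma borelI A : (forall i j : 'I_n, (j < i)%N -> A i j = 0) -> (forall i, A i i != 0) -> borel A.
Proof.
move=> h d; split => //; rewrite unitmxE unitfE det_upper //.
by apply/prodf_neq0 => i _.
Qed.

Lemma borel_diag A i : borel A -> A i i != 0.
Proof.
by case=> u h; move: u; rewrite unitmxE unitfE det_upper // => /prodf_neq0/(_ i isT).
Qed.

Lemma borel1 : borel (1%:M : 'M[K]_n).
Proof. by apply: borelI => [i j ij|i]; rewrite mxE ?eqxx ?oner_neq0 // -val_eqE gtn_eqF. Qed.

Lemma borelM A b : borel A -> borel b -> borel (A *m b).
Proof.
move=> [uA hA] [ub hb]; split; first by rewrite unitmx_mul uA.
move=> i j ij; rewrite mxE big1 // => l _.
have [li|il] := ltnP l i; first by rewrite hA // mul0r.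
by rewrite hb ?mulr0 // (leq_trans ij).
Qed.

Lemma borelV b : borel b -> borel (invmx b).
Proof.
move=> bb; have [ub hb] := bb; split; first by rewrite unitmx_inv.
move=> i j; have [m] := ubnP j; elim: m j => // m IH j; rewrite ltnS => jm ij.
have := congr1 (fun A : 'M_n => A i j) (mulVmx ub).
rewrite !mxE -[in RHS]val_eqE gtn_eqF // (bigD1 j) //= big1 ?addr0 => [/eqP|l lj].
  by rewrite mulf_eq0 (negbTE (borel_diag j bb)) orbF => /eqP.
have [jl|lj'] := ltnP j l; first by rewrite hb ?mulr0.
have ltj : (l < j)%N by rewrite ltn_neqAle lj'; move: lj; rewrite -val_eqE => ->.
by rewrite IH ?mul0r //; [exact: leq_trans ltj jm|exact: ltn_trans ltj ij].
Qed.

Lemma dotmxM w w' : dotmx K w *m dotmx K w' = dotmx K (wcomp w w').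
Proof.
apply/matrixP => i j; rewrite !mxE (bigD1 (w' j)) //= !mxE eqxx mulr1 big1 ?addr0.
  by rewrite wcompE.
by move=> l lj; rewrite !mxE (negbTE lj) mulr0.
Qed.

Lemma dotmx1 : dotmx K 1%g = 1%:M :> 'M_n.
Proof. by apply/matrixP => i j; rewrite !mxE perm1. Qed.

Lemma dotmxV w : invmx (dotmx K w) = dotmx K w^-1%g.
Proof. by apply: invmx_eq; rewrite dotmxM /wcomp mulVg dotmx1. Qed.

Lemma dotmx_unit w : dotmx K w \in unitmx.
Proof.
have : dotmx K w *m dotmx K w^-1%g = 1%:M by rewrite dotmxM /wcomp mulVg dotmx1.
by case/mulmx1_unit.
Qed.

Lemma dotmx_mulr A w i j : (A *m dotmx K w) i j = A i (w j).
Proof.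
rewrite !mxE (bigD1 (w j)) //= !mxE eqxx mulr1 big1 ?addr0 // => l lj.
by rewrite !mxE (negbTE lj) mulr0.
Qed.

Lemma dotmx_mull A w i j : (dotmx K w *m A) (w i) j = A i j.
Proof.
rewrite !mxE (bigD1 i) //= !mxE eqxx mul1r big1 ?addr0 // => l lj.
by rewrite !mxE (inj_eq perm_inj) eq_sym (negbTE lj) mul0r.
Qed.

Lemma conj_dotmx A w i j : conjmx_by (dotmx K w) A (w i) (w j) = A i j.
Proof. by rewrite /conjmx_by dotmxV dotmx_mulr permK dotmx_mull. Qed.

Lemma conj_dotmxE A w i j : conjmx_by (dotmx K w) A i j = A (w^-1%g i) (w^-1%g j).
Proof. by rewrite -{1}[i](permKV w) -{1}[j](permKV w) conj_dotmx. Qed.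

Lemma conj_borel w y : y \in unitmx -> (forall i j, y i j != 0 -> (w i <= w j)%N) ->
  borel (conjmx_by (dotmx K w) y).
Proof.
move=> uy h; split.
  by rewrite /conjmx_by !unitmx_mul uy unitmx_inv dotmx_unit.
move=> i j ji; rewrite conj_dotmxE; apply/eqP; apply: contraTT ji => /h.
by rewrite !permKV -leqNgt.
Qed.

Lemma conj_borel_sub w b : borel b -> (forall i j, b i j != 0 -> (w i <= w j)%N) ->
  borel (conjmx_by (dotmx K w) b).
Proof. by case=> ub _; apply: conj_borel. Qed.

Lemma mul_delta_r (R : comNzRingType) m p r (i : 'I_m) (j : 'I_p) (A : 'M[R]_(r, m)) a c :
  (A *m delta_mx i j) a c = A a i * (c == j)%:R.
Proof.
by rewrite mxE (bigD1 i) //= mxE eqxx /= big1 ?addr0 // => x xi; rewrite mxE (negbTE xi) mulr0.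
Qed.

Lemma mul_delta_l (R : comNzRingType) m p r (i : 'I_m) (j : 'I_p) (B : 'M[R]_(p, r)) a c :
  (delta_mx i j *m B) a c = (a == i)%:R * B j c.
Proof.
by rewrite mxE (bigD1 j) //= mxE eqxx andbT big1 ?addr0 // => x xi;
  rewrite mxE (negbTE xi) andbF mul0r.
Qed.

Lemma transvection_unit (i j : 'I_n) s : i != j ->
  (1%:M + s *: delta_mx i j : 'M[K]_n) *m (1%:M - s *: delta_mx i j) = 1%:M.
Proof.
move=> ij; rewrite mulmxDl mul1mx mulmxBr mulmx1 -scalemxAl -scalemxAr mul_delta_mx_0 1?eq_sym //.
by rewrite !scaler0 subr0 subrK.
Qed.

Lemma uneg_inv (e : 'I_n * 'I_n) (s : K) : (e.1 < e.2)%N -> invmx (uneg e s) = uneg e (- s).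
Proof.
move=> lt; apply: invmx_eq; rewrite /uneg scaleNr transvection_unit // -val_eqE.
by rewrite gtn_eqF.
Qed.

Lemma uneg_unit (e : 'I_n * 'I_n) (s : K) : (e.1 < e.2)%N -> uneg e s \in unitmx.
Proof.
move=> lt; have : uneg e s *m uneg e (- s) = 1%:M.
  by rewrite /uneg scaleNr transvection_unit // -val_eqE gtn_eqF.
by case/mulmx1_unit.
Qed.

Definition upos (e : 'I_n * 'I_n) (s : K) : 'M[K]_n := 1%:M + s *: delta_mx e.1 e.2.

Lemma upos_borel (e : 'I_n * 'I_n) s : (e.1 < e.2)%N -> borel (upos e s).
Proof.
move=> lt; apply: borelI => [i j ji|i]; rewrite !mxE.
  have -> : (i == e.1) && (j == e.2) = false.
    by apply/negP => /andP[/eqP E /eqP E']; move: ji; rewrite E E'; lia.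
  by rewrite -val_eqE gtn_eqF // mulr0 addr0.
have -> : (i == e.1) && (i == e.2) = false.
  by apply/negP => /andP[/eqP E /eqP E']; move: lt; rewrite -E -E'; lia.
by rewrite eqxx mulr0 addr0 oner_neq0.
Qed.

(** The torus factor of [uneg_bruhat]; its sign compensates the determinant -1 of the permutation
    matrix of a transposition. *)
Definition tor (e : 'I_n * 'I_n) (s : K) : 'M[K]_n :=
  diag_mx (\row_i (if i == e.1 then - s^-1 else if i == e.2 then s else 1)).

Lemma tor_borel e s : s != 0 -> borel (tor e s).
Proof.
move=> s0; apply: borelI => [i j ji|i]; rewrite !mxE; first by rewrite -[i == j]val_eqE gtn_eqF.
rewrite eqxx mulr1n; case: ifP => _; first by rewrite oppr_eq0 invr_eq0.
by case: ifP => _; rewrite ?oner_neq0.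
Qed.

Lemma conj_invmx (g y : 'M[K]_n) : g \in unitmx -> y \in unitmx ->
  invmx (conjmx_by g y) = conjmx_by g (invmx y).
Proof.
move=> ug uy; apply: invmx_eq; rewrite /conjmx_by !mulmxA mulmxKV // -[g *m y *m _]mulmxA.
by rewrite mulmxV // mulmx1 mulmxV.
Qed.

(* The SL_2 identity expressing a lower transvection through its Bruhat decomposition. *)
Lemma uneg_bruhat (e : 'I_n * 'I_n) (s : K) : (e.1 < e.2)%N -> s != 0 ->
  uneg e s = upos e s^-1 *m tor e s *m dotmx K (tperm e.1 e.2) *m upos e s^-1.
Proof.
case: e => a b /= ab s0; have nab : a != b by rewrite -val_eqE ltn_eqF.
have nba : b != a by rewrite eq_sym.
pose h i := if i == a then - s^-1 else if i == b then s else 1.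
rewrite -[_ *m tor _ _ *m _]mulmxA; set N := tor (a, b) s *m dotmx K (tperm a b).
have NE i j : N i j = h i * (i == tperm a b j)%:R.
  by rewrite /N dotmx_mulr !mxE /= mulr_natr.
have UN (A : 'M[K]_n) i j : (upos (a, b) s^-1 *m A) i j = A i j + s^-1 * ((i == a)%:R * A b j).
  by rewrite /upos mulmxDl mul1mx -scalemxAl mxE [X in _ + X]mxE mul_delta_l.
have NU (A : 'M[K]_n) i j : (A *m upos (a, b) s^-1) i j = A i j + s^-1 * (A i a * (j == b)%:R).
  by rewrite /upos mulmxDr mulmx1 -scalemxAr mxE [X in _ + X]mxE mul_delta_r.
have tE j : tperm a b j = if j == a then b else if j == b then a else j.
  by case: tpermP => [->|->|/eqP ja /eqP jb];
    rewrite ?eqxx ?(negbTE nba) // (negbTE ja) (negbTE jb).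
apply/matrixP => i j; rewrite NU !UN !NE !mxE /= /h !tE (negbTE nba) !eqxx.
case: (eqVneq i a) => [E|ia]; [rewrite ?E|case: (eqVneq i b) => [E|ib]; [rewrite ?E|]];
  (case: (eqVneq j a) => [F|ja]; [rewrite ?F|case: (eqVneq j b) => [F|jb]; [rewrite ?F|]]);
  rewrite ?eqxx ?(negbTE nab) ?(negbTE nba) ?(negbTE ia) ?(negbTE ib) //= ?(eq_sym a j)
    ?(eq_sym b j) ?(negbTE ja) ?(negbTE jb) /=; try (by field); case: (i == j) => /=; by field.
Qed.
End Borel.

(** * The orbits B w x and their closure relations *)

Section Orbits.
Variables (K : closedFieldType) (n k : nat).
Hypothesis charK0 : [pchar K] =i pred0.
Hypothesis le_2k_n : (2 * k <= n)%N.
Implicit Types (A b u : 'M[K]_n) (w v : 'S_n) (i j : 'I_n).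
Local Notation x := (xk K n k).
Local Notation sh := (sh k).

Lemma xkE i j : x i j = ((i < k)%N && (j == sh i))%:R.
Proof.
by rewrite mxE; case ik: (i < k)%N => //=; rewrite -val_eqE /= shE // addnC.
Qed.

Lemma mulmx_xk A i j : (i < k)%N -> (A *m x) j (sh i) = A j i.
Proof.
move=> ik; rewrite mxE (bigD1 i) //= xkE ik eqxx mulr1 big1 ?addr0 // => l li.
rewrite xkE; case lk: (l < k)%N; rewrite ?mulr0 //= eq_sym.
by rewrite (inj_in_eq (sh_inj le_2k_n)) ?inE // (negbTE li) mulr0.
Qed.

Lemma xk_mulmx A i j : (i < k)%N -> (x *m A) i j = A (sh i) j.
Proof.
move=> ik; rewrite mxE (bigD1 (sh i)) //= xkE ik eqxx mul1r big1 ?addr0 // => l li.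
by rewrite xkE (negbTE li) andbF mul0r.
Qed.

Lemma xk_mulmx0 A i j : (k <= i)%N -> (x *m A) i j = 0.
Proof. by move=> ik; rewrite mxE big1 // => l _; rewrite xkE ltnNge ik mul0r. Qed.

Lemma xk_sq : x *m x = 0.
Proof.
apply/matrixP => i j; rewrite [RHS]mxE; have [ik|ik] := ltnP i k; last by rewrite xk_mulmx0.
by rewrite xk_mulmx // xkE ltnNge sh_ge.
Qed.

Lemma rank_xk : \rank x = k.
Proof.
have kn : (k <= n)%N by lia.
have Axk : x = pid_mx k *m (\matrix_(i, j) (j == i + (n - k) :> nat)%N%:R : 'M[K]_n).
  apply/matrixP => i j; rewrite !mxE (bigD1 i) //= !mxE eqxx /= big1 ?addr0.
    by case: (i < k)%N; rewrite ?mul1r ?mul0r.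
  move=> l li; rewrite !mxE; case: eqP => [/val_inj e|_]; last by rewrite mul0r.
  by rewrite e eqxx in li.
apply/eqP; rewrite eqn_leq; apply/andP; split.
  by rewrite Axk; apply: leq_trans (mxrankM_maxl _ _) _; rewrite rank_pid_mx.
pose B : 'M[K]_n := \matrix_(i, j) (i == j + (n - k) :> nat)%N%:R.
have xB : x *m B = pid_mx k.
  apply/matrixP => i j; have [ik|ik] := ltnP i k; last first.
    by rewrite xk_mulmx0 // !mxE ltnNge ik andbF.
  by rewrite xk_mulmx // !mxE shE // eqn_add2r ik andbT.
by rewrite -{1}(@rank_pid_mx K n n k kn kn) -xB mxrankM_maxl.
Qed.

Lemma Ok_conj g u : g \in unitmx -> Ok k u -> Ok k (conjmx_by g u).
Proof.
move=> ug [u2 ru]; split.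
  by rewrite /conjmx_by !mulmxA mulmxKV // -[g *m u *m u]mulmxA u2 mulmx0 mul0mx.
by rewrite /conjmx_by mxrankMfree ?row_free_unit ?unitmx_inv // -mxrank_tr trmx_mul
  mxrankMfree ?mxrank_tr // row_free_unit unitmx_tr.
Qed.

Lemma Ok_xk : Ok k x.
Proof. by split; [exact: xk_sq|exact: rank_xk]. Qed.

Lemma BorbitE w u : Borbit k w u <->
  exists2 b, borel b & u = conjmx_by b (conjmx_by (dotmx K w) x).
Proof.
by split=> -[b bb ->]; exists b => //; rewrite conjmx_byM ?dotmx_unit //; case: bb.
Qed.

Lemma Borbit_Ok w u : Borbit k w u -> Ok k u.
Proof.
by move=> /BorbitE[b [ub _] ->]; do 2 (apply: Ok_conj; rewrite ?dotmx_unit //); apply: Ok_xk.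
Qed.

Lemma Borbit_conj w b u : borel b -> Borbit k w u -> Borbit k w (conjmx_by b u).
Proof.
move=> bb /BorbitE[b' bb' ->]; apply/BorbitE; exists (b *m b'); first exact: borelM.
by rewrite conjmx_byM //; [case: bb|case: bb'].
Qed.

Lemma Borbit_rep w : Borbit k w (conjmx_by (dotmx K w) x).
Proof. by apply/BorbitE; exists 1%:M; rewrite ?conjmx_by1 //; apply: borel1. Qed.

(* B w B C_k / C_k *)
Definition BBset w u := exists b1 b2, [/\ borel b1, borel b2 &
  u = conjmx_by b1 (conjmx_by (dotmx K w) (conjmx_by b2 x))].

(** Says that [S'] lies in the Zariski closure of [S]; closure relations then compose as
    functions. *)
Definition cvanish (S S' : 'M[K]_n -> Prop) := forall f, vanishes_on S f -> vanishes_on S' f.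

Lemma cvanish_sub (S S' : 'M[K]_n -> Prop) : (forall u, S' u -> S u) -> cvanish S S'.
Proof. by move=> h f fS u /h; apply: fS. Qed.

Lemma cvanish_trans (S S' S'' : 'M[K]_n -> Prop) : cvanish S S' -> cvanish S' S'' -> cvanish S S''.
Proof. by move=> h h' f /h /h'. Qed.

(** By the SL_2 identity [uneg e s] lies in B r_e B; as [w e.1 < w e.2], conjugation by [w] keeps
    the left Borel factor in B. *)
Lemma BBset_uneg w (e : 'I_n * 'I_n) b1 b2 s : (e.1 < e.2)%N -> (w e.1 < w e.2)%N -> s != 0 ->
  borel b1 -> borel b2 ->
  BBset (wcomp w (tperm e.1 e.2))
    (conjmx_by b1 (conjmx_by (dotmx K w) (conjmx_by (uneg e s) (conjmx_by b2 x)))).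
Proof.
move=> lt wlt s0 bb1 bb2.
have bu := upos_borel s^-1 lt.
have bt := tor_borel e s0.
pose y := upos e s^-1 *m tor e s.
have by_ : borel y by apply: borelM.
have bz : borel (conjmx_by (dotmx K w) y).
  apply: conj_borel_sub => // i j.
  rewrite /y /tor mul_mx_diag !mxE mulf_eq0 negb_or => /andP[+ _].
  case: (eqVneq i j) => [-> //|ij].
  case: andP => [[/eqP-> /eqP->] _|_]; first exact: ltnW.
  by rewrite mulr0 addr0 eqxx.
exists (b1 *m conjmx_by (dotmx K w) y), (upos e s^-1 *m b2); split; try exact: borelM.
have uu := dotmx_unit K w; have [u1 _] := bb1; have [u2 _] := bb2; have [uz _] := bz.
have [up _] := bu; have [uy _] := by_.
rewrite -[in RHS]conjmx_byM // -[in RHS]conjmx_byM //; congr (conjmx_by b1 _).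
have [ut _] := bt.
rewrite !conjmx_byM ?(unitmx_mul, unitmx_inv, uu, up, u2, ut, uneg_unit, dotmx_unit) //;
  congr (conjmx_by _ x).
rewrite uneg_bruhat // -dotmxM /conjmx_by -/y !mulmxA.
by rewrite (mulmxKV uu).
Qed.

(** For a step from [t] to [t (a c)], inserting the lower transvection with parameter [s] between
    [t] and [b2] gives a curve that lies in the larger double coset for [s] nonzero and passes
    through the given point at [s = 0]. *)
Lemma bruhat_closure w w' : bruhat w w' -> cvanish (BBset w') (BBset w).
Proof.
case/connectP => p; elim/last_ind: p w' => [|p z IH] w'; first by move=> _ -> f.
rewrite rcons_path last_rcons => /andP[wp st] ->; apply: cvanish_trans (IH _ wp erefl).
case/bruhat_stepP: st => a [c [ac wac ->]] f fv _ [b1 [b2 [bb1 bb2 ->]]].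
set t := last w p in wac fv *.
have [u1 _] := bb1; have ut := dotmx_unit K t.
pose D : 'M[{poly K}]_n := delta_mx c a.
pose g := b1 *m dotmx K t.
(* The inverse of [1 + X D] is [1 - X D], so the curve is polynomial. *)
pose G : 'M[{poly K}]_n := map_mx polyC g *m ((1%:M + 'X *: D) *m map_mx polyC (conjmx_by b2 x) *m
   (1%:M - 'X *: D)) *m map_mx polyC (invmx g).
have GE s : map_mx (horner_eval s) G = conjmx_by g
    ((1%:M + s *: delta_mx c a) *m conjmx_by b2 x *m (1%:M - s *: delta_mx c a)).
  have cst A : map_mx (horner_eval s) (map_mx polyC A) = A.
    by apply/matrixP => i j; rewrite !mxE /= horner_evalE hornerC.
  rewrite /G /conjmx_by !map_mxM !cst /= !map_mxD map_mxN !map_mxZ /= map_mx1 map_delta_mx.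
  by rewrite horner_evalE hornerX.
have -> : conjmx_by b1 (conjmx_by (dotmx K t) (conjmx_by b2 x)) = at0 G.
  by rewrite /at0 GE !scale0r addr0 subr0 mul1mx mulmx1 conjmx_byM.
apply: (curve_closed charK0 (h := 'X) (X := BBset (wcomp t (tperm a c)))) => //.
  by rewrite polyX_eq0.
move=> s; rewrite hornerX => s0; rewrite GE.
have -> : (1%:M + s *: delta_mx c a) *m conjmx_by b2 x *m (1%:M - s *: delta_mx c a) =
    conjmx_by (uneg (a, c) s) (conjmx_by b2 x).
  by rewrite [in RHS]/conjmx_by uneg_inv // /uneg scaleNr.
rewrite -conjmx_byM //; exact: (@BBset_uneg t (a, c)).
Qed.

(** Modulo the stabilizer of [x], an element of B may be replaced by the inverse of a matrix [y]
    that differs from the identity in the last [k] rows only. These rows are the first [k] rows of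
    [u = b x b^-1], so that [x y = u] and [y x = x]. *)
Lemma conj_borel_xk b : borel b -> exists y, [/\ y \in unitmx,
  forall i j, y i j != 0 -> (i == j) || ((n - k <= i)%N && (i < j)%N) &
  conjmx_by b x = conjmx_by (invmx y) x].
Proof.
move=> bb; have [ub hb] := bb; have [ubi hbi] := borelV bb.
set u := conjmx_by b x.
have uE i j : u i j = \sum_(l in 'I_n | (l < k)%N) b i l * invmx b (sh l) j.
  rewrite /u /conjmx_by -mulmxA mxE (bigID (fun l : 'I_n => (l < k)%N)) /= [X in _ + X]big1 ?addr0.
    by apply: eq_bigr => l lk; rewrite xk_mulmx.
  by move=> l; rewrite -leqNgt => kl; rewrite xk_mulmx0 // mulr0.
have u0 i j : u i j != 0 -> (i < k)%N && (i + (n - k) <= j)%N.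
  apply: contraR => h; rewrite uE big1 // => l lk.
  have [li|il] := ltnP l i; first by rewrite hb // mul0r.
  rewrite hbi ?mulr0 //; rewrite shE //; move: h; lia.
have ud i : (i < k)%N -> u i (sh i) != 0.
  move=> ik; rewrite uE (bigD1 i) //= big1 ?addr0.
    by rewrite mulf_neq0 // (borel_diag, borel_diag _ (borelV bb)).
  move=> l /andP[lk li]; have [li'|il] := ltnP l i; first by rewrite hb // mul0r.
  rewrite hbi ?mulr0 // !shE //; move: li; rewrite -val_eqE /=; lia.
pose y : 'M[K]_n := \matrix_(i, j) if (n - k <= i)%N then u (unsh k i) j else (i == j)%:R.
have ysup i j : y i j != 0 -> (i == j) || ((n - k <= i)%N && (i < j)%N).
  rewrite mxE; case: ifP => [h|_]; last by case: (i == j); rewrite ?eqxx.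
  have [lt e] := unshP le_2k_n h; move/u0; rewrite -shE // e -val_eqE /=; lia.
have uy : y \in unitmx.
  suff [] : borel y by [].
  apply: borelI => [i j ji|i].
    apply/eqP; apply: contraTT ji => /ysup; rewrite -val_eqE /=; lia.
  rewrite mxE; case: ifP => [h|_]; last by rewrite eqxx oner_neq0.
  by have [lt {2}<-] := unshP le_2k_n h; apply: ud.
exists y; split => //.
have xy : x *m y = u.
  apply/matrixP => i j; have [ik|ik] := ltnP i k; last first.
    rewrite xk_mulmx0 //; apply/esym/eqP; apply: contraTT ik => /u0; lia.
  rewrite xk_mulmx // mxE; have h : (n - k <= sh i)%N by rewrite shE // leq_addl.
  rewrite h; congr (u _ _); have [lt e] := unshP le_2k_n h.
  by apply: (sh_inj le_2k_n); rewrite ?inE.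
have yx : y *m x = x.
  apply/matrixP => i j; rewrite mxE (bigD1 i) //= big1 ?addr0.
    have [ik|ik] := ltnP i k; last by rewrite xkE ltnNge ik mulr0.
    by rewrite [y i i]mxE ifN ?eqxx ?mul1r // -ltnNge; lia.
  move=> l li; have [lk|lk] := ltnP l k; last by rewrite xkE ltnNge lk mulr0.
  have [->|/ysup] := eqVneq (y i l) 0; first by rewrite mul0r.
  by rewrite eq_sym (negbTE li) /=; lia.
by rewrite /conjmx_by invmxK -xy -[in RHS]yx mulmxA mulVmx // mul1mx.
Qed.

(** The condition under which conjugation by [w] keeps the matrices [y] of [conj_borel_xk] in B. *)
Definition incC w := forall i j, (n - k <= i)%N -> (i < j)%N -> (w i < w j)%N.

Lemma BBset_orbit w : incC w -> forall u, BBset w u -> Borbit k w u.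
Proof.
move=> wC u [b1 [b2 [bb1 bb2 ->]]].
have [y [uy ys ->]] := conj_borel_xk bb2.
have uw := dotmx_unit K w.
have bz : borel (conjmx_by (dotmx K w) y).
  apply: conj_borel => // i j /ys/orP[/eqP -> //|/andP[a c]]; apply/ltnW/wC => //.
apply/BorbitE; exists (b1 *m invmx (conjmx_by (dotmx K w) y)); first exact/borelM/borelV.
have [u1 _] := bb1; have [uz _] := bz.
rewrite -conjmx_byM ?unitmx_inv //; congr (conjmx_by b1 _).
rewrite !conjmx_byM ?unitmx_inv //; congr (conjmx_by _ x).
by rewrite conj_invmx // /conjmx_by mulmxKV.
Qed.

Lemma orbit_BBset w u : Borbit k w u -> BBset w u.
Proof.
case/BorbitE => b bb ->; exists b, 1%:M; split=> //; first exact: borel1.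
by rewrite conjmx_by1.
Qed.

Lemma bruhat_orbit w v : incC v -> bruhat w v -> cvanish (Borbit k v) (BBset w).
Proof.
move=> iv wv; apply: cvanish_trans (bruhat_closure wv).
exact/cvanish_sub/BBset_orbit.
Qed.

End Orbits.

(** * The tangent space at the base point *)

(** The first row is divisible by X; after splitting off this factor, the derivative at 0 is the
    value at 0 of the remaining determinant, which is block triangular there. *)
Lemma det_deriv0 (K : fieldType) m (T : 'M[K]_(1 + m)) :
  (\det (map_mx polyC (block_mx 0 0 0 1%:M) + 'X *: map_mx polyC T))^`().[0] = T 0 0.
Proof.
rewrite -{1}[T]submxK !map_block_mx scale_block_mx add_block_mx.
set a := ulsubmx T; set b := ursubmx T; set c := dlsubmx T; set d := drsubmx T.
pose M' : 'M[{poly K}]_(1 + m) := block_mx (map_mx polyC a) (map_mx polyC b)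
  ('X *: map_mx polyC c) (map_mx polyC 1%:M + 'X *: map_mx polyC d).
have -> : block_mx (map_mx polyC 0 + 'X *: map_mx polyC a) (map_mx polyC 0 + 'X *: map_mx polyC b)
   (map_mx polyC 0 + 'X *: map_mx polyC c) (map_mx polyC 1%:M + 'X *: map_mx polyC d)
   = block_mx 'X%:M 0 0 1%:M *m M'.
  rewrite /M' mulmx_block !mul0mx !mul1mx !mul_scalar_mx !addr0 !add0r !map_mx0 !add0r.
  by [].
rewrite det_mulmx det_ublock det_scalar1 det1 mulr1 derivM derivX mul1r hornerD hornerM hornerX.
rewrite mul0r addr0 -horner_evalE -det_map_mx /M' map_block_mx.
have cst p q (A : 'M[K]_(p, q)) : map_mx (horner_eval 0) (map_mx polyC A) = A.
  by apply/matrixP => i j; rewrite !mxE /= horner_evalE hornerC.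
have x0 p q (A : 'M[K]_(p, q)) : map_mx (horner_eval 0) ('X *: map_mx polyC A) = 0.
  by apply/matrixP => i j; rewrite !mxE /= horner_evalE hornerM hornerX mul0r.
rewrite !map_mxD /= !x0 !cst addr0 det_ublock det1 mulr1 det_mx11 !mxE.
by congr (T _ _); apply: val_inj.
Qed.

(** The entries at the keys act as coordinates dual to the vectors [d e] and vanish on [U]. The
    summands [V e] are separate from the lines they equal because they may be given as tangent
    spaces of curves. *)
Lemma direct_keys (K : fieldType) n (I : finType) (P : {set I}) (d : I -> 'M[K]_n)
    (key : I -> 'I_n * 'I_n) (U : {vspace 'M[K]_n}) (V : I -> {vspace 'M[K]_n}) :
  (forall e, e \in P -> V e = <[d e]>%VS) ->
  (forall u e, u \in U -> e \in P -> u (key e).1 (key e).2 = 0) ->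
  (forall e, e \in P -> d e (key e).1 (key e).2 != 0) ->
  (forall e e', e \in P -> e' \in P -> e' != e -> d e' (key e).1 (key e).2 = 0) ->
  directv (U + \sum_(e in P) V e)%VS /\ (\dim (U + \sum_(e in P) V e) = \dim U + #|P|)%N.
Proof.
move=> VE U0 d1 d0.
have coord (vs : I -> 'M[K]_n) e : (forall e, e \in P -> vs e \in V e) -> e \in P ->
    (\sum_(e in P) vs e) (key e).1 (key e).2 = vs e (key e).1 (key e).2.
  move=> vsV eP; rewrite summxE (bigD1 e) //= big1 ?addr0 // => e' /andP[e'P ne].
  have := vsV e' e'P; rewrite VE // => /vlineP[c ->].
  by rewrite mxE d0 ?mulr0.
have vs0 (vs : I -> 'M[K]_n) e : (forall e, e \in P -> vs e \in V e) -> e \in P ->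
    vs e (key e).1 (key e).2 = 0 -> vs e = 0.
  move=> vsV eP; have := vsV e eP; rewrite VE // => /vlineP[c ->].
  by rewrite mxE => /eqP; rewrite mulf_eq0 (negbTE (d1 e eP)) orbF => /eqP ->; rewrite scale0r.
have dV : directv (\sum_(e in P) V e)%VS.
  apply/directv_sum_independent => vs vsV e0 e eP; apply: (vs0 vs) => //.
  by rewrite -coord // e0 mxE.
have UV : (U :&: \sum_(e in P) V e = 0)%VS.
  apply/eqP; rewrite -subv0; apply/subvP => v;
    rewrite memv_cap memv0 => /andP[vU /memv_sumP[vs vsV e0]].
  rewrite e0 big1 // => e eP; apply: (vs0 vs) => //.
  by rewrite -coord // -e0 U0.
have dUV : directv (U + \sum_(e in P) V e)%VS.
  by rewrite directv_addE /= directv_trivial dV UV eqxx.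
split=> //; rewrite (directvP dUV) /=; congr (_ + _)%N.
rewrite -sum1_card; apply: eq_bigr => e eP; rewrite VE // dim_vline.
suff -> : d e != 0 by [].
by apply: contraNneq (d1 e eP) => ->; rewrite mxE.
Qed.

(** * The tangent space of Y0 and the vectors [E_{j,i}, x] *)

Section TangentVectors.
Variables (K : closedFieldType) (n k : nat).
Hypothesis charK0 : [pchar K] =i pred0.
Hypothesis le_2k_n : (2 * k <= n)%N.
Implicit Types (A b u t : 'M[K]_n) (w v : 'S_n) (i j : 'I_n) (e : 'I_n * 'I_n).
Local Notation x := (xk K n k).
Local Notation sh := (sh k).
Local Notation TY := (tangent (Y0 k) x).

Lemma delta_xk (i l : 'I_n) : (l < k)%N -> delta_mx i l *m x = delta_mx i (sh l).
Proof. by move=> lk; apply/matrixP => a c; rewrite mul_delta_l xkE // lk mxE /= -natrM mulnb. Qed.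

Lemma xk_delta0 (i l : 'I_n) : (i < n - k)%N -> x *m delta_mx i l = 0.
Proof.
move=> ik; apply/matrixP => a c; rewrite mul_delta_r xkE // mxE.
case: (ltnP a k) => ak; rewrite ?mul0r //= -val_eqE /= shE // ltn_eqF ?mul0r //.
by rewrite (leq_trans ik) // leq_addl.
Qed.

Lemma tangentY0P t : reflect (forall i j, t i j != 0 ->
  (i < k)%N /\ (i + (n - k) <= j)%N) (t \in TY).
Proof.
apply: (iffP idP) => [tT i j|h].
  apply: contra_neqP => /not_andP nij; apply: tangent_entry0 tT => u /BorbitE[b bb ->].
  rewrite dotmx1 conjmx_by1; have [_ hb] := bb; have [_ hbi] := borelV bb.
  rewrite /conjmx_by -mulmxA mxE big1 // => l _.
  have [lk|lk] := ltnP l k; last by rewrite xk_mulmx0 // mulr0.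
  rewrite xk_mulmx //; have [li|il] := ltnP l i; first by rewrite hb // mul0r.
  rewrite hbi ?mulr0 // shE // ltnNge; apply/negP => c; case: nij => nij; apply: nij; lia.
rewrite [t]matrix_sum_delta; apply: memv_suml => i _; apply: memv_suml => j _.
have [->|/h [ik ij]] := eqVneq (t i j) 0; first by rewrite scale0r mem0v.
apply: memvZ; have nkj : (n - k <= j)%N by lia.
have [l lk ej] := sh_surj le_2k_n nkj.
have il : (i <= l)%N by move: ij; rewrite ej shE //; lia.
(* For [i = l] the matrix [b] below is singular at [s = -1], hence this [h]. *)
apply: (line_tangent charK0 (h := 'X + 1%:P)).
  by rewrite -size_poly_eq0 size_XaddC.
move=> s; rewrite hornerD hornerX hornerC => s1.
pose b : 'M[K]_n := 1%:M + s *: delta_mx i l.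
have bb : borel b.
  apply: borelI => [a c ca|a]; rewrite !mxE.
    have -> : (a == i) && (c == l) = false.
      by apply/negP => /andP[/eqP E /eqP E']; move: ca; rewrite E E'; lia.
    by rewrite -val_eqE gtn_eqF // mulr0 addr0.
  by rewrite eqxx; case: (_ && _); rewrite ?mulr1 ?mulr0 ?addr0 ?oner_neq0 // addrC.
apply/BorbitE; exists b => //; rewrite dotmx1 conjmx_by1.
have [ub _] := bb.
rewrite /conjmx_by; apply: (canRL (mulmxK ub)); rewrite /b.
have ji : j != i by rewrite -val_eqE /= gtn_eqF //; lia.
rewrite mulmxDl mulmxDl mul1mx mulmxDr mulmx1 mulmxDr mulmx1 -!scalemxAl -!scalemxAr.
rewrite delta_xk // -ej xk_delta0; last by lia.
by rewrite mul_delta_mx_0 // !scaler0 !addr0.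
Qed.

Definition dvec e : 'M[K]_n := delta_mx e.2 e.1 *m x - x *m delta_mx e.2 e.1.

Lemma dvecE e i j : dvec e i j =
  ((i == e.2) && (e.1 < k)%N && (j == sh e.1))%:R - ((i < k)%N && (e.2 == sh i) && (j == e.1))%:R.
Proof. by rewrite mxE mul_delta_l [X in _ + X]mxE mul_delta_r !xkE // -!natrM !mulnb andbA. Qed.

(** Block form of membership in $\phi^+(C_k)$, see [phi_CE]. *)
Definition moved e := (e.1 < e.2)%N && ((e.2 < k)%N || ~~ same_block k e.1 e.2).

(* A matrix position at which, among the vectors [dvec e] with [moved e], only one is nonzero. *)
Definition key e := if (e.1 < k)%N then (e.2, sh e.1) else (unsh k e.2, e.1).

Lemma sh_eq i j : (i < k)%N -> (j < k)%N -> (sh i == sh j) = (i == j).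
Proof. by move=> ik jk; apply: (inj_in_eq (sh_inj le_2k_n)); rewrite inE. Qed.

Lemma sh_big i : (i < k)%N -> (n - k <= sh i)%N.
Proof. by move=> ik; rewrite shE // leq_addl. Qed.

Lemma moved_C e : moved e -> (k <= e.1)%N -> (e.1 < n - k)%N /\ (n - k <= e.2)%N.
Proof. by rewrite /moved /same_block; lia. Qed.

Lemma dvec_key e : moved e -> dvec e (key e).1 (key e).2 != 0.
Proof.
move=> me; rewrite /key; case: ifP => ek; rewrite dvecE /=.
  rewrite !eqxx ek /= [X in _ - (nat_of_bool X)%:R](_ : _ = false) ?subr0 ?oner_neq0 //.
  apply/negP => /andP[/andP[e2k _] /eqP E]; have := sh_big ek.
  rewrite E; move: me; rewrite /moved; lia.
have [e1 e2] : (e.1 < n - k)%N /\ (n - k <= e.2)%N by apply: moved_C; rewrite // leqNgt ek.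
have [uk ue] := unshP le_2k_n e2; by rewrite ek andbF /= uk ue !eqxx /= sub0r oppr_eq0 oner_neq0.
Qed.

Lemma dvec_key0 e e' : moved e -> moved e' -> e' != e -> dvec e' (key e).1 (key e).2 = 0.
Proof.
case: e e' => i j [i' j'] me me'; apply: contra_neqP; rewrite /key dvecE /=.
have [ik|ik] := ltnP i k => /=.
  case: andP => [[/andP[/eqP E i'k] E']|_].
    by move: E'; rewrite sh_eq // => /eqP ->; rewrite E.
  case: andP => [[/andP[jk /eqP E] /eqP E']|_]; last by rewrite subrr.
  have := sh_big ik; rewrite E'; move: me'; rewrite /moved /same_block /=; lia.
have [/= iC jC] := moved_C me ik; have [uk ue] := unshP le_2k_n jC.
case: andP => [[/andP[_ i'k] /eqP E]|_].
  by have := sh_big i'k; rewrite -E; lia.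
case: andP => [[/andP[_ /eqP ->] /eqP ->]|_]; last by rewrite subrr.
by rewrite ue.
Qed.

Lemma tangentY0_key t e : t \in TY -> moved e -> t (key e).1 (key e).2 = 0.
Proof.
move=> /tangentY0P h me; apply/eqP; apply: contraT => /h; rewrite /key; case: ifP => ek /=.
  by rewrite shE // => -[a b]; move: me; rewrite /moved; lia.
have [e1 e2] : (e.1 < n - k)%N /\ (n - k <= e.2)%N by apply: moved_C; rewrite // leqNgt ek.
by move=> [_ a]; lia.
Qed.

(** Links the two nonzero positions of [dvec e] for [e.1 < k] and [n - k <= e.2], of which the key
    is only one. *)
Lemma anti_deriv (d : 'M[K]_n) : x *m d + d *m x = 0 ->
  forall i j, (i < k)%N -> (j < k)%N -> d (sh i) (sh j) = - d i j.
Proof.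
move=> h i j ik jk; have := congr1 (fun A : 'M_n => A i (sh j)) h.
rewrite mxE [RHS]mxE xk_mulmx // mulmx_xk // => /eqP.
by rewrite addr_eq0 => /eqP.
Qed.

(** The quadratic term in [s] is a multiple of E_{j,i} x E_{j,i}, which carries the factor
    [x e.1 e.2]; without it the curve is a line. *)
Lemma uneg_xk e s : (e.1 < e.2)%N -> x e.1 e.2 = 0 ->
  conjmx_by (uneg e s) x = x + s *: dvec e.
Proof.
move=> lt xe; rewrite /conjmx_by uneg_inv // /uneg scaleNr mulmxDl mul1mx mulmxBr mulmx1 mulmxDl.
have exe : delta_mx e.2 e.1 *m x *m delta_mx e.2 e.1 = 0.
  apply/matrixP => i j; rewrite mul_delta_r mul_delta_l xe mxE; ring.
rewrite -!scalemxAl -!scalemxAr exe !scaler0 addr0 /dvec scalerBr addrAC addrA.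
by rewrite addrAC.
Qed.

Lemma tangent_Ccurve e : (e.1 < e.2)%N -> x e.1 e.2 = 0 ->
  tangent (Ccurve k e) x = <[dvec e]>%VS.
Proof.
move=> lt xe; apply: tangent_param_line => // u; split => -[s ->]; exists s; rewrite uneg_xk //.
Qed.

Lemma same_block_Pk e : (e.1 < e.2)%N -> same_block k e.1 e.2 -> forall s,
  Pk k (uneg e s : 'M[K]_n).
Proof.
move=> lt sb s; have [->|s0] := eqVneq s 0.
  exists 1%g, 1%:M, 1%:M; split; rewrite ?group1 //; try exact: borel1.
  by rewrite dotmx1 !mulmx1 /uneg scale0r addr0.
have bt := tor_borel e s0.
exists (tperm e.1 e.2), (upos e s^-1 *m tor e s), (upos e s^-1); split.
- apply/(WLP le_2k_n) => i; case: tpermP => [->|->|_ _]; rewrite /same_block ?eqxx //.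
    by move: sb; rewrite /same_block ![(e.1 < _)%N == _]eq_sym.
- by apply: borelM => //; apply: upos_borel.
- exact: upos_borel.
- exact: uneg_bruhat.
Qed.

Lemma Pk_block (g : 'M[K]_n) : Pk k g -> forall i j, (j < i)%N -> ~~ same_block k j i -> g i j = 0.
Proof.
case=> w [b1 [b2 [/(WLP le_2k_n) wL [_ h1] [_ h2] ->]]] i j ji nb.
rewrite mxE big1 // => l _; rewrite dotmx_mulr.
have [lt|le] := ltnP j l; first by rewrite h2 ?mulr0.
have := wL l; rewrite /same_block => sb.
rewrite h1 ?mul0r // ltnNge; apply/negP => c; move: nb sb; rewrite /same_block; lia.
Qed.

Lemma phi_CE e : (e \in phi_C K n k) = moved e.
Proof.
rewrite /moved !inE; case lt: (e.1 < e.2)%N => //=.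
have [lt2|le2] := ltnP e.2 k => //=.
apply/asboolP/idP => [h|nb h].
  by apply/negP => sb; apply: h; apply: same_block_Pk.
have := Pk_block (h 1) lt nb; rewrite !mxE !eqxx mulr1 -val_eqE gtn_eqF // add0r.
by move/eqP; rewrite oner_eq0.
Qed.

End TangentVectors.

(** * Corner ranks of r_e x and the differentials of corner minors *)

Section Corners.
Variables (K : closedFieldType) (n k : nat).
Hypothesis charK0 : [pchar K] =i pred0.
Hypothesis le_2k_n : (2 * k <= n)%N.
Implicit Types (A b u t : 'M[K]_n) (w v : 'S_n) (i j : 'I_n) (e : 'I_n * 'I_n).
Local Notation x := (xk K n k).
Local Notation sh := (sh k).

Lemma card_interval (a c : nat) : (#|[set i : 'I_n | (a <= i) && (i < c)]| <= c - a)%N.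
Proof.
rewrite cardE -(size_map val) -(size_iota a (c - a)); apply: uniq_leq_size.
  by rewrite map_inj_uniq ?enum_uniq //; apply: val_inj.
move=> _ /mapP[i + ->]; rewrite mem_enum inE mem_iota => /andP[/= h1 h2]; lia.
Qed.

Lemma card_perm_interval w (a c : nat) : (#|[set i : 'I_n | (a <= w i) && (w i < c)]| <= c - a)%N.
Proof.
rewrite -[X in (X <= _)%N](card_imset _ (@perm_inj _ w)).
apply: leq_trans (card_interval a c); apply: subset_leq_card.
by apply/subsetP => _ /imsetP[i + ->]; rewrite !inE.
Qed.

(** Among the [k] entries of [v x], at most [p] lie in rows below [p] and at most [n - q] in columns
    from [q] on; what remains is at least the number of entries of [x] in the corner. *)
Lemma crank1_le v p q : (q <= n)%N -> (crank k (1%g : 'S_n) p q <= crank k v p q)%N.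
Proof.
move=> qn; have [lt|le] := ltnP (p + (n - k)) q; last first.
  rewrite [X in (X <= _)%N]eq_card0 // => i; rewrite !inE !perm1.
  by apply/negP => /and3P[ik a b]; move: b; rewrite shE //; lia.
have le1 : (crank k (1%g : 'S_n) p q <= q - (n - k) - p)%N.
  apply: leq_trans (card_interval p (q - (n - k))); apply: subset_leq_card.
  apply/subsetP => i; rewrite !inE !perm1 => /and3P[ik -> b] /=.
  by move: b; rewrite shE //; lia.
apply: leq_trans le1 _.
pose S1 := [set i : 'I_n | (0 <= v i)%N && (v i < p)%N].
pose S2 := [set i : 'I_n | (i < k)%N && (q <= v (sh i))%N].
have c1 : (#|S1| <= p)%N by apply: leq_trans (card_perm_interval v 0 p) _; rewrite subn0.
have c2 : (#|S2| <= n - q)%N.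
  rewrite -(card_in_imset (f := sh)); last first.
    by move=> i j; rewrite !inE => /andP[ik _] /andP[jk _]; apply: (sh_inj le_2k_n).
  apply: leq_trans (card_perm_interval v q n); apply: subset_leq_card.
  by apply/subsetP => _ /imsetP[i + ->]; rewrite !inE => /andP[_ ->]; rewrite ltn_ord.
pose S3 := [set i : 'I_n | [&& (i < k)%N, (p <= v i)%N & (v (sh i) < q)%N]].
have c3 : (k <= #|S3 :|: (S1 :|: S2)|)%N.
  have kn : (k <= n)%N by lia.
  have winj : injective (widen_ord kn) by move=> i j /(congr1 val) /= /val_inj.
  rewrite -{1}(card_ord k) -(card_imset _ winj).
  apply: subset_leq_card; apply/subsetP => _ /imsetP[i _ ->]; rewrite !inE /= ltn_ord /=.
  by rewrite !ltnNge; case: (p <= _)%N => //=; case: (q <= _)%N.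
have [h1 _] := leq_card_setU S3 (S1 :|: S2); have [h2 _] := leq_card_setU S1 S2.
rewrite /crank -/S3; lia.
Qed.

Lemma crank_full v : crank k v 0 n = crank k (1%g : 'S_n) 0 n.
Proof. by apply: eq_card => i; rewrite !inE !ltn_ord. Qed.

(** If r_e x has larger rank than [x] in a corner, then some nonzero position of [dvec e] lies in
    that corner, in a row and a column free of entries of [x] there, as [corner_minor] requires. It
    is the key or, for [e] leading from the first to the last block, possibly the other position. *)
Lemma crank_moved e p q : moved k e -> x e.1 e.2 = 0 ->
  (crank k (1%g : 'S_n) p q < crank k (tperm e.1 e.2) p q)%N ->
  exists a c : 'I_n, [/\ (p <= a)%N && (c < q)%N, ~~ ((a < k)%N && (sh a < q)%N),
    (forall i, (i < k)%N -> (p <= i)%N -> sh i <> c) &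
    (a, c) = key k e \/ [/\ (e.1 < k)%N, (n - k <= e.2)%N & (a, c) = (unsh k e.2, e.1)]].
Proof.
case: e => i j /= me xij lt; set r := tperm i j in lt.
have nij : j <> sh i \/ (k <= i)%N.
  have [ik|] := ltnP i k; [left => E|by right].
  by move: xij; rewrite xkE // ik E eqxx => /eqP; rewrite oner_eq0.
have ltij : (i < j)%N by move: me; rewrite /moved => /andP[].
have iC : (i < n - k)%N by move: me; rewrite /moved /same_block /=; lia.
set Er := [set m : 'I_n | [&& (m < k)%N, (p <= r m)%N & (r (sh m) < q)%N]].
set E1 := [set m : 'I_n | [&& (m < k)%N, (p <= m)%N & (sh m < q)%N]].
have {}lt : (#|E1| < #|Er|)%N.
  by move: lt; rewrite /crank (_ : [set _ | _] = E1) //; apply/setP => m; rewrite !inE !perm1.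
have [m mr m1] : exists2 m, m \in Er & m \notin E1.
  apply/exists_inP; apply: contraLR lt => /exists_inPn h; rewrite -leqNgt.
  by apply: subset_leq_card; apply/subsetP => m /h; rewrite negbK.
move: (mr) (m1); rewrite !inE => /and3P[mk rm rsm]; rewrite mk /= => nm.
have shi : sh m <> i by move=> E; have := sh_big le_2k_n mk; rewrite E leqNgt iC.
have rE l : l <> i -> l <> j -> r l = l by move=> li lj; rewrite /r tpermD //; apply/eqP/nesym.
have [mi|/eqP mi] := eqVneq m i.
  have ik : (i < k)%N by rewrite -mi.
  have shj : sh i <> j by case: nij => [/nesym //|]; rewrite leqNgt ik.
  rewrite rE // in rsm; last by rewrite mi.
  rewrite /r mi tpermL in rm; rewrite mi in rsm nm.
  exists j, (sh i); split; first by rewrite rm rsm.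
  - apply/negP => /andP[jk sj].
    (* If row [j] had its entry of [x] in the corner, [r] would gain the entry indexed by [i] and
       lose the one indexed by [j], and the count would not grow. *)
    have sub : Er \subset i |: (E1 :\ j).
      apply/subsetP => l; rewrite !inE => /and3P[lk rl rsl].
      have [//|/eqP li] := eqVneq l i; rewrite /=.
      have sli : sh l <> i by move=> E; have := sh_big le_2k_n lk; rewrite E leqNgt iC.
      have slj : sh l <> j by move=> E; have := sh_ge le_2k_n lk; rewrite E leqNgt jk.
      rewrite (rE _ sli slj) in rsl; rewrite lk rsl.
      have [lj|/eqP lj] := eqVneq l j; last by rewrite rE // in rl; rewrite rl.
      rewrite lj /r tpermR in rl; move: nm; rewrite rl /= => /negP; case.
      by move: rsl; rewrite lj !shE //; lia.
    have jE1 : j \in E1 by rewrite inE jk rm sj.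
    have := subset_leq_card sub; rewrite cardsU1 => h.
    by move: lt; rewrite (cardsD1 j E1) jE1; move: h; case: (i \notin _) => /=; lia.
  - by move=> l lk pl /(sh_inj le_2k_n); rewrite !inE => /(_ lk ik) E; move: nm;
    rewrite -E pl E rsm.
  - by left; rewrite /key /= ik.
have [mj|/eqP mj] := eqVneq m j.
  move: rm rsm nm; rewrite mj /r tpermR tpermD; first by lia.
    by apply/eqP => E; apply: shi; rewrite mj.
  by apply/eqP => E; have := sh_ge le_2k_n mk; rewrite mj -E; move: mk; rewrite mj; lia.
rewrite rE // in rm.
have [smj|/eqP smj] := eqVneq (sh m) j; last by rewrite rE // in rsm; rewrite rm rsm in nm.
rewrite smj /r tpermR in rsm.
have jC : (n - k <= j)%N by rewrite -smj sh_big.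
have um : unsh k j = m.
  have [uk ue] := unshP le_2k_n jC.
  by apply: (sh_inj le_2k_n); rewrite ?inE // ue.
exists m, i; split; first by rewrite rm rsm.
- by rewrite mk /=; move: nm; rewrite rm.
- by move=> l lk _ E; have := sh_big le_2k_n lk; rewrite E leqNgt iC.
- rewrite /key /= um; case: ltnP => ik; [right; split => //|by left].
Qed.

(** Only the entry indexed by [i] and the one in column [j] can be gained. Gaining both would need
    [i < p <= m] with [sh m = j], whereas [j < sh i] means [m < i]. *)
Lemma crank_moved_le e p q : moved k e -> x e.1 e.2 = 0 ->
  ((e.1 < k)%N -> (e.2 < sh e.1)%N) ->
  (crank k (tperm e.1 e.2) p q <= (crank k (1%g : 'S_n) p q).+1)%N.
Proof.
case: e => i j /= me xij up; set r := tperm i j.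
have ltij : (i < j)%N by move: me; rewrite /moved => /andP[].
have iC : (i < n - k)%N by move: me; rewrite /moved /same_block /=; lia.
set Er := [set m : 'I_n | [&& (m < k)%N, (p <= r m)%N & (r (sh m) < q)%N]].
set E1 := [set m : 'I_n | [&& (m < k)%N, (p <= m)%N & (sh m < q)%N]].
have -> : crank k (1%g : 'S_n) p q = #|E1| by apply: eq_card => m; rewrite !inE !perm1.
rewrite -/(#|Er|).
have new m : m \in Er -> m \notin E1 ->
    (m = i /\ (sh i < q)%N /\ (i < p)%N) \/ (sh m = j /\ (p <= m)%N).
  rewrite !inE => /and3P[mk rm rsm]; rewrite mk /= => nm.
  have shi : sh m <> i by move=> E; have := sh_big le_2k_n mk; rewrite E leqNgt iC.
  have rE l : l <> i -> l <> j -> r l = l by move=> li lj; rewrite /r tpermD //; apply/eqP/nesym.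
  have [mi|/eqP mi] := eqVneq m i.
    have ik : (i < k)%N by rewrite -mi.
    have shj : sh i <> j by move=> E; have := up ik; rewrite E ltnn.
    rewrite rE // in rsm; last by rewrite mi.
    by left; rewrite -mi; move: nm; rewrite rsm andbT ltnNge.
  have [mj|/eqP mj] := eqVneq m j.
    move: rm rsm nm; rewrite mj /r tpermR tpermD; first by lia.
      by apply/eqP => E; apply: shi; rewrite mj.
    by apply/eqP => E; have := sh_ge le_2k_n mk; rewrite mj -E; move: mk; rewrite mj; lia.
  rewrite rE // in rm.
  have [smj|/eqP smj] := eqVneq (sh m) j; last by rewrite rE // in rsm; rewrite rm rsm in nm.
  by right.
have [/subset_leq_card/leqW //|/subsetPn[m mr m1]] := boolP (Er \subset E1).
apply: leq_trans (_ : #|m |: E1| <= _)%N; last by rewrite cardsU1; case: (_ \notin _); lia.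
apply: subset_leq_card; apply/subsetP => l lr; rewrite !inE -/(#|_|).
have [//|l1] := boolP (l \in E1); first by rewrite inE => ->; rewrite orbT.
rewrite (_ : l = m) ?eqxx //.
have mk : (m < k)%N by move: mr; rewrite inE => /andP[].
have lk : (l < k)%N by move: lr; rewrite inE => /andP[].
have clash (a c : 'I_n) : (c < k)%N -> a = i -> (i < p)%N -> sh c = j -> (p <= c)%N ->
  (a < k)%N -> False.
  move=> ck -> ip E pc ik; have := up ik; rewrite -E !shE //; lia.
case: (new _ mr m1) => [[m2 [_ m3]]|[m2 m3]]; case: (new _ lr l1) => [[l2 [_ l3]]|[l2 l3]].
- by rewrite m2 l2.
- by case: (clash m l).
- by case: (clash l m).
- by apply: (sh_inj le_2k_n); rewrite ?inE // m2 l2.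
Qed.

Lemma orbit_entry b w i j :
  conjmx_by b (conjmx_by (dotmx K w) x) i j =
  \sum_(l in 'I_n | (l < k)%N) b i (w l) * invmx b (w (sh l)) j.
Proof.
rewrite /conjmx_by dotmxV -!mulmxA mxE (reindex_inj (@perm_inj _ w)) /=.
rewrite (bigID (fun l : 'I_n => (l < k)%N)) /= [X in _ + X]big1 ?addr0.
  apply: eq_bigr => l lk; rewrite dotmx_mull xk_mulmx //; congr (_ * _).
  by rewrite -{1}(permK w (sh l)) dotmx_mull.
by move=> l; rewrite -leqNgt => kl; rewrite dotmx_mull xk_mulmx0 // mulr0.
Qed.

(** Take the minor on the rows and columns of the entries of [x] in the corner, bordered by row [j]
    and column [c0]. It is too large to be nonzero on the orbit, and at [x] its matrix is diag(0, 1,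
    ..., 1), so its differential there is the entry [(j, c0)]. *)
Lemma corner_minor w p q (j c0 : 'I_n) t :
  (crank k w p q <= crank k (1%g : 'S_n) p q)%N -> (p <= j)%N -> (c0 < q)%N ->
  ~~ ((j < k)%N && (sh j < q)%N) ->
  (forall i, (i < k)%N -> (p <= i)%N -> sh i <> c0) ->
  t \in tangent (Borbit k w) x -> t j c0 = 0.
Proof.
move=> cr pj cq nj nc /tangentP tt.
set E := [set i : 'I_n | [&& (i < k)%N, (p <= i)%N & (sh i < q)%N]].
set Ew := [set i : 'I_n | [&& (i < k)%N, (p <= w i)%N & (w (sh i) < q)%N]].
have {}cr : (#|Ew| <= #|E|)%N.
  apply: leq_trans cr _; rewrite leq_eqVlt (_ : crank _ _ _ _ = #|E|) ?eqxx //.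
  by apply: eq_card => i; rewrite !inE !perm1.
have enE (s : 'I_#|E|) : enum_val s \in E := enum_valP s.
have en (s : 'I_#|E|) : [/\ (enum_val s < k)%N, (p <= enum_val s)%N & (sh (enum_val s) < q)%N].
  by have := enE s; rewrite inE => /and3P.
pose rw (a : 'I_(1 + #|E|)) := match split a with inl _ => j | inr s => enum_val s end.
pose cl (a : 'I_(1 + #|E|)) := match split a with inl _ => c0 | inr s => sh (enum_val s) end.
have rwp a : (p <= rw a)%N by rewrite /rw; case: split => s //; have [] := en s.
have clq a : (cl a < q)%N by rewrite /cl; case: split => s //; have [] := en s.
pose f := \det (mxsub rw cl (genmx K n)).
have fv : vanishes_on (Borbit k w) f.
  move=> u /BorbitE[b bb ->]; set z := conjmx_by b _.
  have fz : mxeval f z = \det (mxsub rw cl z).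
    rewrite -[LHS]/(mxev z f) -det_map_mx; congr (\det _).
    by rewrite map_mxsub mxeval_genmx.
  rewrite fz; have [_ hb] := bb; have [_ hbi] := borelV bb.
  (* As [b] is upper triangular, only entries of [w x] in the corner contribute to the corner of its
     conjugate by [b], so the submatrix factors through dimension [#|Ew| <= #|E|]. *)
  pose P : 'M[K]_(1 + #|E|, #|Ew|) := \matrix_(a, s) b (rw a) (w (enum_val s)).
  pose Q : 'M[K]_(#|Ew|, 1 + #|E|) := \matrix_(s, a) invmx b (w (sh (enum_val s))) (cl a).
  have -> : mxsub rw cl z = P *m Q.
    apply/matrixP => a c; rewrite [LHS]mxE [RHS]mxE.
    transitivity (\sum_(i in Ew) b (rw a) (w i) * invmx b (w (sh i)) (cl c)); last first.
      by rewrite big_enum_val; apply: eq_bigr => s _; rewrite !mxE.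
    rewrite /z orbit_entry (bigID (fun i => i \in Ew)) /= [X in _ + X]big1 ?addr0.
      by apply: eq_bigl => i; rewrite inE andbC; case: (i < k)%N; rewrite ?andbF ?andbT.
    move=> i /andP[ik]; rewrite inE ik /= negb_and -ltnNge -leqNgt => /orP[lt|le].
      by rewrite hb ?mul0r // (leq_trans lt).
    by rewrite hbi ?mulr0 // (leq_trans (clq c)).
  apply/eqP; apply: contraT => dn.
  have uPQ : P *m Q \in unitmx by rewrite unitmxE unitfE.
  have := leq_trans (mxrankM_maxl P Q) (rank_leq_col P); rewrite (mxrank_unit uPQ).
  by move=> /leq_trans/(_ cr); rewrite add1n ltnn.
have := tt f fv; rewrite mxdiff_line.
have -> : pev (mxline x t) f = \det (map_mx polyC (block_mx 0 0 0 1%:M) + 'X *: map_mx polyC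
  (mxsub rw cl t)).
  rewrite -[LHS]det_map_mx map_mxsub pev_genmx; congr (\det _).
  have -> : mxsub rw cl (mxline x t) = map_mx polyC (mxsub rw cl x) + 'X *: map_mx polyC (mxsub rw
    cl t).
    by apply/matrixP => a c; rewrite !mxE.
  congr (map_mx polyC _ + _); apply/matrixP => a c; rewrite mxE xkE // /rw /cl.
  case: split_ordP => s ->; case: split_ordP => s' ->.
  - rewrite block_mxEul mxE; case: andP => // -[jk /eqP E0]; case: (nc j jk pj); by [].
  - rewrite block_mxEur mxE; case: andP => // -[jk /eqP E0]; case/negP: nj.
    by rewrite jk -E0; have [] := en s'.
  - rewrite block_mxEdl mxE; case: andP => // -[jk /eqP E0]; have [a1 a2 _] := en s.
    by case: (nc _ a1 a2).
  - rewrite block_mxEdr mxE; have [a1 _ _] := en s; have [b1 _ _] := en s'.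
    rewrite a1 sh_eq // (inj_eq enum_val_inj) eq_sym; by [].
rewrite det_deriv0 mxE /rw /cl; case: split_ordP => s; last by move/(congr1 val) => /=.
by [].
Qed.

End Corners.

(** * The tangent space of Z at x *)

Section TangentSpace.
Variables (K : closedFieldType) (n k : nat).
Hypothesis charK0 : [pchar K] =i pred0.
Hypothesis le_2k_n : (2 * k <= n)%N.
Variable v : 'S_n.
Hypothesis vC : incC k v.
Implicit Types (A b u t : 'M[K]_n) (w : 'S_n) (i j : 'I_n) (e : 'I_n * 'I_n).
Local Notation x := (xk K n k).
Local Notation sh := (sh k).
Local Notation TY := (tangent (Y0 k) x).

Definition Zorb : 'M[K]_n -> Prop := zclosure_in (@Ok K n k) (Borbit k v).

Lemma vanish_Zset f : vanishes_on Zorb f <-> vanishes_on (Borbit k v) f.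
Proof.
split=> h u uX; last by case: uX => _; apply.
by apply: h; split; [apply: Borbit_Ok uX|move=> g; apply].
Qed.

Lemma tangent_Zset p : tangent Zorb p = tangent (Borbit k v) p.
Proof. by apply/eqP; rewrite eqEsubv !tangent_sub // => f; apply vanish_Zset. Qed.

Lemma Zset_closed (S : 'M[K]_n -> Prop) u : Ok k u -> cvanish (Borbit k v) S -> S u -> Zorb u.
Proof. by move=> uO h Su; split => // f fv; apply: h. Qed.

Lemma Zset_conj b u : borel b -> Zorb u -> Zorb (conjmx_by b u).
Proof.
move=> bb [uO uZ]; have [ub _] := bb; split; first exact: Ok_conj.
move=> f fv; have [g gE] := polynomial_conj f ub; rewrite -gE; apply: uZ => w wO.
by rewrite gE; apply/fv/Borbit_conj.
Qed.

Lemma BBset_xk : BBset k 1%g x.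
Proof.
exists 1%:M, 1%:M; split; try exact: borel1.
by rewrite dotmx1 !conjmx_by1.
Qed.

Lemma cvanish1 : cvanish (Borbit k v) (@BBset K n k 1%g).
Proof. by apply: bruhat_orbit => //; apply: bruhat1. Qed.

Lemma Zset_xk : Zorb x.
Proof. by apply: Zset_closed cvanish1 BBset_xk; apply: Ok_xk. Qed.

Lemma tangentY0_sub : (TY <= tangent Zorb x)%VS.
Proof.
rewrite tangent_Zset; apply: tangent_sub => f /cvanish1 fv u uY.
by apply: fv; apply: orbit_BBset.
Qed.

Lemma WC_xk c : c \in WC n k -> conjmx_by (dotmx K c) x = x.
Proof.
rewrite inE => /andP[/(WLP le_2k_n) cL /forallP h].
apply/matrixP => i j; rewrite -[i](permKV c) -[j](permKV c) conj_dotmx.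
set a := (c^-1)%g i; set d := (c^-1)%g j; rewrite !xkE //.
have := cL a; rewrite /same_block => ca.
have cak : (c a < k)%N = (a < k)%N by case/andP: ca => /eqP.
rewrite cak; case ak: (a < k)%N => //=; congr (_%:R); congr nat_of_bool.
have cs : c (sh a) = sh (c a).
  have /forallP/(_ (sh a)) := h a; rewrite ak shE // addnC eqxx /= => /eqP e.
  by apply: val_inj; rewrite /= e shE ?cak // addnC.
by rewrite -cs (inj_eq perm_inj).
Qed.

Lemma Borbit_WC w c u : c \in WC n k -> Borbit k w u -> Borbit k (wcomp w c) u.
Proof.
move=> cW /BorbitE[b bb ->]; apply/BorbitE; exists b => //; congr (conjmx_by b _).
by rewrite -dotmxM -(conjmx_byM x (dotmx_unit K w) (dotmx_unit K c)) (WC_xk cW).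
Qed.

Hypothesis Zn : forall u, Zorb u -> strictly_upper u.

Lemma Zset_ntype w : Zorb (conjmx_by (dotmx K w) x) -> ntype k w.
Proof.
move=> /Zn h i ik; rewrite ltnNge; apply/negP => /h.
by rewrite conj_dotmx xkE // ik eqxx => /eqP; rewrite oner_eq0.
Qed.

Lemma ntype_v : ntype k v.
Proof.
apply: Zset_ntype; split; last by move=> f; apply; apply: Borbit_rep.
by apply: Ok_conj; [exact: dotmx_unit|exact: Ok_xk].
Qed.

Local Notation r e := (tperm e.1 e.2).
Local Notation P := [set e in phi_C K n k | coset_bruhat k (r e) v].

Lemma tk_orbit e : e \in P -> cvanish (Borbit k v) (@Borbit K n k (r e)).
Proof.
rewrite inE => /andP[_ /exists_inP[c cW br]] f fv u uO.
by apply: (bruhat_orbit charK0 le_2k_n vC br fv); apply/orbit_BBset/Borbit_WC.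
Qed.

(** An entry of [x] at [e] would give r_e x, a point of Z, an entry at [(e.2, e.1)] below the
    diagonal. *)
Lemma tk_moved e : e \in P -> moved k e /\ x e.1 e.2 = 0.
Proof.
move=> eP; have me : moved k e by rewrite -(phi_CE K le_2k_n); move: eP; rewrite inE => /andP[].
split=> //; rewrite xkE //; case: andP => // -[ik /eqP E].
have /Zset_ntype/(_ e.1 ik) : Zorb (conjmx_by (dotmx K (r e)) x).
  apply: (Zset_closed _ (tk_orbit eP)); last exact: Borbit_rep.
  by apply: Ok_conj; [exact: dotmx_unit|exact: Ok_xk].
by rewrite -E tpermL tpermR; move: me; rewrite /moved; lia.
Qed.

(** The right factor [upos] of the SL_2 identity has to be absorbed. If [e.2 < k], the matrix [y] of
    [conj_borel_xk] passes through r_e, which fixes the last [k] indices; otherwise [upos]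
    stabilizes [x]. *)
Lemma uneg_orbit e s : moved k e -> s != 0 -> Borbit k (r e) (conjmx_by (uneg e s) x).
Proof.
move=> me s0; have lt : (e.1 < e.2)%N by move: me; rewrite /moved => /andP[].
have bu := @upos_borel K n e s^-1 lt; have [uu _] := bu.
have bt := tor_borel e s0.
have [ut _] := bt; have ur := dotmx_unit K (r e).
rewrite uneg_bruhat // -conjmx_byM ?unitmx_mul ?uu ?ut //.
rewrite -conjmx_byM ?unitmx_mul ?uu ?ut //.
apply: Borbit_conj; first exact: borelM.
have [e2k|e2k] := ltnP e.2 k.
  have [y [uy ys ->]] := conj_borel_xk le_2k_n bu.
  have bz : borel (conjmx_by (dotmx K (r e)) y).
    apply: conj_borel => // i j /ys/orP[/eqP -> //|/andP[iC ij]].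
    by rewrite !tpermD -?val_eqE /=; try lia; apply: ltnW.
  have [uz _] := bz.
  apply/BorbitE; exists (invmx (conjmx_by (dotmx K (r e)) y)); first exact: borelV.
  rewrite !conjmx_byM ?unitmx_inv //; congr (conjmx_by _ x).
  by rewrite conj_invmx // /conjmx_by mulmxKV.
have -> : conjmx_by (upos e s^-1) x = x; last exact: Borbit_rep.
rewrite /conjmx_by; apply: (canLR (mulmxK uu)).
have e1C : (e.1 < n - k)%N by move: me; rewrite /moved /same_block; lia.
rewrite /upos mulmxDl mul1mx mulmxDr mulmx1 -scalemxAl -scalemxAr xk_delta0 // scaler0.
suff -> : delta_mx e.1 e.2 *m x = 0 by rewrite scaler0.
apply/matrixP => i j; rewrite mul_delta_l xkE // ltnNge e2k mulr0 mxE //.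
Qed.

Lemma tk_dvec e : e \in P -> dvec K k e \in tangent Zorb x.
Proof.
move=> eP; have [me xe] := tk_moved eP.
have lt : (e.1 < e.2)%N by move: me; rewrite /moved => /andP[].
have sub : (tangent (Borbit k (r e)) x <= tangent Zorb x)%VS.
  by rewrite tangent_Zset; apply: tangent_sub; apply: tk_orbit.
apply: (subvP sub); apply: (line_tangent charK0 (h := 'X)); first by rewrite polyX_eq0.
by move=> s; rewrite hornerX => s0; rewrite -uneg_xk //; apply: uneg_orbit.
Qed.

Lemma tangent_Z_upper t i j : t \in tangent Zorb x -> (j <= i)%N -> t i j = 0.
Proof. by move=> tt ji; apply: tangent_entry0 tt => u /Zn; apply. Qed.

(** The corner is the whole matrix: minors of size [k + 1] vanish on Z, and row [i] and column [j]
    contain no entry of [x]. *)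
Lemma tangent_Z_corner t i j : t \in tangent Zorb x -> (k <= i)%N -> (j < n - k)%N -> t i j = 0.
Proof.
rewrite tangent_Zset => tt ki jk;
  apply: (corner_minor le_2k_n (p := 0%N) (q := n) _ _ _ _ _ tt) => //.
- by rewrite crank_full.
- by rewrite ltnNge ki.
- by move=> l lk _ E; have := sh_big le_2k_n lk; rewrite E leqNgt jk.
Qed.

Lemma tangent_Z_anti t : t \in tangent Zorb x -> x *m t + t *m x = 0.
Proof.
move=> /tangentP tt; apply/matrixP => i j; rewrite [RHS]mxE.
have := tt ((genmx K n *m genmx K n) i j).
have sq R (g : {rmorphism {mpoly K[n * n]} -> R}) :
  g ((genmx K n *m genmx K n) i j) = (map_mx g (genmx K n) *m map_mx g (genmx K n)) i j.
  by rewrite -map_mxM [RHS]mxE.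
have fv : vanishes_on Zorb ((genmx K n *m genmx K n) i j).
  by move=> u [[u2 _] _]; rewrite -[LHS]/(mxev u _) sq mxeval_genmx u2 mxE.
move=> /(_ fv); rewrite mxdiff_line sq pev_genmx => e; rewrite -[RHS]e.
rewrite [in RHS]mxE raddf_sum /= horner_sum mxE [X in X + _]mxE [X in _ + X]mxE -big_split /=.
apply: eq_bigr => l _; rewrite derivM hornerD !hornerM.
have d0 a c : ((mxline x t a c)^`()).[0] = t a c.
  by have := congr1 (fun B : 'M_n => B a c) (deriv0_line x t); rewrite mxE.
have a0 a c : (mxline x t a c).[0] = x a c.
  by have := congr1 (fun B : 'M_n => B a c) (at0_line x t); rewrite mxE.
by rewrite !d0 !a0 addrC.
Qed.

Lemma tangent_Z_key t e : t \in tangent Zorb x -> moved k e -> e \notin P ->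
  t (key k e).1 (key k e).2 = 0.
Proof.
move=> tt me eP; apply/eqP; apply: contraNT eP => tn.
have xe : x e.1 e.2 = 0.
  rewrite xkE //; case: andP => // -[ik /eqP E]; move: tn; rewrite /key ik /= E.
  by rewrite (tangent_Z_upper tt) ?eqxx.
rewrite inE phi_CE // me /=.
suff /(Rle_bruhat le_2k_n ntype_v)[c cW br] : Rle k (r e) v by apply/exists_inP; exists c.
move=> p q qn; rewrite leqNgt; apply/negP => lt.
have lt1 := leq_ltn_trans (crank1_le le_2k_n v p qn) lt.
(* A violation at [(p, q)] forces the corner rank of [v x] down to that of [x], because r_e x
   exceeds the latter by at most one; this is the rank condition of [corner_minor]. *)
have [a [c [/andP[pa cq] na nc ac]]] := crank_moved le_2k_n me xe lt1.
have tac : t a c = 0.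
  apply: (corner_minor le_2k_n (p := p) (q := q) (w := v)) => //; last by rewrite -tangent_Zset.
  rewrite -ltnS; apply: leq_trans lt _; apply: (crank_moved_le (K := K)) => // ik.
  rewrite ltnNge; apply/negP => le; move: tn; rewrite /key ik /=.
  by rewrite (tangent_Z_upper tt le) eqxx.
(* The minor may have reached the position of [dvec e] other than the key; the entries of [t] at the
   two positions agree up to sign. *)
case: ac => [ac|[ik jC ac]]; first by move: tn; rewrite -ac tac eqxx.
have [uk ue] := unshP le_2k_n jC.
move: tn; rewrite /key ik /= -ue (anti_deriv le_2k_n (tangent_Z_anti tt)) //.
by move: ac => -[<- <-]; rewrite tac oppr0 eqxx.
Qed.

End TangentSpace.

Section TangentSum.
Variables (K : closedFieldType) (n k : nat).
Hypothesis charK0 : [pchar K] =i pred0.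
Hypothesis le_2k_n : (2 * k <= n)%N.
Variable v : 'S_n.
Hypothesis vC : incC k v.
Hypothesis Zn : forall u : 'M[K]_n, Zorb k v u -> strictly_upper u.
Local Notation x := (xk K n k).
Local Notation sh := (sh k).
Local Notation TY := (tangent (Y0 k) x).
Local Notation TZ := (tangent (Zorb k v) x).
Local Notation P := [set e in phi_C K n k | coset_bruhat k (tperm e.1 e.2) v].

(** Each position outside the support of T(Y0) is the key of a moved pair, is linked to one by x t +
    t x = 0, or lies in rows [>= k] and columns [< n - k], where [t] vanishes. *)
Lemma tangentY0_of_keys (t : 'M[K]_n) : t \in TZ ->
  (forall e : 'I_n * 'I_n, moved k e -> t (key k e).1 (key k e).2 = 0) -> t \in TY.
Proof.
move=> tt h; apply/(tangentY0P charK0 le_2k_n) => i j tn.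
have [jC|jC] := leqP (n - k) j.
  have [l lk ej] := sh_surj le_2k_n jC.
  have h' := h (l, i); move: h'; rewrite /key /= lk /moved /same_block /= -ej => h'.
  have : ~~ ((l < i)%N && ((i < k)%N || ~~ [&& ((l < k) == (i < k))%N & ((l < n - k) == (i < n -
    k))%N])).
    by apply: contra tn => /h' ->.
  by rewrite ej shE //; lia.
have ik : (i < k)%N.
  by rewrite ltnNge; apply: contra tn => ik; rewrite (tangent_Z_corner le_2k_n tt).
have shi := sh_big le_2k_n ik; case/eqP: tn.
have me : moved k (j, sh i) by rewrite /moved /same_block /=; lia.
have := h _ me; rewrite /key /=; case: ltnP => jk /=.
  by rewrite (anti_deriv le_2k_n (tangent_Z_anti tt)) // => /eqP; rewrite oppr_eq0 => /eqP.
have [uk ue] := unshP le_2k_n shi.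
by rewrite (_ : unsh k (sh i) = i) //; apply: (sh_inj le_2k_n); rewrite ?inE.
Qed.

Lemma tangent_Z_sum : [/\
  directv (TY + \sum_(e in P) tangent (Ccurve k e) x)%VS,
  (TY + \sum_(e in P) tangent (Ccurve k e) x)%VS = TZ &
  \dim TZ = (\dim TY + #|P|)%N].
Proof.
have VE e : e \in P -> tangent (Ccurve k e) x = <[dvec K k e]>%VS.
  move=> /(tk_moved charK0 le_2k_n vC Zn)[me xe]; apply: tangent_Ccurve => //.
  by move: me; rewrite /moved => /andP[].
have mP e : e \in P -> moved k e by case/(tk_moved charK0 le_2k_n vC Zn).
have [dV dimV] := direct_keys (U := TY) VE
  (fun u e uY eP => tangentY0_key charK0 le_2k_n uY (mP e eP))
  (fun e eP => dvec_key K le_2k_n (mP e eP))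
  (fun e e' eP eP' ne => dvec_key0 K le_2k_n (mP e eP) (mP e' eP') ne).
suff E : (TY + \sum_(e in P) tangent (Ccurve k e) x)%VS = TZ by split=> //; rewrite -E.
apply/eqP; rewrite eqEsubv; apply/andP; split.
  rewrite subv_add tangentY0_sub //=; apply/subv_sumP => e eP; rewrite VE //.
  by rewrite -memvE; apply: tk_dvec.
apply/subvP => t tt; pose c e := t (key k e).1 (key k e).2 / dvec K k e (key k e).1 (key k e).2.
pose s := \sum_(e in P) c e *: dvec K k e.
have sZ : s \in TZ by apply: memv_suml => e eP; apply: memvZ; apply: tk_dvec.
rewrite -[t](subrK s); apply: memv_add; last first.
  by apply/memv_sumP; exists (fun e => c e *: dvec K k e) => // e eP;
    rewrite VE // memvZ // memv_line.
apply: tangentY0_of_keys => [|e me]; first exact: memvB.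
have [eP|eP] := boolP (e \in P); last first.
  have tsZ : t - s \in TZ by apply: memvB.
  refine (tangent_Z_key le_2k_n Zn tsZ me eP).
rewrite mxE [X in _ + X]mxE /s summxE (bigD1 e) //= big1 ?addr0.
  by rewrite mxE /c divfK ?subrr // dvec_key.
by move=> e' /andP[e'P ne]; rewrite mxE dvec_key0 ?mulr0 // mP.
Qed.

End TangentSum.

(** * Representatives of the orbits *)

Section NormalForm.
Variables (K : closedFieldType) (n : nat).
Implicit Types (u : 'M[K]_n) (s : seq ('I_n * 'I_n)) (i j : 'I_n).

Definition support s := unzip1 s ++ unzip2 s.

(** The part of [u] already in normal form: rows and columns of the support carry exactly the
    partial matching [s], with entries 1. *)
Definition reduced u s := uniq (support s) /\
  forall i j, (i \in support s) || (j \in support s) -> u i j = ((i, j) \in s)%:R.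

Lemma pair_support s i j : (i, j) \in s -> (i \in support s) /\ (j \in support s).
Proof. by move=> h; rewrite !mem_cat (map_f fst h) (map_f snd h) orbT. Qed.

Lemma reduced_cross u s i j : reduced u s -> (i \in support s) != (j \in support s) -> u i j = 0.
Proof.
case=> _ h ne; rewrite h; first by case E: ((i, j) \in s) => //; case: (pair_support E) ne => -> ->.
by move: ne; case: (i \in _); case: (j \in _).
Qed.

(** The pivot column [m] is the leftmost nonzero one outside the support, and [a] is the lowest row
    where it is nonzero; this choice keeps [P] upper triangular. The new basis replaces e_a by u e_m
    and subtracts multiples of e_m from the other vectors to clear row [a]; then u^2 = 0 clears
    column [a] and row [m]. *)
Lemma reduce_step u s : u *m u = 0 -> reduced u s ->
  (exists i j, [/\ i \notin support s, j \notin support s & u i j != 0]) ->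
  exists b a m, borel b /\ reduced (conjmx_by b u) ((a, m) :: s).
Proof.
move=> u2 rs [i0 [j0 [i0s j0s u00]]]; set D := support s in i0s j0s.
pose Q j := (j \notin D) && [exists i, u i j != 0].
have Qj0 : Q j0 by rewrite /Q j0s; apply/existsP; exists i0.
case: (arg_minnP (fun j : 'I_n => j : nat) Qj0) => m /andP[mD /existsP[i1 ui1]] minm.
case: (arg_maxnP (fun i : 'I_n => i : nat) (P := fun i => u i m != 0) ui1) => a uam maxa.
have aD : a \notin D.
  apply: contraNN uam => aD; apply/eqP; apply: (reduced_cross rs).
  by rewrite -/D aD (negbTE mD).
have colz (j l : 'I_n) : (j < m)%N -> j \notin D -> u l j = 0.
  move=> jm jD; apply/eqP; apply: contraTT jm => ulj; rewrite -leqNgt; apply: minm.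
  by rewrite /Q jD; apply/existsP; exists l.
have rowz (l : 'I_n) : (a < l)%N -> u l m = 0.
  move=> al; apply/eqP; apply: contraTT al => ulm; rewrite -leqNgt; exact: maxa.
have u2E i j : \sum_l u i l * u l j = 0.
  by have := congr1 (fun A : 'M_n => A i j) u2; rewrite !mxE.
(* A pivot on the diagonal would give [u *m u] the nonzero diagonal entry [u m m ^+ 2]. *)
have am : a != m.
  apply: contraNneq uam => E; have := u2E m m; rewrite (bigD1 m) //= big1 ?addr0.
    by rewrite -E => /eqP; rewrite mulf_eq0 orbb.
  move=> l lm; have [ll|ll] := ltnP a l; first by rewrite rowz ?mulr0.
  have ltm : (l < m)%N by rewrite ltn_neqAle; move: lm ll; rewrite -val_eqE E => -> ->.
  have [lD|lD] := boolP (l \in D); last by rewrite (colz l) ?mul0r.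
  by rewrite (reduced_cross (j := m) rs) ?mulr0 // -/D lD (negbTE mD).
have ma : m != a by rewrite eq_sym.
pose c j := if (j == m) || (j == a) then 0 else u a j / u a m.
pose P : 'M[K]_n := \matrix_(i, j) if j == a then u i m else (i == j)%:R - (i == m)%:R * c j.
have cD j : j \in D -> c j = 0.
  move=> jD; rewrite /c; case: ifP => // _; rewrite (reduced_cross rs) ?mul0r //.
  by rewrite -/D jD (negbTE aD).
have PB : borel P.
  apply: borelI => [i j ji|i]; rewrite mxE.
    case: (j =P a) => [E|_]; first by apply: rowz; rewrite -E.
    rewrite -val_eqE gtn_eqF // sub0r; case: (i =P m) => [E|_]; last by rewrite mul0r oppr0.
    have [jD|jD] := boolP (j \in D); first by rewrite cD // mulr0 oppr0.
    rewrite /c; case: ifP => _; rewrite ?mulr0 ?oppr0 // colz ?mul0r ?mulr0 ?oppr0 //.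
    by rewrite -E.
  case: (i =P a) => [-> //|_]; rewrite eqxx; case: (i =P m) => [->|_].
    by rewrite /c eqxx mulr0 subr0 oner_neq0.
  by rewrite mul0r subr0 oner_neq0.
have [uP _] := PB.
pose v := conjmx_by (invmx P) u.
have vE : v = invmx P *m u *m P by rewrite /v /conjmx_by invmxK.
have Pv : P *m v = u *m P by rewrite vE !mulmxA mulmxV // mul1mx.
have v2 : v *m v = 0.
  by rewrite vE !mulmxA mulmxK // -[invmx P *m u *m u]mulmxA u2 mulmx0 mul0mx.
have col_of j (w : 'cV[K]_n) : u *m col j P = P *m w -> col j v = w.
  move=> E; have <- : invmx P *m (u *m col j P) = w by rewrite E mulKmx.
  by rewrite vE !colE !mulmxA.
have Pm : col m P = delta_mx m 0.
  apply/colP => i; rewrite !mxE (negbTE ma) /c eqxx mulr0 subr0 andbT //.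
have Pa : col a P = col m u by apply/colP => i; rewrite !mxE eqxx.
have vm i : v i m = (i == a)%:R.
  have : col m v = delta_mx a 0.
    by apply: col_of; rewrite Pm -colE -colE Pa.
  by move/colP/(_ i); rewrite !mxE andbT.
have va i : v i a = 0.
  have : col a v = 0.
    by apply: col_of; rewrite Pa mulmx0 colE mulmxA u2 mul0mx.
  by move/colP/(_ i); rewrite !mxE.
have row_aV : row a (invmx P) = (u a m)^-1 *: delta_mx 0 a.
  have E : delta_mx 0 a *m P = u a m *: delta_mx 0 a :> 'rV_n.
    apply/matrixP => l j; rewrite -rowE !mxE [l]ord1 eqxx /=; case: (j =P a) => [_|/eqP ja].
      by rewrite mulr1.
    by rewrite (negbTE am) mul0r subr0 eq_sym (negbTE ja) mulr0.
  have := congr1 (mulmxr (invmx P)) E; rewrite /= mulmxK // -scalemxAl -rowE => ->.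
  by rewrite scalerA mulVf // scale1r.
have vaj j : v a j = (j == m)%:R.
  have : row a v = (u a m)^-1 *: (row a u *m P).
    by rewrite vE rowE !mulmxA -rowE row_aV -!scalemxAl -rowE.
  move/rowP/(_ j); rewrite !mxE => ->.
  have [->|ja] := eqVneq j a.
    rewrite (negbTE am); under eq_bigr => l _ do rewrite !mxE eqxx.
    by rewrite u2E mulr0.
  under eq_bigr => l _ do rewrite !mxE (negbTE ja) mulrBr.
  rewrite sumrB (bigD1 j) //= eqxx mulr1 big1 ?addr0; last first.
    by move=> l lj; rewrite (negbTE lj) mulr0.
  rewrite (bigD1 m) //= eqxx mul1r big1 ?addr0; last first.
    by move=> l lm; rewrite (negbTE lm) mul0r mulr0.
  have [->|jm] := eqVneq j m; first by rewrite /c eqxx mulr0 subr0 mulVf.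
  by rewrite /c (negbTE jm) (negbTE ja) /= [u a m * _]mulrC divfK // subrr mulr0.
have vmj j : v m j = 0.
  have E : (v *m v) a j = 0 by rewrite v2 mxE.
  move: E; rewrite mxE (bigD1 m) //= vaj eqxx mul1r big1 ?addr0 //.
  by move=> l lm; rewrite vaj (negbTE lm) mul0r.
have PD i j : (i \in D) || (j \in D) -> P i j = (i == j)%:R.
  rewrite mxE => /orP[iD|jD].
    have ia : i != a by apply: contraNneq aD => <-.
    have im : i != m by apply: contraNneq mD => <-.
    case: eqP => [->|_]; last by rewrite (negbTE im) mul0r subr0.
    by rewrite (negbTE ia) (reduced_cross rs) // -/D iD (negbTE mD).
  have ja : j != a by apply: contraNneq aD => <-.
  by rewrite (negbTE ja) cD // mulr0 subr0.
have rowD i : i \in D -> row i (invmx P) = delta_mx 0 i.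
  move=> iD; have E : delta_mx 0 i *m P = delta_mx 0 i :> 'rV_n.
    by apply/rowP => j; rewrite -rowE mxE PD ?iD // [RHS]mxE eqxx eq_sym.
  by rewrite rowE -E mulmxK.
have colD j : j \in D -> col j (invmx P) = delta_mx j 0.
  move=> jD; have E : P *m delta_mx j 0 = delta_mx j 0 :> 'cV_n.
    by apply/colP => i; rewrite -colE mxE PD ?jD ?orbT // mxE andbT.
  by rewrite colE -[in LHS]E mulKmx.
have vD i j : (i \in D) || (j \in D) -> v i j = u i j.
  case/orP => [iD|jD].
    have : row i v = row i u *m P by rewrite vE rowE !mulmxA -rowE rowD // -!rowE.
    move/rowP/(_ j); rewrite !mxE => ->; rewrite (bigD1 j) //= big1 ?addr0.
      have [jD|jD] := boolP (j \in D); first by rewrite PD ?jD ?orbT // !mxE eqxx mulr1.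
      by rewrite !mxE (reduced_cross (j := j) rs) ?mul0r // -/D iD (negbTE jD).
    move=> l lj; rewrite mxE; have [lD|lD] := boolP (l \in D).
      by rewrite PD ?lD // (negbTE lj) mulr0.
    by rewrite (reduced_cross (j := l) rs) ?mul0r // -/D iD (negbTE lD).
  have : col j v = invmx P *m col j u.
    rewrite vE !colE -!mulmxA; congr (_ *m (_ *m _)).
    by apply/colP => l; rewrite -colE mxE PD ?jD ?orbT // mxE andbT.
  move/colP/(_ i); rewrite !mxE => ->; rewrite (bigD1 i) //= big1 ?addr0.
    have [iD|iD] := boolP (i \in D).
      have := congr1 (fun B : 'rV_n => B 0 i) (rowD i iD); rewrite !mxE !eqxx /= => ->.
      by rewrite mul1r.
    by rewrite !mxE (reduced_cross (j := j) rs) ?mulr0 // -/D jD (negbTE iD).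
  move=> l li; rewrite mxE; have [lD|lD] := boolP (l \in D).
    have := congr1 (fun B : 'cV_n => B i 0) (colD l lD); rewrite !mxE => ->.
    by rewrite eq_sym (negbTE li) mul0r.
  by rewrite (reduced_cross (j := j) rs) ?mulr0 // -/D jD (negbTE lD).
have [us h] := rs.
exists (invmx P), a, m; split; first exact: borelV.
have memD i : (i \in support ((a, m) :: s)) = [|| i == a, i == m | i \in D].
  rewrite /D /support /= !(inE, mem_cat) /=; case: (i == a) => //=; case: (i == m) => //=.
  by rewrite orbT.
split.
  have pe : perm_eq (support ((a, m) :: s)) (a :: m :: D).
    by rewrite /support /= perm_cons (perm_catCA (unzip1 s) [:: m] (unzip2 s)).
  by rewrite (perm_uniq pe) /= inE negb_or am aD mD us.
have nDl i j : i \notin D -> ((i, j) \in s) = false.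
  by move=> iD; apply: contraNF iD => /pair_support[].
have nDr i j : j \notin D -> ((i, j) \in s) = false.
  by move=> iD; apply: contraNF iD => /pair_support[].
move=> i j; rewrite !memD -/v inE xpair_eqE.
have [->|ia] := eqVneq i a; first by rewrite vaj nDl // orbF.
have [->|im] := eqVneq i m; first by rewrite vmj nDl.
have [->|ja] := eqVneq j a; first by rewrite va nDr.
have [->|jm] := eqVneq j m; first by rewrite vm nDr // (negbTE ia).
by rewrite !(orFb, andFb) => hD; rewrite vD // h.
Qed.

Lemma reduce_full u : u *m u = 0 ->
  exists b s, borel b /\ reduced (conjmx_by b u) s /\
    forall i j, conjmx_by b u i j = ((i, j) \in s)%:R.
Proof.
move=> u2.
have sq b : borel b -> conjmx_by b u *m conjmx_by b u = 0.
  move=> [ub _]; rewrite /conjmx_by !mulmxA mulmxKV // -[b *m u *m u]mulmxA u2.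
  by rewrite mulmx0 mul0mx.
suff H d : forall b s, borel b -> reduced (conjmx_by b u) s -> (n - size s < d)%N ->
    exists b s, borel b /\ reduced (conjmx_by b u) s /\
    forall i j, conjmx_by b u i j = ((i, j) \in s)%:R.
  by apply: (H _ 1%:M [::]) (borel1 _ _) _ (ltnSn _); split.
elim: d => // d IH b s bb rs; rewrite ltnS => le.
have [ex|nex] := pselect (exists i j, [/\ i \notin support s,
  j \notin support s & conjmx_by b u i j != 0]).
  have [b' [a [m [bb' rs']]]] := reduce_step (sq b bb) rs ex.
  have [ub _] := bb; have [ub' _] := bb'.
  rewrite conjmx_byM // in rs'; apply: (IH _ _ (borelM bb' bb) rs').
  have [us _] := rs'; have := max_card (mem (support ((a, m) :: s))).
  rewrite (card_uniqP us) card_ord size_cat !size_map /=; move: le; lia.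
exists b, s; split=> //; split=> // i j; have [_ h] := rs.
have [|] := boolP ((i \in support s) || (j \in support s)); first exact: h.
rewrite negb_or => /andP[iD jD].
have -> : ((i, j) \in s) = false by apply: contraNF iD => /pair_support[].
by apply/eqP; apply: contraT => ne; case: nex; exists i, j.
Qed.

End NormalForm.

Section OrbitRepresentative.
Variables (K : closedFieldType) (n k : nat).
Hypothesis le_2k_n : (2 * k <= n)%N.
Local Notation x := (xk K n k).

Lemma seq_perm (L : seq 'I_n) : uniq L -> size L = n ->
  exists w : 'S_n, forall i : 'I_n, w i = nth i L i.
Proof.
move=> uL sL; have inj : injective (fun i : 'I_n => nth i L i).
  move=> i j /=; rewrite (set_nth_default j) ?sL // => /eqP.
  by rewrite nth_uniq ?sL // => /eqP/val_inj.
by exists (perm inj) => i; rewrite permE.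
Qed.

Lemma Ok_Borbit (u : 'M[K]_n) : Ok k u -> exists2 w, incC k w & Borbit k w u.
Proof.
move=> [u2 ru]; have [b [s0 [bb [[us0 _] uE]]]] := reduce_full u2.
pose le2 := [rel e e' : 'I_n * 'I_n | (e.2 <= e'.2)%N].
pose s := sort le2 s0.
have ps : perm_eq s s0 by rewrite perm_sort.
have us : uniq (support s).
  rewrite (perm_uniq (s2 := support s0)) //.
  by apply: perm_cat; apply: perm_map.
have {}uE i j : conjmx_by b u i j = ((i, j) \in s)%:R by rewrite uE (perm_mem ps).
have srt : sorted leq (map val (unzip2 s)).
  rewrite /unzip2 -map_comp sorted_map; apply: sort_sorted => e e'; exact: leq_total.
pose rest := [seq i <- enum 'I_n | i \notin support s].
pose L := unzip1 s ++ rest ++ unzip2 s.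
have pL : perm_eq L (rest ++ support s).
  by rewrite /L perm_catCA.
have uL : uniq L.
  rewrite (perm_uniq pL) cat_uniq filter_uniq ?enum_uniq //= us andbT.
  by apply/hasPn => i iD; rewrite mem_filter iD.
have sL : size L = n.
  have pn : perm_eq L (enum 'I_n).
    apply: uniq_perm => // [|i]; first exact: enum_uniq.
    by rewrite (perm_mem pL) mem_cat mem_filter mem_enum; case: (i \in support s).
  by rewrite (perm_size pn) size_enum_ord.
have [w wE] := seq_perm uL sL.
set k' := size s.
have sLE : (k' + (size rest + k') = n)%N by rewrite -[RHS]sL /L !size_cat !size_map.
have sz : (2 * k' <= n)%N by lia.
have srest : size rest = (n - 2 * k')%N by lia.
have wA (i : 'I_n) : (i < k')%N -> w i = nth i (unzip1 s) i.
  by move=> ik; rewrite wE /L nth_cat size_map ik.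
have wC (i : 'I_n) : (n - k' <= i)%N -> w i = nth i (unzip2 s) (i - (n - k')).
  move=> ik; have lt := ltn_ord i; rewrite wE /L catA nth_cat size_cat size_map srest -/k'.
  by rewrite ifN; [congr nth; lia|lia].
have conjE : conjmx_by b u = conjmx_by (dotmx K w) (xk K n k').
  apply/matrixP => i j; rewrite -[i](permKV w) -[j](permKV w) conj_dotmx uE xkE //.
  set c := (w^-1)%g i; set d := (w^-1)%g j; congr (_%:R); congr nat_of_bool.
  apply/idP/andP => [/(nthP (c, d))[l lk E]|[ck /eqP ->]].
    have ln : (l < n)%N by move: lk; rewrite -/k'; lia.
    pose li := Ordinal ln.
    have e1 : w li = w c by rewrite wA // (nth_map (c, d)) // E.
    have shl : sh k' li = (l + (n - k'))%N :> nat by rewrite shE.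
    have e2 : w (sh k' li) = w d.
      rewrite wC ?shl ?leq_addl // addnK (nth_map (c, d)) // E //.
    by rewrite -(perm_inj e1) -(perm_inj e2) lk.
  apply/(nthP (c, c)); exists c => //.
  have -> : w c = nth c (unzip1 s) c by rewrite wA.
  have -> : w (sh k' c) = nth (sh k' c) (unzip2 s) c.
    by rewrite wC ?shE ?leq_addl // addnK.
  by rewrite !(nth_map (c, c)) // -surjective_pairing.
have [ub _] := bb.
have kk : k' = k.
  by have [_ <-] := Ok_conj ub (conj u2 ru); rewrite conjE;
    have [_ ->] := Ok_conj (dotmx_unit K w) (Ok_xk K sz).
rewrite kk in conjE wC.
exists w.
  move=> i j iC ij; have jC : (n - k <= j)%N by lia.
  have lt2 : (j - (n - k) < size (unzip2 s))%N by rewrite size_map -/k' kk; have := ltn_ord j; lia.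
  have lt1 : (i - (n - k) < size (unzip2 s))%N by lia.
  rewrite !wC // (set_nth_default j) // ltn_neqAle; apply/andP; split.
    apply/eqP => /val_inj/eqP; rewrite nth_uniq //; first by lia.
    by move: us; rewrite /support cat_uniq => /and3P[].
  rewrite -!(nth_map j (val j)) //; apply: (sorted_leq_nth leq_trans leqnn _ srt);
    rewrite ?inE ?size_map //.
  - by rewrite size_map in lt1.
  - by rewrite size_map in lt2.
  - lia.
apply/BorbitE; exists (invmx b); first exact: borelV.
by rewrite -conjE conjmx_byM ?unitmx_inv // mulVmx // conjmx_by1.
Qed.

End OrbitRepresentative.

(** * The dimension of an orbit closure *)

Section Dimension.
Variables (K : closedFieldType) (n k : nat).
Hypothesis charK0 : [pchar K] =i pred0.
Hypothesis le_2k_n : (2 * k <= n)%N.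
Variable v : 'S_n.
Hypothesis vC : incC k v.
Hypothesis v_moved : forall e, e \in inv_set v -> moved k e.
Implicit Types (A E F b u t : 'M[K]_n) (i j : 'I_n) (e : 'I_n * 'I_n).
Local Notation x := (xk K n k).
Local Notation sh := (sh k).
Local Notation TY := (tangent (Y0 k) x).
Local Notation Z := (Zorb k v).
Local Notation cv := (conjmx_by (dotmx K v)).
Local Notation q0 := (cv x).

Definition upper (R : nmodType) (A : 'M[R]_n) := forall i j : 'I_n, (j < i)%N -> A i j = 0.

Definition orbit_model : {vspace 'M[K]_n} := (TY + \sum_(e in inv_set v) <[dvec K k e]>)%VS.
Definition orbit_tangent : {vspace 'M[K]_n} := (linfun cv @: orbit_model)%VS.

Lemma dim_orbit_tangent : \dim orbit_tangent = (\dim TY + #|inv_set v|)%N.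
Proof.
rewrite dim_conj ?dotmx_unit //.
by have [] := direct_keys (U := TY) (fun e _ => erefl <[dvec K k e]>%VS)
  (fun u e uY eP => tangentY0_key charK0 le_2k_n uY (v_moved eP))
  (fun e eP => dvec_key K le_2k_n (v_moved eP))
  (fun e e' eP eP' ne => dvec_key0 K le_2k_n (v_moved eP) (v_moved eP') ne).
Qed.

Definition mxcomm A B : 'M[K]_n := A *m B - B *m A.

Lemma commDl A B C : mxcomm (A + B) C = mxcomm A C + mxcomm B C.
Proof. by rewrite /mxcomm mulmxDl mulmxDr opprD addrACA. Qed.

Lemma commZl a A B : mxcomm (a *: A) B = a *: mxcomm A B.
Proof. by rewrite /mxcomm -scalemxAl -scalemxAr scalerBr. Qed.

Lemma comm0l B : mxcomm 0 B = 0.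
Proof. by rewrite /mxcomm mul0mx mulmx0 subrr. Qed.

Lemma comm_conj A B : cv (mxcomm A B) = mxcomm (cv A) (cv B).
Proof.
rewrite /mxcomm linearB /=; congr (_ - _); rewrite /conjmx_by !mulmxA mulmxKV ?dotmx_unit //.
Qed.

Lemma conj_delta i j : cv (delta_mx i j) = delta_mx (v i) (v j).
Proof.
apply/matrixP => a c; rewrite conj_dotmxE !mxE; congr (_%:R); congr (nat_of_bool (_ && _)).
  by rewrite -(inj_eq (@perm_inj _ v)) permKV.
by rewrite -(inj_eq (@perm_inj _ v)) permKV.
Qed.

Lemma comm_delta i j : mxcomm (delta_mx (v i) (v j)) q0 = cv (dvec K k (j, i)).
Proof. by rewrite -conj_delta -comm_conj. Qed.

(** For [j < i] the pair [(j, i)] is an inversion of [v]; for [i <= j] the vector is already tangent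
    to Y0. *)
Lemma dvec_model i j : (v i <= v j)%N -> dvec K k (j, i) \in orbit_model.
Proof.
move=> le; have [ji|ij] := ltnP j i.
  apply: subvP (addvSr _ _) _ _; apply: (subvP (sumv_sup (j, i) _ (subvv _))).
    rewrite inE /= ji ltn_neqAle le andbT; apply/eqP => /val_inj/perm_inj E.
    by rewrite E ltnn in ji.
  exact: memv_line.
apply: subvP (addvSl _ _) _ _; apply/(tangentY0P charK0 le_2k_n) => a c; rewrite dvecE //=.
case: andP => [[/andP[/eqP -> jk] /eqP ->] _|_].
  by split; [exact: leq_ltn_trans ij jk|rewrite shE // leq_add2r].
rewrite sub0r oppr_eq0; case: andP => [[/andP[ak /eqP E] /eqP ->] _|_]; last by rewrite eqxx.
by split => //; rewrite -shE // -E.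
Qed.

Lemma comm_orbit_tangent E : upper E -> mxcomm E q0 \in orbit_tangent.
Proof.
move=> uE; rewrite [E]matrix_sum_delta.
suff H (P : 'M[K]_n -> Prop) : P 0 -> (forall A B, P A -> P B -> P (A + B)) ->
   (forall i j, P (E i j *: delta_mx i j)) -> P (\sum_i \sum_j E i j *: delta_mx i j).
  apply: (H (fun A => mxcomm A q0 \in orbit_tangent)) => [|A B|i j].
  - by rewrite comm0l mem0v.
  - by rewrite commDl => *; apply: memvD.
  - rewrite commZl; have [ji|ij] := ltnP j i; first by rewrite uE // scale0r mem0v.
    apply: memvZ; rewrite -[i](permKV v) -[j](permKV v) comm_delta.
    apply/memv_imgP; eexists; last by rewrite lfunE.
    by apply: dvec_model; rewrite !permKV.
by move=> P0 PD Pd; apply: (big_ind P) => // i _; apply: (big_ind P).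
Qed.

Lemma orbit_tangent_comm w : w \in orbit_tangent -> exists2 E, upper E & mxcomm E q0 = w.
Proof.
pose Q (u : 'M[K]_n) := exists2 E, upper E & mxcomm E q0 = cv u.
have QD u u' : Q u -> Q u' -> Q (u + u').
  move=> [E uE e] [E' uE' e']; exists (E + E'); first by move=> i j ij; rewrite mxE uE ?uE' ?addr0.
  by rewrite commDl e e' linearD.
have QZ a u : Q u -> Q (a *: u).
  move=> [E uE e]; exists (a *: E); first by move=> i j ij; rewrite mxE uE ?mulr0.
  by rewrite commZl e linearZ.
have Q0 : Q 0.
  by exists 0; [move=> i j _; rewrite mxE|rewrite comm0l linear0].
have Qd i j : (v i <= v j)%N -> Q (dvec K k (j, i)).
  move=> ij; exists (delta_mx (v i) (v j)); last exact: comm_delta.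
  move=> a c ca; rewrite mxE; case: andP => // -[/eqP E /eqP E']; move: ca; rewrite E E'; lia.
case/memv_imgP => u /memv_addP[y yY [z /memv_sumP[vs vsV ->] ->]] ->; rewrite lfunE /=.
apply: (QD).
  rewrite [y]matrix_sum_delta; apply: (big_ind Q Q0 QD) => i _; apply: (big_ind Q Q0 QD) => j _.
  have [->|] := eqVneq (y i j) 0; first by rewrite scale0r.
  have /(tangentY0P charK0 le_2k_n) h := yY; move=> /h [ik ij]; apply: (QZ).
  (* A basis vector of T(Y0) comes from the elementary matrix E_{sh i, j} on the last [k] indices,
     where [v] is increasing. *)
  have -> : delta_mx i j = -1 *: dvec K k (j, sh i).
    apply/matrixP => a c; rewrite mxE [RHS]mxE dvecE //= [(j < k)%N]ltnNge (leq_trans _ ij) /=;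
      last by lia.
    rewrite andbF sub0r mulN1r opprK; congr (_%:R); congr nat_of_bool; congr (_ && _).
    case: ltnP => ak /=; first by rewrite sh_eq // eq_sym.
    by apply/eqP => E; move: ak; rewrite E leqNgt ik.
  apply/QZ/Qd; have iC := sh_big le_2k_n ik.
  have : (sh i <= j)%N by rewrite shE.
  by rewrite leq_eqVlt => /orP[/eqP/val_inj <- //|lt]; apply/ltnW/vC.
apply: (big_ind Q Q0 QD) => e eP; have := vsV e eP; case/vlineP => c ->.
apply: (QZ); rewrite [e]surjective_pairing; apply: (Qd).
by move: eP; rewrite inE => /andP[_ /ltnW].
Qed.

(** The orbit is stable under nonzero scalars; this direction enters [dPsiE] through the derivative
    of the determinant. *)
Lemma q0_orbit_tangent : q0 \in orbit_tangent.
Proof.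
apply/memv_imgP; exists x; last by rewrite lfunE.
apply: subvP (addvSl _ _) _ _; apply/(tangentY0P charK0 le_2k_n) => i j; rewrite xkE //.
by case: andP => [[ik /eqP ->] _|]; rewrite ?eqxx // shE // leqnn.
Qed.

End Dimension.

(** * A polynomial parametrization of the orbit of q0 *)

Section Parametrization.
Variables (K : closedFieldType) (n k : nat).
Hypothesis charK0 : [pchar K] =i pred0.
Hypothesis le_2k_n : (2 * k <= n)%N.
Variable v : 'S_n.
Hypothesis vC : incC k v.
Hypothesis v_moved : forall e, e \in inv_set v -> moved k e.
Implicit Types (A E F b u t : 'M[K]_n) (i j : 'I_n) (e : 'I_n * 'I_n).
Local Notation x := (xk K n k).
Local Notation sh := (sh k).
Local Notation TY := (tangent (Y0 k) x).
Local Notation Z := (Zorb k v : 'M[K]_n -> Prop).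
Local Notation cv := (conjmx_by (dotmx K v)).
Local Notation q0 := (cv x).
Local Notation pol := {mpoly K[n * n]}.
Local Notation orbit_tangent := (orbit_tangent K k v).

(** Lets the parameters range over all matrices, so that the polynomial ring in [n * n] variables
    serves for B as well. *)
Definition triu (R : nmodType) (A : 'M[R]_n) : 'M[R]_n :=
  \matrix_(i, j) if (i <= j)%N then A i j else 0.

Lemma triu_upper (R : nmodType) (A : 'M[R]_n) : upper (triu A).
Proof. by move=> i j ji; rewrite mxE leqNgt ji. Qed.

Lemma triu_id (R : nmodType) (A : 'M[R]_n) : upper A -> triu A = A.
Proof. by move=> h; apply/matrixP => i j; rewrite mxE; case: leqP => // /h ->. Qed.

Lemma map_triu (R S : pzRingType) (g : {rmorphism R -> S}) (A : 'M[R]_n) :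
  map_mx g (triu A) = triu (map_mx g A).
Proof. by apply/matrixP => i j; rewrite !mxE; case: ifP; rewrite ?rmorph0. Qed.

(** Conjugation with the adjugate in place of the inverse, hence polynomial in [B]; the extra
    factor, a determinant, is absorbed by [scale_q0]. *)
Definition orbmx (R : comNzRingType) (Q B : 'M[R]_n) : 'M[R]_n := triu B *m Q *m \adj (triu B).

Lemma map_orbmx (R S : comNzRingType) (g : {rmorphism R -> S}) (Q B : 'M[R]_n) :
  map_mx g (orbmx Q B) = orbmx (map_mx g Q) (map_mx g B).
Proof. by rewrite /orbmx !map_mxM map_mx_adj map_triu. Qed.

Definition Psi : 'M[pol]_n := orbmx (map_mx (@mpolyC (n * n) K) q0) (genmx K n).
Definition psi b : 'M[K]_n := orbmx q0 b.
Definition detT : pol := \det (triu (genmx K n)).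

Lemma Psi_eval b : map_mx (mxev b) Psi = psi b.
Proof.
rewrite map_orbmx mxeval_genmx; congr orbmx; apply/matrixP => i j; rewrite !mxE; exact: mevalC.
Qed.

Lemma detT_eval b : mxeval detT b = \det (triu b).
Proof. by rewrite -[LHS]/(mxev b _) -det_map_mx map_triu mxeval_genmx. Qed.

Lemma adj_inv (m : nat) (B : 'M[K]_m) : B \in unitmx -> \adj B = \det B *: invmx B.
Proof.
move=> uB; rewrite /invmx uB scalerA divff ?scale1r //.
by move: uB; rewrite unitmxE unitfE.
Qed.

Lemma triu_borel b : \det (triu b) != 0 -> borel (triu b).
Proof. by move=> d; split; [rewrite unitmxE unitfE|exact: triu_upper]. Qed.

Lemma psiE b : \det (triu b) != 0 -> psi b = \det (triu b) *: conjmx_by (triu b) q0.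
Proof.
move=> d; have [ub _] := triu_borel d.
by rewrite /psi /orbmx adj_inv // -scalemxAr.
Qed.

Definition tors (c : K) : 'M[K]_n := diag_mx (\row_i if (i < k)%N then c else 1).

Lemma tors_borel (w : 'S_n) c : c != 0 -> borel (conjmx_by (dotmx K w) (tors c)).
Proof.
move=> c0; apply: borelI => [i j ji|i]; rewrite conj_dotmxE !mxE.
  by rewrite (inj_eq (@perm_inj _ _)) -val_eqE gtn_eqF.
by rewrite eqxx; case: ifP => _; rewrite ?oner_neq0.
Qed.

Lemma tors_unit c : c != 0 -> tors c \in unitmx.
Proof.
by move=> c0; have [] := tors_borel 1%g c0; rewrite dotmx1 conjmx_by1.
Qed.

Lemma tors_xk c : c != 0 -> conjmx_by (tors c) x = c *: x.
Proof.
move=> c0; rewrite /conjmx_by; apply: (canLR (mulmxK (tors_unit c0))).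
apply/matrixP => i j; rewrite mul_diag_mx -scalemxAl mul_mx_diag !mxE.
case: (ltnP i k) => ik /=; last by rewrite !(mul0r, mulr0).
case: eqP => [E|_]; last by rewrite !(mul0r, mulr0).
by rewrite ltnNge E (leq_trans _ (leq_addl _ _)) /=; [ring|lia].
Qed.

Lemma det_tors (w : 'S_n) c : \det (conjmx_by (dotmx K w) (tors c)) = c ^+ k.
Proof.
have kn : (k <= n)%N by lia.
rewrite /conjmx_by !det_mulmx mulrAC -det_mulmx mulmxV ?dotmx_unit // det1 mul1r.
rewrite det_diag (eq_bigr (fun i : 'I_n => if (i < k)%N then c else 1)); last by move=> i _;
  rewrite mxE.
by rewrite -big_mkcond /= (big_ord_narrow kn) /= prodr_const card_ord.
Qed.

Lemma scale_q0 c : c != 0 -> c *: q0 = conjmx_by (cv (tors c)) q0.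
Proof.
move=> c0; have [u1 _] := tors_borel v c0; have uv := dotmx_unit K v; have ut := tors_unit c0.
rewrite -linearZ /= -tors_xk // !conjmx_byM //; congr (conjmx_by _ x).
by rewrite /conjmx_by mulmxKV.
Qed.

Lemma psi_Borbit b : \det (triu b) != 0 -> Borbit k v (psi b).
Proof.
move=> d; rewrite psiE // -linearZ /= scale_q0 //.
by apply: Borbit_conj; [exact: triu_borel|apply: Borbit_conj;
  [exact: tors_borel|exact: Borbit_rep]].
Qed.

Lemma psi_surj u : Borbit k v u -> exists2 b, \det (triu b) != 0 & psi b = u.
Proof.
move=> /BorbitE[b [ub hb] ->].
have d0 : \det b != 0 by move: ub; rewrite unitmxE unitfE.
(* Multiplying [b] by [cv (tors s)] on the right multiplies the determinant by [s ^+ k] and [q0] by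
   [s], hence [psi] by [s ^+ k.+1]. *)
have [s sE] : exists s, s ^+ k.+1 = (\det b)^-1.
  have /closed_rootP[s] : size ('X^(k.+1) - ((\det b)^-1)%:P) != 1%N by rewrite size_XnsubC.
  by rewrite /root !hornerE subr_eq0 => /eqP; exists s.
have s0 : s != 0.
  by apply: contraTneq (invr_neq0 d0) => E; rewrite -sE E expr0n eqxx.
have bh := tors_borel v s0; have [uh _] := bh.
have [ubh hbh] : borel (b *m cv (tors s)) by apply: borelM.
have tE : triu (b *m cv (tors s)) = b *m cv (tors s) by apply: triu_id.
have dE : \det (triu (b *m cv (tors s))) = \det b * s ^+ k by rewrite tE det_mulmx det_tors.
have dn : \det b * s ^+ k != 0 by rewrite mulf_neq0 ?expf_neq0.
exists (b *m cv (tors s)); first by rewrite dE.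
rewrite psiE ?dE // tE -conjmx_byM // -scale_q0 // linearZ /= scalerA -mulrA -exprSr sE mulfV //.
by rewrite scale1r.
Qed.

Lemma detT_neq0 : detT != 0.
Proof.
apply/eqP => /(congr1 (mxev 1%:M)); rewrite rmorph0 -[LHS]/(mxeval _ _) detT_eval triu_id.
  by rewrite det1 => /eqP; rewrite oner_eq0.
by move=> i j ji; rewrite mxE -val_eqE gtn_eqF.
Qed.

Lemma ptE (p : 'I_(n * n) -> K) : exists b, forall f : pol, f.@[p] = mxeval f b.
Proof.
exists (vec_mx (\row_i p i)) => f; apply: meval_eq => i.
by rewrite vec_mxK mxE.
Qed.

Lemma pol_ext0 (f : pol) : (forall b, \det (triu b) != 0 -> mxeval f b = 0) -> f = 0.
Proof.
move=> h; apply/eqP; apply: contraT => fn.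
have /(mpoly_nonroot charK0)[p] : f * detT != 0 by rewrite mulf_neq0 ?detT_neq0.
have [b bE] := ptE p; rewrite bE -[mxeval _ _]/(mxev b _) rmorphM /= /mxev detT_eval.
by have [->|/h ->] := eqVneq (\det (triu b)) 0; rewrite ?mulr0 ?mul0r eqxx.
Qed.

Lemma vanish_Psi f : vanishes_on (Borbit k v) f <-> mxcomp f Psi = 0.
Proof.
split=> [h|h u /psi_surj[b d <-]].
  by apply: pol_ext0 => b d; rewrite mxcomp_eval Psi_eval; apply/h/psi_Borbit.
by rewrite -Psi_eval -mxcomp_eval h; apply: meval0.
Qed.

Definition dPsi b F : 'M[K]_n := map_mx (fun f => mxdiff f b F) Psi.

Lemma dPsi_line b F : dPsi b F = deriv0 (orbmx (map_mx polyC q0) (mxline b F)).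
Proof.
have pE : map_mx (pev (mxline b F)) Psi = orbmx (map_mx polyC q0) (mxline b F).
  rewrite map_orbmx pev_genmx; congr orbmx; apply/matrixP => i j; rewrite !mxE; exact: mmapC.
by rewrite -pE; apply/matrixP => i j; rewrite !mxE mxdiff_line.
Qed.

Lemma deriv0M (G H : 'M[{poly K}]_n) : deriv0 (G *m H) = deriv0 G *m at0 H + at0 G *m deriv0 H.
Proof.
apply/matrixP => i j; rewrite !mxE raddf_sum horner_sum -big_split /=.
by apply: eq_bigr => l _; rewrite !mxE derivM hornerD !hornerM.
Qed.

Lemma at0M (G H : 'M[{poly K}]_n) : at0 (G *m H) = at0 G *m at0 H.
Proof. exact: map_mxM. Qed.

Lemma deriv0C A : deriv0 (map_mx polyC A) = 0.
Proof. by apply/matrixP => i j; rewrite !mxE derivC horner0. Qed.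

Lemma at0C A : at0 (map_mx polyC A) = A.
Proof. by apply/matrixP => i j; rewrite !mxE /= horner_evalE hornerC. Qed.

Lemma deriv0Z p (G : 'M[{poly K}]_n) : deriv0 (p *: G) = p^`().[0] *: at0 G + p.[0] *: deriv0 G.
Proof. by apply/matrixP => i j; rewrite !mxE derivM hornerD !hornerM horner_evalE. Qed.

(* Differentiating [S L = det(L) L q0], where S is the image of the line L, avoids computing the
   derivative of the adjugate. *)
Lemma dPsiE b F : \det (triu b) != 0 ->
  dPsi b F = conjmx_by (triu b)
    ((\det (triu (mxline b F)))^`().[0] *: q0 +
     \det (triu b) *: mxcomm (invmx (triu b) *m triu F) q0).
Proof.
move=> d; have [ub _] := triu_borel d; rewrite dPsi_line.
set B := triu b in d ub *; set L := triu (mxline b F); set G := orbmx _ _.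
have LE : L = mxline B (triu F).
  by apply/matrixP => i j; rewrite !mxE; case: ifP => // _; rewrite polyC0 mulr0 addr0.
have GL : G *m L = \det L *: (L *m map_mx polyC q0).
  by rewrite /G /orbmx -/L -mulmxA mul_adj_mx mul_mx_scalar.
have aL : at0 L = B by rewrite LE at0_line.
have dL : deriv0 L = triu F by rewrite LE deriv0_line.
have detL : (\det L).[0] = \det B by rewrite -horner_evalE -det_map_mx -aL.
have aG : at0 G = \det B *: conjmx_by B q0.
  rewrite -psiE // /psi /at0 map_orbmx; congr orbmx; first exact: at0C.
  exact: at0_line.
have := congr1 (@deriv0 K n) GL;
  rewrite deriv0M deriv0Z deriv0M at0M deriv0C mulmx0 addr0 aL dL at0C detL aG.
move=> H; have {H} : deriv0 G *m B = (\det L)^`().[0] *: (B *m q0) + \det B *: (triu F *m q0) -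
    \det B *: conjmx_by B q0 *m triu F by rewrite -H addrK.
move=> /(canRL (mulmxK ub)) ->.
rewrite /conjmx_by mulmxDr mulmxDl -!scalemxAr -!scalemxAl mulmxBl mulmxDl -!scalemxAl -addrA.
congr (_ + _); rewrite /mxcomm mulmxBr mulmxBl scalerBr !mulmxA mulmxV // mul1mx //.
Qed.

End Parametrization.

(** * The transcendence degree of Z as the rank of the parametrization *)

Section OrbitDim.
Variables (K : closedFieldType) (n k : nat).
Hypothesis charK0 : [pchar K] =i pred0.
Hypothesis le_2k_n : (2 * k <= n)%N.
Variable v : 'S_n.
Hypothesis vC : incC k v.
Hypothesis v_moved : forall e, e \in inv_set v -> moved k e.
Implicit Types (A E F b u t : 'M[K]_n) (i j : 'I_n) (e : 'I_n * 'I_n).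
Local Notation x := (xk K n k).
Local Notation sh := (sh k).
Local Notation TY := (tangent (Y0 k) x).
Local Notation Z := (Zorb k v : 'M[K]_n -> Prop).
Local Notation cv := (conjmx_by (dotmx K v)).
Local Notation q0 := (cv x).
Local Notation pol := {mpoly K[n * n]}.
Local Notation orbit_tangent := (orbit_tangent K k v).
Local Notation D := (\dim TY + #|inv_set v|)%N.

Lemma triu1 : triu (1%:M : 'M[K]_n) = 1%:M.
Proof. by apply: triu_id => i j ji; rewrite mxE -val_eqE gtn_eqF. Qed.

Lemma deriv_prod0 (I : finType) (a : I -> K) :
  (\prod_i (1 + 'X * (a i)%:P))^`().[0] = \sum_i a i.
Proof.
suff H (r : seq I) : (\prod_(i <- r) (1 + 'X * (a i)%:P)).[0] = 1 /\
    (\prod_(i <- r) (1 + 'X * (a i)%:P))^`().[0] = \sum_(i <- r) a i.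
  by have [] := H (index_enum I).
elim: r => [|i r [IH1 IH2]]; first by rewrite !big_nil hornerE -polyC1 derivC horner0.
split; first by rewrite big_cons hornerM IH1 !hornerE; ring.
rewrite !big_cons derivM hornerD [X in X + _]hornerM [X in _ + X]hornerM IH1 IH2.
by rewrite derivD derivM derivX -polyC1 !derivC !hornerE; ring.
Qed.

Lemma dPsi1 F : upper F -> dPsi k v 1%:M F = (\tr F) *: q0 + mxcomm F q0.
Proof.
move=> uF; rewrite dPsiE // triu1 ?det1 ?oner_neq0 // conjmx_by1 invmx1 mul1mx scale1r (triu_id uF).
suff -> : (\det (triu (mxline 1%:M F)))^`().[0] = \tr F by [].
rewrite /mxtrace -deriv_prod0 triu_id; last first.
  move=> i j ji; rewrite !mxE uF // -val_eqE gtn_eqF // polyC0; ring.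
rewrite -det_tr det_trig; last first.
  by apply/is_trig_mxP => i j ji; rewrite !mxE uF // -val_eqE gtn_eqF // polyC0; ring.
by congr (_^`().[0]); apply: eq_bigr => i _; rewrite !mxE eqxx polyC1.
Qed.

(** The derivative in direction [E] is [E, q0] plus [\tr E] times [q0]. The diagonal matrix [H] has
    [H, q0] = q0 and trace [k], so a multiple of it removes the extra term, [1 + k] being nonzero in
    [K]. *)
Lemma dPsi1_surj w : w \in orbit_tangent -> exists F, dPsi k v 1%:M F = w.
Proof.
case/(orbit_tangent_comm charK0 le_2k_n vC) => E uE Ew.
pose H : 'M[K]_n := \matrix_(i, j) if i == j then (((v^-1)%g i < k)%N)%:R else 0.
have uH : upper H by move=> i j ji; rewrite mxE -val_eqE gtn_eqF.
have HE : mxcomm H q0 = q0.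
  have -> : H = cv (\matrix_(i, j) if i == j then ((i < k)%N)%:R else 0).
    by apply/matrixP => i j; rewrite conj_dotmxE !mxE (inj_eq (@perm_inj _ _)).
  rewrite -comm_conj; congr (conjmx_by _ _); apply/matrixP => i j.
  rewrite !mxE (bigD1 i) //= big1 ?addr0; last first.
    by move=> l li; rewrite !mxE eq_sym (negbTE li) mul0r.
  rewrite (bigD1 j) //= big1 ?addr0; last first.
    by move=> l lj; rewrite !mxE (negbTE lj) mulr0.
  rewrite !mxE !eqxx; case: (ltnP i k) => ik /=; last by rewrite !mul0r subr0.
  case: eqP => [E0|_]; last by rewrite mulr0 mul0r subr0.
  by rewrite ltnNge E0 (leq_trans _ (leq_addl _ _)) /= ?mulr0 ?subr0 ?mulr1 //; lia.
have trH : \tr H = k%:R.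
  have kn : (k <= n)%N by lia.
  rewrite /mxtrace (reindex_inj (@perm_inj _ v)) /=.
  rewrite (eq_bigr (fun i : 'I_n => if (i < k)%N then 1 else 0)); last first.
    by move=> i _; rewrite !mxE eqxx permK; case: ifP.
  by rewrite -big_mkcond /= (big_ord_narrow kn) /= sumr_const card_ord.
have k1 : 1 + k%:R != 0 :> K by rewrite -mulrS natr_eq0.
pose c := - \tr E / (1 + k%:R).
exists (E + c *: H); rewrite dPsi1; last by move=> i j ji;
  rewrite mxE [X in _ + X]mxE uE // uH // mulr0 addr0.
rewrite mxtraceD mxtraceZ trH commDl commZl HE Ew [w + _]addrC addrA -scalerDl.
have -> : \tr E + c * k%:R + c = \tr E + c * (1 + k%:R) by ring.
by rewrite divfK // subrr scale0r add0r.
Qed.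

Lemma psi1 : psi k v (1%:M : 'M[K]_n) = q0.
Proof. by rewrite psiE // triu1 det1 ?oner_neq0 // scale1r conjmx_by1. Qed.

Lemma orbit_tangent_sub : (orbit_tangent <= tangent Z q0)%VS.
Proof.
apply/subvP => w /dPsi1_surj[F <-]; apply/tangentP => f /(vanish_Zset le_2k_n).
move/(vanish_Psi charK0 le_2k_n) => f0; have := mxcomp_diff f (Psi K k v) 1%:M F.
by rewrite Psi_eval psi1 f0 -mpolyC0 mxdiffC.
Qed.

Lemma dim_tangent_ge q : Z q -> (D <= \dim (tangent Z q))%N.
Proof.
case=> _ qZ; apply: (tangent_semicontinuous qZ) => u /BorbitE[b bb ->].
have [ub _] := bb; rewrite -(dim_orbit_tangent charK0 le_2k_n v_moved).
apply: leq_trans (dimvS orbit_tangent_sub) (dim_tangent_conj _ ub _) => u'.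
exact: Zset_conj.
Qed.

Lemma mxcomp_family m (f : 'I_m -> pol) (P : {mpoly K[m]}) :
  psubst (fun l => mxcomp (f l) (Psi K k v)) P = mxcomp (psubst f P) (Psi K k v).
Proof.
rewrite /mxcomp [in RHS]/psubst mmap_comp; apply: mmap_eq_supp => // c.
by rewrite /= mmapC.
Qed.

(** A polynomial vanishes on Z if and only if its composition with [Psi] is zero, so pulling back
    embeds the coordinate ring of the closure of Z into a polynomial ring. *)
Lemma indep_Zset m (f : 'I_m -> pol) : alg_indep_on Z f <->
  pindep (fun l => mxcomp (f l) (Psi K k v)).
Proof.
split=> h P hP; last first.
  apply: h; rewrite mxcomp_family; apply/vanish_Psi => // u uO.
  by rewrite /mxeval psubst_eval; apply: hP; split; [exact: Borbit_Ok uO|move=> g; apply].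
apply: h => A [_ AZ]; have /AZ : vanishes_on (Borbit k v) (psubst f P).
  by apply/vanish_Psi => //; rewrite -mxcomp_family.
by rewrite /mxeval psubst_eval.
Qed.

Lemma mxdiff_sum m (f : pol) A (a : 'I_m -> K) (w : 'I_m -> 'M[K]_n) :
  mxdiff f A (\sum_l a l *: w l) = \sum_l a l * mxdiff f A (w l).
Proof.
rewrite /mxdiff; under [RHS]eq_bigr => l _ do rewrite mulr_sumr.
rewrite exchange_big /=; apply: eq_bigr => i _.
rewrite linear_sum /= summxE mulr_sumr; apply: eq_bigr => l _.
by rewrite linearZ /= mxE; ring.
Qed.

(** Linear forms dual to a basis of [orbit_tangent]: their pull-backs have Jacobian matrix of full
    rank at the identity, since [dPsi] maps onto [orbit_tangent] there. *)
Lemma has_dim_lower : exists f : 'I_D -> pol, alg_indep_on Z f.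
Proof.
rewrite -(dim_orbit_tangent charK0 le_2k_n v_moved).
pose B : 'M[K]_(\dim orbit_tangent, n * n) := \matrix_i mxvec (vbasis orbit_tangent)`_i.
have freeB : row_free B.
  rewrite -kermx_eq0; apply/rowV0P => c /sub_kermxP cB.
  have sum0 : \sum_(i < \dim orbit_tangent) c 0 i *: (vbasis orbit_tangent)`_i = 0.
    apply: (can_inj mxvecK); rewrite linear0 linear_sum /= -[RHS]cB.
    apply/rowP => j; rewrite summxE !mxE; apply: eq_bigr => i _.
    by rewrite linearZ /= !mxE.
  have /freeP := basis_free (vbasisP orbit_tangent); move=> /(_ (fun l => c 0 l) sum0) c0.
  by apply/rowP => i; rewrite mxE c0.
have /row_freeP[Q BQ] := freeB.
pose f (l : 'I_(\dim orbit_tangent)) : pol := \sum_i Q i l *: 'X_i.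
have df l A w : mxdiff (f l) A w = (mxvec w *m Q) 0 l.
  rewrite /mxdiff mxE; apply: eq_bigr => i _; rewrite mulrC; congr (_ * _).
  rewrite /f raddf_sum (bigD1 i) //= mderivZ mderivX mnm1E eqxx big1 ?addr0.
    have -> : (U_(i) - U_(i) = 0 :> 'X_{1..(n * n)})%MM by apply/mnmP => j; rewrite !mnmE subnn.
    by rewrite mpolyX0 scale1r /mxeval mevalZ meval1 mulr1.
  by move=> j ji; rewrite mderivZ mderivX mnm1E (negbTE ji) scale0r scaler0.
exists f; apply/indep_Zset.
refine (jac_pindep charK0 (x := fun a => mxvec (1%:M : 'M[K]_n) 0 a) _).
have /choice[F FE] : forall l : 'I_(\dim orbit_tangent), exists F,
  dPsi k v 1%:M F = (vbasis orbit_tangent)`_l.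
  by move=> l; apply: dPsi1_surj; apply: vbasis_mem; rewrite mem_nth ?size_tuple.
apply/row_freeP; exists (\matrix_(i, l) mxvec (F l) 0 i).
apply/matrixP => a l; rewrite !mxE.
transitivity (mxdiff (mxcomp (f a) (Psi K k v)) 1%:M (F l)).
  by apply: eq_bigr => i _; rewrite !mxE.
rewrite mxcomp_diff -/(dPsi k v 1%:M (F l)) FE df.
have := congr1 (fun C : 'M_(_) => C l a) BQ; rewrite [RHS]mxE eq_sym => <-.
by rewrite !mxE; apply: eq_bigr => i _; rewrite !mxE.
Qed.

(** At some [b] with invertible triangular part the Jacobian matrix of the pull-backs has rank [m],
    yet it factors through the image of [dPsi], which lies in a conjugate of [orbit_tangent]. *)
Lemma has_dim_upper m (f : 'I_m -> pol) : alg_indep_on Z f -> (m <= D)%N.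
Proof.
move/indep_Zset => /(pindep_jac charK0)/(_ (detT_neq0 K n))[p dp fr].
have [b bE] := ptE p; rewrite bE detT_eval in dp.
have [ub hb] := triu_borel dp.
rewrite -(dim_orbit_tangent charK0 le_2k_n v_moved) -(dim_conj orbit_tangent ub).
set V' := (linfun _ @: orbit_tangent)%VS; rewrite leqNgt; apply/negP => lt.
pose A : 'M[K]_(m, \dim V') := \matrix_(i, l) mxdiff (f i) (psi k v b) (vbasis V')`_l.
have : kermx A != 0.
  by rewrite kermx_eq0 /row_free; apply/negP => /eqP e; have := rank_leq_col A; rewrite e leqNgt lt.
case/rowV0Pn => c /sub_kermxP cA cn0.
have cV w : w \in V' -> \sum_i c 0 i * mxdiff (f i) (psi k v b) w = 0.
  move=> wV; rewrite (coord_vbasis wV).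
  under eq_bigr => i _ do rewrite mxdiff_sum mulr_sumr.
  rewrite exchange_big big1 //= => l _.
  have := congr1 (fun C : 'rV_ _ => C 0 l) cA; rewrite [RHS]mxE => e.
  transitivity (coord (vbasis V') l w * (c *m A) 0 l); last by rewrite e mulr0.
  by rewrite mxE mulr_sumr; apply: eq_bigr => i _; rewrite mxE; ring.
have FV F : dPsi k v b F \in V'.
  rewrite dPsiE //; apply/memv_imgP; eexists; last by rewrite lfunE.
  apply: memvD; apply: memvZ; first exact: q0_orbit_tangent.
  apply: comm_orbit_tangent => // i j ji.
  have [_ hi] := borelV (triu_borel dp).
  rewrite mxE big1 // => l _; have [li|il] := ltnP l i; first by rewrite hi ?mul0r.
  by rewrite triu_upper ?mulr0 // (leq_trans ji).
case/eqP: cn0; have /row_freeP[R JR] := fr.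
suff cJ : c *m jac (fun l => mxcomp (f l) (Psi K k v)) p = 0.
  by rewrite -[c]mulmx1 -JR mulmxA cJ mul0mx.
apply/rowP => j; rewrite !mxE.
have := cV _ (FV (vec_mx (delta_mx 0 j))) => h; rewrite -[RHS]h.
apply: eq_bigr => i _; congr (_ * _); rewrite mxE bE.
rewrite -Psi_eval -mxcomp_diff /mxdiff vec_mxK (bigD1 j) //= mxE !eqxx mulr1 big1 ?addr0 //.
by move=> l lj; rewrite mxE (negbTE lj) mulr0.
Qed.

Lemma has_dim_Z : has_dim Z D.
Proof. by split; [exact: has_dim_lower|exact: has_dim_upper]. Qed.

End OrbitDim.

(** * The theorem *)

Section ZkWk.
Variables n k : nat.
Hypothesis le_2k_n : (2 * k <= n)%N.
Variables s a : 'S_n.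
Hypothesis Zs : s \in Zk n k.
Hypothesis Wa : a \in Wk n k.

Lemma Wk_lt (i : 'I_n) : (a i < k)%N = (i < k)%N.
Proof.
have fixk := WkP le_2k_n Wa; apply/idP/idP => h; rewrite ltnNge; apply/negP => le.
  by move: h; rewrite fixk // ltnNge le.
have := fixk (a i) le => /perm_inj E; by rewrite E leqNgt h in le.
Qed.

Lemma wcomp_incC : incC k (wcomp s a).
Proof.
move=> i j iC ij; rewrite !wcompE !(WkP le_2k_n Wa); try lia.
by apply: (ZkP le_2k_n Zs) => //; rewrite /same_block; lia.
Qed.

Lemma wcomp_inv_moved e : e \in inv_set (wcomp s a) -> moved k e.
Proof.
case: e => i j; rewrite inE /moved /= !wcompE => /andP[lt h]; rewrite lt /=.
have [//|jk] := ltnP j k; apply/negP => sb; move: h; rewrite ltnNge => /negP; apply; apply: ltnW.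
have ik : (k <= i)%N by move: sb; rewrite /same_block; lia.
by rewrite !(WkP le_2k_n Wa) //; apply: (ZkP le_2k_n Zs).
Qed.

(** Inversions [e] of the product with [e.2 < k] are those of [a], since [s] increases on the first
    block; those with [k <= e.2] correspond through [a] to the inversions of [s]. *)
Lemma coxlen_wcomp : #|inv_set (wcomp s a)| = (coxlen s + coxlen a)%N.
Proof.
rewrite !coxlen_inv; pose f (e : 'I_n * 'I_n) := (a e.1, a e.2).
have finj : injective f by move=> [i j] [i' j'] [/perm_inj -> /perm_inj ->].
have aA (e : 'I_n * 'I_n) : e \in inv_set a -> (e.2 < k)%N.
  rewrite inE => /andP[lt h]; rewrite ltnNge; apply/negP => e2k; move: h.
  rewrite (WkP le_2k_n Wa e2k) ltnNge => /negP; apply.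
  have [e1k|e1k] := ltnP e.1 k; last by rewrite (WkP le_2k_n Wa e1k) ltnW.
  by have := Wk_lt e.1; rewrite e1k; lia.
have sA (e : 'I_n * 'I_n) : e \in inv_set s -> (k <= e.2)%N.
  rewrite inE => /andP[lt h]; rewrite leqNgt; apply/negP => e2k; move: h.
  by rewrite ltnNge => /negP; apply; apply/ltnW/(ZkP le_2k_n Zs) => //; rewrite /same_block; lia.
have smon (i j : 'I_n) : (i < k)%N -> (j < k)%N -> (s i < s j)%N = (i < j)%N.
  move=> ik jk; have sb : same_block k i j by rewrite /same_block; lia.
  have sb' : same_block k j i by rewrite /same_block; lia.
  have [ij|ji|/val_inj->] := ltngtP i j; rewrite ?ltnn //; first exact: (ZkP le_2k_n Zs).
  by apply/negbTE; rewrite -leqNgt; apply/ltnW/(ZkP le_2k_n Zs).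
have order (i j : 'I_n) : (k <= j)%N -> (a i < a j)%N = (i < j)%N.
  move=> kj; rewrite (WkP le_2k_n Wa kj); have [ik|ik] := ltnP i k;
    last by rewrite (WkP le_2k_n Wa ik).
  by have := Wk_lt i; rewrite ik; lia.
rewrite -(cardsID [set e : 'I_n * 'I_n | (k <= e.2)%N]); congr (_ + _)%N.
  rewrite -(card_imset _ finj); apply: eq_card => -[i j]; apply/imsetP/idP.
    move=> [[i' j']]; rewrite !inE /= !wcompE => /andP[/andP[ij h] kj] [-> ->].
    by rewrite /= h order // ij.
  move=> ijs; have kj : (k <= j)%N := sA _ ijs; have aj := WkP le_2k_n Wa kj.
  move: ijs; rewrite inE /= => /andP[ij h].
  exists ((a^-1)%g i, j); last by rewrite /f /= permKV aj.
  by rewrite !inE /= !wcompE permKV aj h kj !andbT -order // permKV aj.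
apply: eq_card => -[i j]; rewrite !inE /= -ltnNge !wcompE.
have [jk|jk] := ltnP j k; last first.
  by apply/esym/negP => h; have := @aA (i, j); rewrite inE /= h => /(_ isT); lia.
case ij: (i < j)%N => //=; rewrite smon ?Wk_lt //; lia.
Qed.

End ZkWk.

Theorem corollary6p12 (K : closedFieldType) (charK0 : [pchar K] =i pred0)
    (n k : nat) (le_2k_n : (2 * k <= n)%N)
    (sigma alpha : 'S_n)
    (Zsigma : sigma \in Zk n k) (Walpha : alpha \in Wk n k)
    (Zn : forall u : 'M[K]_n, Zvar k sigma alpha u -> strictly_upper u) :
  (directv (tangent (Y0 k) (xk K n k) +
            \sum_(e in tk K k sigma alpha) tangent (Ccurve k e) (xk K n k))%VS /\
   (tangent (Y0 k) (xk K n k) +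
      \sum_(e in tk K k sigma alpha) tangent (Ccurve k e) (xk K n k))%VS
     = tangent (Zvar k sigma alpha) (xk K n k)) /\
  (regular_variety (Zvar k sigma alpha : 'M[K]_n -> Prop) <->
     #|tk K k sigma alpha| = (coxlen sigma + coxlen alpha)%N).
Proof.
set v := wcomp sigma alpha.
have vC : incC k v := wcomp_incC le_2k_n Zsigma Walpha.
have vm := wcomp_inv_moved le_2k_n Zsigma Walpha.
have [dV eV dimT] := tangent_Z_sum charK0 le_2k_n vC Zn.
split; first by [].
rewrite -(coxlen_wcomp le_2k_n Zsigma Walpha) -/v.
have [ex ub] := has_dim_Z charK0 le_2k_n vC vm.
have Zx := Zset_xk charK0 le_2k_n vC.
split=> [reg|card_tk q Zq].
  (* [has_dim] determines its value: an independent family realizing one candidate bounds it by the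
     other. *)
  have [[f fi] ub'] := reg _ Zx; have [g gi] := ex.
  by have := ub _ _ fi; have := ub' _ _ gi; rewrite dimT -/(tk K k sigma alpha); lia.
suff -> : \dim (tangent (Zvar k sigma alpha) q) = (\dim (tangent (Y0 k) (xk K n k)) + #|inv_set
  v|)%N.
  by [].
apply/eqP; rewrite eqn_leq (dim_tangent_ge charK0 le_2k_n vC vm Zq) andbT -card_tk -dimT.
have [qO _] := Zq; have [w wC wq] := Ok_Borbit le_2k_n qO.
(* Conjugation by B maps Z to itself, so tangent spaces along the orbit of [q] are at least as large
   as that at [q], and [x] lies in the closure of this orbit. *)
apply: (tangent_semicontinuous (S := Borbit k w)) => [f fw|q' q'w].
  apply: (bruhat_orbit charK0 le_2k_n wC (bruhat1 w) fw); exact: BBset_xk.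
have /BorbitE[b bb qE] := wq; have /BorbitE[b' bb' ->] := q'w.
have [ub1 _] := bb; have [ub2 _] := bb'.
have bbb : borel (b' *m invmx b) by apply: borelM => //; apply: borelV.
have [ubb _] := bbb.
have -> : conjmx_by b' (conjmx_by (dotmx K w) (xk K n k)) = conjmx_by (b' *m invmx b) q.
  by rewrite qE (conjmx_byM _ ubb ub1) mulmxKV.
apply: (dim_tangent_conj q ubb) => u; exact: (Zset_conj (v := v)).
Qed.
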